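(* Let $0<\theta,\alpha<1$ and $1\le r,\kappa\le\infty$ be such that $\frac1r+\frac1\kappa=1$. If $u\in L^{2r}_t(C^\theta_x)$ is a weak solution of the incompressible Euler equations on $\mathbb{T}^3\times(0,\infty)$ such that $\omega:=\operatorname{curl}u\in L^\kappa_t(W^{\alpha,1}_x)$, where $2\theta+\alpha\ge1$, then the helicity $H(t)=\int_{\mathbb{T}^3}u(x,t)\cdot\omega(x,t)\,dx$ is constant in time.
   Context: $\mathbb{T}^3=\mathbb{R}^3/\mathbb{Z}^3$ is the three-dimensional flat torus. The incompressible Euler equations for a velocity $u:\mathbb{T}^3\times(0,\infty)\to\mathbb{R}^3$ and a pressure $p:\mathbb{T}^3\times(0,\infty)\to\mathbb{R}$ are $$\partial_t u+\operatorname{div}(u\otimes u)+\nabla p=0,\qquad \operatorname{div}u=0.$$ A weak solution is a vector field $u$ satisfying these equations in the sense of distributions on $\mathbb{T}^3\times(0,\infty)$ for some distribution $p$. For $0<\theta,\alpha<1$, the spatial norms are $\|f\|_{C^\theta}=\sup_x|f(x)|+\sup_{x\ne y}\frac{|f(x)-f(y)|}{|x-y|^\theta}$ and $$\|f\|_{W^{\alpha,1}}=\|f\|_{L^1}+\int_{\mathbb{T}^3}\int_{\mathbb{T}^3}\frac{|f(x)-f(y)|}{|x-y|^{\alpha+3}}\,dx\,dy.$$ For a spatial Banach space $X$, $L^s_t(X_x)$ is the space of time-dependent functions $f$ on $(0,\infty)$ with $\|f\|_{L^s_t(X_x)}=\big(\int_0^\infty\|f(t)\|_X^s\,dt\big)^{1/s}<\infty$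 if $s<\infty$, and with $\operatorname{ess\,sup}_{t>0}\|f(t)\|_X<\infty$ if $s=\infty$. The helicity $H(t)$ is defined for almost every $t$; ''constant'' means that $H$ agrees with a constant for almost every $t$. *)

(* Defs.v *)
From HB Require Import structures.
From mathcomp Require Import all_boot all_order all_algebra.
From mathcomp Require Import all_classical all_reals all_analysis.

Set Implicit Arguments.
Unset Strict Implicit.
Unset Printing Implicit Defensive.

Import Order.TTheory GRing.Theory Num.Theory.
Import numFieldNormedType.Exports.

Local Open Scope classical_set_scope.
Local Open Scope ring_scope.

(* The library's product measure m1 \x m2.  The library also proves that it is
   sigma-finite, but does not make this available by type inference. *)
Section SigmaFiniteProduct.
Context d1 d2 (T1 : measurableType d1) (T2 : measurableType d2) (R : realType).
Variable m1 : {sigma_finite_measure set T1 -> \bar R}.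
Variable m2 : {sigma_finite_measure set T2 -> \bar R}.
Local Open Scope ereal_scope.

Definition sfprod : set (T1 * T2) -> \bar R := m1 \x m2.

HB.instance Definition _ := Measure.on sfprod.

Let sfprod_sigma_finite : sigma_finite setT sfprod.
Proof.
have /sigma_finiteP[F [TF ndF Foo]] := sigma_finiteT m1.
have /sigma_finiteP[G [TG ndG Goo]] := sigma_finiteT m2.
exists (fun n => F n `*` G n).
  rewrite -setXTT TF TG predeqE => -[x y]; split.
    move=> [/= [n _ Fnx] [k _ Gky]]; exists (maxn n k) => //; split.
    - by move: x Fnx; exact/subsetPset/ndF/leq_maxl.
    - by move: y Gky; exact/subsetPset/ndG/leq_maxr.
  by move=> [n _ []/= ? ?]; split; exists n.
move=> k; have [? ?] := Foo k; have [? ?] := Goo k.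
split; first exact: measurableX.
by rewrite /sfprod product_measure1E// lte_mul_pinfty// ge0_fin_numE.
Qed.

HB.instance Definition _ :=
  Measure_isSigmaFinite.Build _ _ _ sfprod sfprod_sigma_finite.

End SigmaFiniteProduct.
(* R^3 is R * R * R, so that the library's product topology, norm (the sup
   norm, used here only for its topology) and product measure apply.
   A function on the torus T^3 = R^3 / Z^3 is a Z^3-periodic function on R^3. *)
Notation vec R := (R * R * R)%type.

Section Torus.
Context {R : realType}.
Implicit Types (x y : vec R) (i : 'I_3).

Definition coord3 x i : R :=
  if i == 0 then x.1.1 else if i == 1 then x.1.2 else x.2.

Definition basis3 i : vec R := ((i == 0)%:R, (i == 1)%:R, (i == 2)%:R).

Definition dotp x y : R := \sum_i coord3 x i * coord3 y i.

Definition enorm x : R := Num.sqrt (dotp x x).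

Definition zvec (k : int * int * int) : vec R :=
  (k.1.1%:~R, k.1.2%:~R, k.2%:~R).

Definition z_periodic (T : Type) (f : vec R -> T) : Prop :=
  forall x k, f (x + zvec k) = f x.

Definition same_point x y : Prop := exists k, x = y + zvec k.

Definition tdist x y : R := inf [set enorm (x - y + zvec k) | k in setT].

Definition cell : set (vec R) := [set x | forall i, 0 <= coord3 x i < 1].

(* Lebesgue measure on R^3 and on R^3 x R; the measure of T^3 is the former
   restricted to the fundamental cell. *)
Definition leb3 : {sigma_finite_measure set _ -> \bar R} :=
  sfprod (sfprod (@lebesgue_measure R) (@lebesgue_measure R))
    (@lebesgue_measure R).

Definition leb4 : {sigma_finite_measure set _ -> \bar R} :=
  sfprod leb3 (@lebesgue_measure R).

Definition spacetime : set (vec R * R) := [set z | cell z.1 /\ 0 < z.2].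

End Torus.

Section FunctionSpaces.
Context {R : realType}.
Implicit Types (f : vec R -> vec R) (u : R -> vec R -> vec R).
Local Open Scope ereal_scope.

Definition holder_norm (theta : R) f : \bar R :=
  ereal_sup [set (enorm (f x))%:E | x in setT] +
  ereal_sup [set (enorm (f z.1 - f z.2) / tdist z.1 z.2 `^ theta)%R%:E
            | z in [set z | ~ same_point z.1 z.2]].

(* On the null set where tdist x y = 0 the quotient is 0, as r / 0 = 0. *)
Definition sobolev_norm (alpha : R) f : \bar R :=
  \int[leb3]_(x in cell) (enorm (f x))%:E +
  \int[leb3]_(x in cell) \int[leb3]_(y in cell)
    (enorm (f x - f y) / tdist x y `^ (alpha + 3))%R%:E.

(* Values at times t <= 0 are never used. *)
Definition torus_field u : Prop :=
  (forall t, (0 < t)%R -> z_periodic (u t)) /\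
  measurable_fun ([set z | (0 < z.2)%R] : set (vec R * R))
    (fun z : vec R * R => u z.2 z.1).

(* u belongs to L^s_t(X_x) on (0, oo), where X is the space of functions with
   N f < +oo: u is jointly measurable, takes its values in X for a.e. t, and
   its norm is finite. *)
Definition in_Lt (s : \bar R) (N : (vec R -> vec R) -> \bar R) u : Prop :=
  [/\ torus_field u,
      {ae @lebesgue_measure R, forall t, (0 < t)%R -> N (u t) < +oo} &
      'N[@lebesgue_measure R]_s[(fun t => N (u t)) \_ `]0%R, +oo[] < +oo].

End FunctionSpaces.

Section Distributions.
Context {R : realType}.
Implicit Types (phi psi : vec R * R -> R) (u w : R -> vec R -> vec R).

(* None stands for the time variable, Some i for the i-th space variable. *)
Definition dir (o : option 'I_3) : vec R * R :=
  if o is Some i then (basis3 i, 0) else (0, 1).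

Definition partial (o : option 'I_3) phi : vec R * R -> R :=
  fun z => 'D_(dir o) phi z.

Definition partials (s : seq (option 'I_3)) phi : vec R * R -> R :=
  foldr partial phi s.

Definition smooth phi : Prop := forall s,
  continuous (partials s phi) /\
  forall o z, derivable (partials s phi) z (dir o).

Definition time_support (a b : R) phi : Prop :=
  forall x t, phi (x, t) != 0 -> a <= t <= b.

(* Elements of C_c^oo(T^3 x (0, oo)), extended by 0 to times t <= 0. *)
Definition test_function phi : Prop :=
  [/\ smooth phi, forall t, z_periodic (fun x => phi (x, t)) &
      exists a b : R, [/\ 0 < a, a < b & time_support a b phi]].

(* A distribution on T^3 x (0, oo): only the values of p at test functions
   matter.  Continuity is the usual seminorm estimate on each compact set
   T^3 x [a, b], with M any bound for the C^N norm of phi. *)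
Definition distribution_on_torus (p : (vec R * R -> R) -> R) : Prop :=
  (forall (c : R) phi psi, test_function phi -> test_function psi ->
     p (fun z => c * phi z + psi z) = c * p phi + p psi) /\
  (forall a b : R, 0 < a -> a < b ->
     exists (N : nat) (C : R), forall phi (M : R),
       test_function phi -> time_support a b phi ->
       (forall s z, (size s <= N)%N -> `|partials s phi z| <= M) ->
       `|p phi| <= C * M).

(* \int_0^oo \int_{T^3} g(x, t) dx dt *)
Definition pairing (g : vec R * R -> R) : R :=
  Rintegral leb4 spacetime g.

(* The i-th equation is d_t u_i + sum_j d_j (u_i u_j) + d_i p = 0, tested
   against phi; all derivatives move to phi with a minus sign.  This is
   meaningful for u locally square integrable. *)
Definition euler_weak_solution u : Prop :=
  (exists p, distribution_on_torus p /\
     forall phi (i : 'I_3), test_function phi ->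
       pairing (fun z => coord3 (u z.2 z.1) i * partial None phi z +
         \sum_j coord3 (u z.2 z.1) i * coord3 (u z.2 z.1) j *
                partial (Some j) phi z)
       + p (partial (Some i) phi) = 0) /\
  (forall phi, test_function phi ->
     pairing (fun z => \sum_j coord3 (u z.2 z.1) j * partial (Some j) phi z)
     = 0).

(* w = curl u as distributions: w_i = d_{i+1} u_{i+2} - d_{i+2} u_{i+1}, where
   the indices in 'I_3 are added modulo 3. *)
Definition is_curl u w : Prop :=
  forall phi (i : 'I_3), test_function phi ->
    pairing (fun z => coord3 (w z.2 z.1) i * phi z) =
    - pairing (fun z =>
        coord3 (u z.2 z.1) (i + 2) * partial (Some (i + 1)) phi z -
        coord3 (u z.2 z.1) (i + 1) * partial (Some (i + 2)) phi z).

Definition helicity u w (t : R) : \bar R :=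
  \int[leb3]_(x in cell) (dotp (u t x) (w t x))%:E.

End Distributions.

(* Main.v *)
Require Import Defs.
From HB Require Import structures.
From mathcomp Require Import all_boot all_order all_algebra.
From mathcomp Require Import ring lra.
From mathcomp Require Import all_classical all_reals all_analysis.
From mathcomp Require Import measurable_realfun ess_sup_inf.

Set Implicit Arguments.
Unset Strict Implicit.
Unset Printing Implicit Defensive.

Import Order.TTheory GRing.Theory Num.Theory.
Import numFieldNormedType.Exports.

Local Open Scope classical_set_scope.
Local Open Scope ring_scope.

(** The mollified helicity.  Let [K_N(x, y)] be the product over the three
    coordinates of [c_N cos(pi (x_i - y_i))^(2N + 2)].  It is nonnegative, has
    integral 1 in [y] and concentrates on the diagonal of the torus at scale
    [N^(-1/2)]; by the binomial theorem it is also a finite sum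
    [sum_J C_J E_J(x) E_J(y)].  So, with [U_J] and [W_J] the vectors of integrals
    of [u] and [omega] against [E_J],
      [F_N(t) = sum_J C_J U_J(t) . W_J(t)
              = int int K_N(x, y) u(x, t) . omega(y, t) dx dy]
    involves finitely many functions of time, and it tends to the helicity for
    almost every [t] ([hel_cvg]).

    Evolution of [F_N].  The equations are only tested with products
    [chi(t) E(x)].  Taking [E] to be a derivative of [E_J] and combining two
    momentum equations as in a curl removes the pressure ([vmoment_weak]), so
    that [W_J] has a locally integrable derivative in time ([du_bois_reymond],
    [moment_evolution]).  Nothing of the kind is known for [U_J]; but the curl
    is symmetric, hence [U(t) . W(s)] and [U(s) . W(t)] have equal sums over
    [J] ([hel_sym]), and [F_N(t) - F_N(s)] is the sum of
    [C_J (U_J(t) + U_J(s)) . (W_J(t) - W_J(s))].  Moving the curl to the other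
    factor ([stress_duality]) makes it the sum of [W_J(t) + W_J(s)] against the
    time integral over [s, t] of the stress [u (x) u] paired with
    [C_J grad E_J].  Refining the time interval ([partition_lemma]) gives
      [F_N(t) - F_N(s) = 2 int_s^t flux_N],
      [flux_N = sum_{i,j} int u_i u_j d_j (K_N * omega_i) dx].

    The flux vanishes.  At a fixed time put
      [D_j(f, g, h) = int int d_j K_N(x, y) (f(x) - f(y)) (g(x) - g(y))
                                          (h(x) - h(y)) dx dy].
    Because [u] and [omega] are divergence free and [omega = curl u], expanding
    the products and using the Lamb form of the transport term gives
      [flux_N = (sum_{i,j} D_j(u_i, u_i, omega_j)) / 8
              - (sum_{i,j} D_j(u_j, u_i, omega_i)) / 4]
    ([flux_increments]); this is where the structure of the helicity enters.  As
    the distance on the torus is bounded, the Hoelder exponent may be lowered to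
    [(1 - alpha) / 2].  Then two increments of [u] and the kernel of the
    [W^(alpha,1)] seminorm of [omega] leave the weight [|d_j K_N| |x - y|^4],
    which is bounded uniformly in [N] and tends to 0 off the diagonal
    ([dKern_weight]).  By dominated convergence [flux_N(t)] tends to 0, and it is
    at most a constant times [|u(t)|^2_(C^theta) |omega(t)|_(W^(alpha,1))]
    ([flux_le], [flux_cvg0]), which is integrable on compact time intervals by
    Hoelder's inequality ([Lcontrol_mul]).  Hence the increments of [F_N] tend
    to 0 ([helicity_conserved]).

    The norms need not be measurable in time: only measurable minorants of them
    that still control the increments are used ([holder_majorant],
    [sobolev_majorant]). *)

(** * Smooth functions of one real variable *)

Section SmoothReal.
Context {R : realType}.
Implicit Types (f g : R -> R).

Lemma is_derive1D f g (x a b : R) : is_derive x 1 f a -> is_derive x 1 g b ->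
  is_derive x 1 (fun y => f y + g y) (a + b).
Proof. exact: is_deriveD. Qed.

Lemma is_derive1M f g (x a b : R) : is_derive x 1 f a -> is_derive x 1 g b ->
  is_derive x 1 (fun y => f y * g y) (f x * b + g x * a).
Proof. exact: is_deriveM. Qed.

Lemma is_derive1Z f (c x a : R) : is_derive x 1 f a ->
  is_derive x 1 (fun y => c * f y) (c * a).
Proof. exact: is_deriveZ. Qed.

Lemma is_derive1V f (x a : R) : f x != 0 -> is_derive x 1 f a ->
  is_derive x 1 (fun y => (f y)^-1) (- f x ^- 2 * a).
Proof. exact: is_deriveV. Qed.

Lemma is_derive1N f (x a : R) : is_derive x 1 f a ->
  is_derive x 1 (fun y => - f y) (- a).
Proof. exact: is_deriveN. Qed.

(** Smoothness is membership in some class of differentiable functions that is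
    closed under derivation: a coinductive definition, proved for a function by
    exhibiting such a class. *)
Definition smooth1 f : Prop := exists C : set (R -> R), C f /\
  forall g, C g -> (forall x : R, derivable g x 1) /\ C (derive1 g).

Lemma smooth1_derivable f : smooth1 f -> forall x : R, derivable f x 1.
Proof. by move=> [C [Cf /(_ _ Cf)[]]]. Qed.

Lemma smooth1_derive f : smooth1 f -> smooth1 (derive1 f).
Proof. by move=> [C [Cf CP]]; exists C; split => //; case: (CP _ Cf). Qed.

Lemma smooth1_is_derive f (x : R) : smooth1 f -> is_derive x 1 f (derive1 f x).
Proof.
by move=> sf; split; [exact: smooth1_derivable|rewrite derive1E].
Qed.

Lemma smooth1_continuous f : smooth1 f -> continuous f.
Proof.
move=> sf x; apply/differentiable_continuous/derivable1_diffP.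
exact: smooth1_derivable.
Qed.

Lemma is_derive1_eq f (f' : R -> R) : (forall x : R, is_derive x 1 f (f' x)) ->
  derive1 f = f'.
Proof. by move=> h; apply/funext => x; rewrite derive1E; apply: derive_val. Qed.

(** The closure of the smooth functions under the field operations is again a
    class closed under derivation. *)
Inductive smooth_gen : (R -> R) -> Prop :=
| gen_base f : smooth1 f -> smooth_gen f
| gen_add f g : smooth_gen f -> smooth_gen g -> smooth_gen (fun x => f x + g x)
| gen_mul f g : smooth_gen f -> smooth_gen g -> smooth_gen (fun x => f x * g x)
| gen_inv f : smooth_gen f -> (forall x, f x != 0) ->
    smooth_gen (fun x => (f x)^-1).

Lemma smooth1_cst (c : R) : smooth1 (fun=> c).
Proof.
exists [set f | exists c, f = fun=> c]; split; first by exists c.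
move=> _ [d ->]; split; first by move=> x; exact: derivable_cst.
by exists 0; apply: is_derive1_eq => x; exact: is_derive_cst.
Qed.

Lemma smooth_gen_derive f : smooth_gen f ->
  exists2 f', (forall x : R, is_derive x 1 f (f' x)) & smooth_gen f'.
Proof.
elim=> {f} [f sf|f g _ [f' df sf] _ [g' dg sg]|f g gf [f' df sf] gg [g' dg sg]
  |f gf [f' df sf] f0].
- exists (derive1 f); last exact/gen_base/smooth1_derive.
  by move=> x; exact: smooth1_is_derive.
- exists (fun x => f' x + g' x); last exact: gen_add.
  by move=> x; exact: is_derive1D.
- exists (fun x => f x * g' x + g x * f' x).
    by move=> x; exact: is_derive1M.
  by apply: gen_add; exact: gen_mul.
- exists (fun x => -1 * ((f x)^-1 * (f x)^-1) * f' x).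
    move=> x; have h := is_derive1V (f0 x) (df x).
    apply: is_derive_eq h _.
    by rewrite mulN1r -expr2 exprVn.
  apply: gen_mul => //; apply: gen_mul; first exact/gen_base/smooth1_cst.
  by apply: gen_mul; exact: gen_inv.
Qed.

Lemma smooth1_gen f : smooth_gen f -> smooth1 f.
Proof.
move=> sf; exists smooth_gen; split => // g /smooth_gen_derive[g' dg sg].
by split; [move=> x; exact: (@ex_derive _ _ _ _ _ _ _ (dg x))|rewrite (is_derive1_eq dg)].
Qed.

Lemma smooth1D f g : smooth1 f -> smooth1 g -> smooth1 (fun x => f x + g x).
Proof. by move=> sf sg; apply/smooth1_gen/gen_add; exact: gen_base. Qed.

Lemma smooth1M f g : smooth1 f -> smooth1 g -> smooth1 (fun x => f x * g x).
Proof. by move=> sf sg; apply/smooth1_gen/gen_mul; exact: gen_base. Qed.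

Lemma smooth1V f : smooth1 f -> (forall x, f x != 0) ->
  smooth1 (fun x => (f x)^-1).
Proof. by move=> sf f0; apply/smooth1_gen/gen_inv => //; exact: gen_base. Qed.

Lemma smooth1X f n : smooth1 f -> smooth1 (fun x => f x ^+ n).
Proof.
move=> sf; elim: n => [|n ih]; first exact: smooth1_cst.
rewrite (_ : (fun x => _) = (fun x => f x * f x ^+ n)).
  exact: smooth1M.
by apply/funext => x; rewrite exprS.
Qed.

Lemma is_derive_affine f (f' : R) (a b x : R) :
  is_derive (a * x + b) 1 f f' ->
  is_derive x 1 (fun x => f (a * x + b)) (a * f').
Proof.
move=> df.
have dg : is_derive x 1 (fun x => a * x + b) a.
  by apply: (is_derive_eq (is_derive1D (is_derive1Z a (is_derive_id x (1 : R)))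
    (is_derive_cst b x (1 : R)))); rewrite mulr1 addr0.
by rewrite mulrC; exact: (@is_derive1_comp _ f (fun x => a * x + b)).
Qed.

Lemma smooth1_affine f (a b : R) : smooth1 f -> smooth1 (fun x => f (a * x + b)).
Proof.
move=> sf; exists [set h | exists c g, smooth1 g /\ h = fun x => c * g (a * x + b)].
split; first by exists 1, f; split => //; apply/funext => x; rewrite mul1r.
move=> _ [c [g [sg ->]]].
have h (x : R) : is_derive x 1 (fun x => c * g (a * x + b)) (c * a * (derive1 g) (a * x + b)).
  by apply: (is_derive_eq (is_derive1Z c (is_derive_affine (smooth1_is_derive (a * x + b) sg)))); rewrite mulrA.
split; first by move=> x; exact: (@ex_derive _ _ _ _ _ _ _ (h x)).
exists (c * a), (derive1 g); split; first exact: smooth1_derive.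
exact: is_derive1_eq.
Qed.

Lemma smooth1_sin : smooth1 (@sin R).
Proof.
exists [set h | exists c d : R, h = fun x => c * sin x + d * cos x]; split.
  by exists 1, 0; apply/funext => x; rewrite mul1r mul0r addr0.
move=> _ [c [d ->]].
have h (x : R) : is_derive x 1 (fun x => c * sin x + d * cos x)
    ((- d) * sin x + c * cos x).
  by apply: (is_derive_eq (is_derive1D (is_derive1Z c (is_derive_sin x))
    (is_derive1Z d (is_derive_cos x)))); rewrite mulrN mulNr addrC.
split; first by move=> x; exact: (@ex_derive _ _ _ _ _ _ _ (h x)).
by exists (- d), c; exact: is_derive1_eq.
Qed.

Lemma smooth1_cos : smooth1 (@cos R).
Proof.
have -> : @cos R = (fun x => sin (1 * x + pi / 2)).
  by apply/funext => x; rewrite mul1r sinDpihalf.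
exact/smooth1_affine/smooth1_sin.
Qed.

End SmoothReal.

Section SmoothStep.
Context {R : realType}.
Implicit Types (p : {poly R}).

(** For [p = 1] this is the classical flat function [exp(-1/t)]; the polynomial
    factor makes the family closed under derivation. *)
Definition flat p (t : R) : R :=
  if 0 < t then p.[t^-1] * expR (- t^-1) else 0.

(** Exponential decay beats any polynomial: the difference quotient of [flat p]
    at 0 is [x p(x) exp(-x)] with [x = 1/t]. *)
Lemma flat_bound p : exists2 C : R, 0 <= C &
  forall x, 1 <= x -> `|p.[x] * expR (- x)| * x ^+ 2 <= C.
Proof.
elim/poly_ind: p => [|p c [C C0 hC]].
  by exists 0 => // x x1; rewrite horner0 mul0r normr0 mul0r.
have key n : exists2 C : R, 0 <= C & forall x : R, 1 <= x -> x ^+ n.+1 * expR (- x) <= C.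
  exists (n.+1)`!%:R => // x x1.
  rewrite expRN ler_pdivrMr ?expR_gt0//.
  have := @expR_ge1Dxn _ x n (le_trans ler01 x1).
  rewrite -ler_pdivrMl ?ltr0n ?fact_gt0//; apply: le_trans.
  by rewrite mulrC; lra.
have poly_bd q : exists n, exists2 D : R, 0 <= D & forall x : R, 1 <= x -> `|q.[x]| <= D * x ^+ n.
  exists (size q).
  exists (\sum_(i < size q) `|q`_i|); first by apply: sumr_ge0.
  move=> x x1; rewrite horner_coef (le_trans (ler_norm_sum _ _ _))//.
  rewrite mulr_suml; apply: ler_sum => i _; rewrite normrM normrX.
  rewrite (ger0_norm (le_trans ler01 x1)) ler_wpM2l//.
  by rewrite ler_weXn2l// ltnW.
have [n [D D0 hD]] := poly_bd (p * 'X + c%:P).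
have [E E0 hE] := key n.+1.
exists (D * E); first exact: mulr_ge0.
move=> x x1; rewrite normrM (ger0_norm (expR_ge0 _)).
rewrite mulrAC; apply: (@le_trans _ _ (D * x ^+ n * x ^+ 2 * expR (- x))).
  rewrite ler_wpM2r ?expR_ge0// ler_wpM2r ?exprn_ge0 ?(le_trans ler01 x1)//.
  exact: hD.
rewrite (_ : _ * expR (- x) = D * (x ^+ n.+2 * expR (- x))).
  by rewrite ler_wpM2l//; exact: hE.
by rewrite !exprS; ring.
Qed.

Lemma flat_derive p (t : R) : is_derive t 1 (flat p) (flat ((p - p^`()) * 'X ^+ 2) t).
Proof.
have [t0|t0|t0] := ltgtP 0 t.
- have h : is_derive t 1 (fun t => p.[t^-1] * expR (- t^-1))
     (flat ((p - p^`()) * 'X ^+ 2) t).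
    have dV : is_derive t 1 (fun t : R => t^-1) (- t ^- 2).
      by apply: (is_derive_eq (is_derive1V (lt0r_neq0 t0 : id t != 0) (is_derive_id t (1 : R)))); rewrite mulr1.
    have dN : is_derive t 1 (fun t : R => - t^-1) (t ^- 2).
      by have := is_derive1N dV; rewrite opprK.
    have dE : is_derive t 1 (fun t : R => expR (- t^-1)) (t ^- 2 * expR (- t^-1)).
      by apply: (is_derive_eq (@is_derive1_comp _ expR (fun t : R => - t^-1) t _ _
        (is_derive_expR _) dN)); rewrite mulrC.
    have dP : is_derive t 1 (fun t : R => p.[t^-1]) (- t ^- 2 * p^`().[t^-1]).
      by apply: (is_derive_eq (@is_derive1_comp _ (horner p) (fun t : R => t^-1) t _ _
        (is_derive_poly p _) dV)); rewrite mulrC.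
    apply: (is_derive_eq (is_derive1M dP dE)); rewrite /flat t0 !hornerE /=.
    by field; exact: lt0r_neq0.
  apply: near_eq_is_derive h.
  by near=> s; rewrite /flat (_ : 0 < s)//; near: s; exact: lt_nbhsr.
- have h : is_derive t 1 (fun t : R => 0 : R) (flat ((p - p^`()) * 'X ^+ 2) t).
    by apply: (is_derive_eq (is_derive_cst (0 : R) t (1 : R))); rewrite /flat ltNge (ltW t0).
  apply: near_eq_is_derive h.
  near=> s; rewrite /flat (_ : 0 < s = false)//; apply/negbTE; rewrite -leNgt.
  by apply/ltW; near: s; exact: lt_nbhsl.
- rewrite -t0 {t t0}.
  have [C C0 hC] := flat_bound p.
  have lim0 : (fun h => h^-1 *: ((flat p \o shift 0) (h *: 1) - flat p 0)) @ 0^' --> (0 : R).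
    apply/cvgrPdist_lt => e e0; near=> h.
    rewrite sub0r normrN /= /GRing.scale/= mulr1 addr0.
    rewrite {2}/flat ltxx subr0 /flat; case: ifPn => h0; last by rewrite mulr0 normr0.
    have h1 : h < 1.
      near: h; apply: nbhs_dnbhs; exact: lt_nbhsl.
    have := hC h^-1; rewrite invf_ge1// => /(_ (ltW h1)) hh.
    rewrite normrM normfV (gtr0_norm h0).
    apply: (@le_lt_trans _ _ (C * h)).
      move: hh; set A := `| _ |; move=> hh.
      rewrite (_ : h^-1 * A = A * h^-1 ^+ 2 * h); first by rewrite ler_wpM2r// ltW.
      by field; exact: lt0r_neq0.
    rewrite (@le_lt_trans _ _ ((C + 1) * h))//; first by rewrite ler_pM2r// lerDl.
    rewrite -ltr_pdivlMl; last by rewrite ltr_wpDl.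
    near: h; apply: nbhs_dnbhs; apply: lt_nbhsl.
    by rewrite mulr_gt0// invr_gt0 ltr_wpDl.
  split; first by apply/cvg_ex; exists 0.
  rewrite /flat ltxx; exact/cvg_lim.
Unshelve. all: by end_near. Qed.

Lemma smooth1_flat p : smooth1 (flat p).
Proof.
exists [set h | exists p, h = flat p]; split; first by exists p.
move=> _ [q ->]; split.
  by move=> x; exact: (@ex_derive _ _ _ _ _ _ _ (flat_derive q x)).
by exists ((q - q^`()) * 'X ^+ 2); apply: is_derive1_eq => x; exact: flat_derive.
Qed.

Let denom (t : R) := flat 1 t + flat 1 (-1 * t + 1).

Lemma flat1_ge0 t : 0 <= flat 1 t.
Proof. by rewrite /flat; case: ifP => // _; rewrite hornerE mul1r expR_ge0. Qed.

Lemma flat1_gt0 t : 0 < t -> 0 < flat 1 t.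
Proof. by rewrite /flat => ->; rewrite hornerE mul1r expR_gt0. Qed.

Let denom_neq0 t : denom t != 0.
Proof.
apply: lt0r_neq0; rewrite /denom.
have [t0|t0] := ltP 0 t.
  by rewrite ltr_pwDl ?flat1_gt0 ?flat1_ge0.
by rewrite ltr_wpDl ?flat1_ge0// flat1_gt0//; lra.
Qed.

(** A smooth function equal to 0 before 0 and to 1 after 1. *)
Definition step (t : R) : R := flat 1 t * (denom t)^-1.

Lemma smooth1_step : smooth1 step.
Proof.
apply: smooth1M; first exact: smooth1_flat.
apply: smooth1V => //; apply: smooth1D; first exact: smooth1_flat.
exact/smooth1_affine/smooth1_flat.
Qed.

Lemma step_le0 t : t <= 0 -> step t = 0.
Proof. by rewrite leNgt => /negbTE t0; rewrite /step /flat t0 mul0r. Qed.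

Lemma step_ge1 t : 1 <= t -> step t = 1.
Proof.
move=> t1; have h : denom t = flat 1 t.
  rewrite /denom [in X in _ + X]/flat ifF ?addr0//; apply/negbTE.
  by rewrite -leNgt; lra.
rewrite /step h divff//; apply/lt0r_neq0/flat1_gt0; lra.
Qed.

Lemma step_itv t : 0 <= step t <= 1.
Proof.
rewrite /step; have d0 : 0 < denom t.
  by rewrite lt_def denom_neq0/= addr_ge0 ?flat1_ge0.
apply/andP; split; first by rewrite divr_ge0 ?flat1_ge0// ltW.
by rewrite ler_pdivrMr// mul1r lerDl flat1_ge0.
Qed.

End SmoothStep.

(** * Product test functions *)

Lemma ord3P (i : 'I_3) : [\/ i = 0, i = 1 | i = 2].
Proof.
by case: i => -[|[|[|//]]] p; [apply: Or31|apply: Or32|apply: Or33]; exact: val_inj.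
Qed.

Section ProductFunctions.
Context {R : realType}.
Implicit Types (g : R -> R) (e : 'I_3 -> R -> R).

(** Directional derivatives of a function of one linear coordinate reduce to
    derivatives on the line. *)
Lemma is_derive_line (V : normedModType R) (h : V -> R) (g : R -> R)
    (x v : V) (a b : R) :
  (forall s : R, h (s *: v + x) = a * s + h x) ->
  is_derive (h x) 1 g b -> is_derive x v (fun y => g (h y)) (a * b).
Proof.
move=> hv dg.
have : is_derive (0 : R) 1 (fun s => g (a * s + h x)) (a * b).
  by apply: is_derive_affine; rewrite mulr0 add0r.
have E : (fun s : R => s^-1 *: (((fun y => g (h y)) \o shift x) (s *: v) - g (h x))) =
  (fun s : R => s^-1 *: (((fun s => g (a * s + h x)) \o shift 0) (s *: 1) - g (a * 0 + h x))).
  by apply/funext => s /=; rewrite hv addr0 mulr0 add0r /GRing.scale/= mulr1.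
by case=> d1 d2; split; rewrite /derivable /derive E.
Qed.

Lemma is_deriveMe (V : normedModType R) (f1 f2 : V -> R) (x v : V) (a b : R) :
  is_derive x v f1 a -> is_derive x v f2 b ->
  is_derive x v (fun y => f1 y * f2 y) (f1 x * b + f2 x * a).
Proof. exact: is_deriveM. Qed.

Definition smooth3 e := forall i, smooth1 (e i).

Definition prodf e (x : vec R) : R := e 0 x.1.1 * e 1 x.1.2 * e 2 x.2.

(** The [i]-th partial derivative, at the level of the factors of a product. *)
Definition dere (i : 'I_3) e : 'I_3 -> R -> R :=
  fun j => if j == i then derive1 (e j) else e j.

Lemma smooth3_dere i e : smooth3 e -> smooth3 (dere i e).
Proof.
by move=> se j; rewrite /dere; case: ifP => // _; exact: smooth1_derive.
Qed.

Lemma dereC i j e : dere i (dere j e) = dere j (dere i e).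
Proof.
apply/funext => k; rewrite /dere.
by case: (k == i); case: (k == j).
Qed.

Lemma is_derive_prodf i e (x : vec R) : smooth3 e ->
  is_derive x (basis3 i) (prodf e) (prodf (dere i e) x).
Proof.
move=> se.
have d0 : is_derive x (basis3 i) (fun y : vec R => e 0 y.1.1)
    ((i == 0)%:R * derive1 (e 0) x.1.1).
  apply: (@is_derive_line _ (fun y : vec R => y.1.1)) => [s /=|].
    by rewrite /GRing.scale/= mulrC.
  exact: smooth1_is_derive.
have d1 : is_derive x (basis3 i) (fun y : vec R => e 1 y.1.2)
    ((i == 1)%:R * derive1 (e 1) x.1.2).
  apply: (@is_derive_line _ (fun y : vec R => y.1.2)) => [s /=|].
    by rewrite /GRing.scale/= mulrC.
  exact: smooth1_is_derive.
have d2 : is_derive x (basis3 i) (fun y : vec R => e 2 y.2)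
    ((i == 2)%:R * derive1 (e 2) x.2).
  apply: (@is_derive_line _ (fun y : vec R => y.2)) => [s /=|].
    by rewrite /GRing.scale/= mulrC.
  exact: smooth1_is_derive.
apply: (is_derive_eq (is_deriveMe (is_deriveMe d0 d1) d2)).
rewrite /prodf /dere /GRing.scale /= /GRing.mul_fun.
by have [->|->|->] := ord3P i; rewrite /=; ring.
Qed.

Lemma continuous_prodf e : smooth3 e -> continuous (prodf e).
Proof.
move=> se x; rewrite /prodf.
have c i (y : R) : {for y, continuous (e i)} by exact: smooth1_continuous.
apply: cvgM; first apply: cvgM.
- apply: (@continuous_comp _ _ _ (fun z : vec R => z.1.1) (e 0)); last exact: c.
  by apply: (@continuous_comp _ _ _ fst fst); exact: cvg_fst.
- apply: (@continuous_comp _ _ _ (fun z : vec R => z.1.2) (e 1)); last exact: c.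
  by apply: (@continuous_comp _ _ _ fst snd); [exact: cvg_fst|exact: cvg_snd].
- apply: (@continuous_comp _ _ _ snd (e 2)); last exact: c.
  exact: cvg_snd.
Qed.

Definition stprod g e (z : vec R * R) : R := g z.2 * prodf e z.1.

Lemma continuous_stprod g e : smooth1 g -> smooth3 e -> continuous (stprod g e).
Proof.
move=> sg se z; apply: cvgM.
  apply: (@continuous_comp _ _ _ snd g); first exact: cvg_snd.
  exact: smooth1_continuous.
apply: (@continuous_comp _ _ _ fst (prodf e)); first exact: cvg_fst.
exact: continuous_prodf.
Qed.

Lemma is_derive_stprod_time g e (z : vec R * R) : smooth1 g -> smooth3 e ->
  is_derive z (dir None) (stprod g e) (stprod (derive1 g) e z).
Proof.
move=> sg se.
have d0 : is_derive z (dir None) (fun y : vec R * R => g y.2) (1 * derive1 g z.2).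
  apply: (@is_derive_line _ (fun y : vec R * R => y.2)) => [s /=|].
    by rewrite /GRing.scale/= mulrC.
  exact: smooth1_is_derive.
have d1 : is_derive z (dir None) (fun y : vec R * R => prodf e y.1) (0 : R).
  have E : (fun s : R => s^-1 *: (((fun y : vec R * R => prodf e y.1) \o shift z)
     (s *: (dir None : vec R * R)) - prodf e z.1)) = (fun=> 0).
    by apply/funext => s /=; rewrite scaler0 add0r subrr scaler0.
  split; rewrite /derivable /derive E.
    by apply/cvg_ex; exists 0; exact: cvg_cst.
  by apply/cvg_lim => //; exact: cvg_cst.
apply: (is_derive_eq (is_deriveMe d0 d1)).
by rewrite /stprod /GRing.scale/=; ring.
Qed.

Lemma is_derive_stprod_space i g e (z : vec R * R) : smooth1 g -> smooth3 e ->
  is_derive z (dir (Some i)) (stprod g e) (stprod g (dere i e) z).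
Proof.
move=> sg se.
have d0 : is_derive z (dir (Some i)) (fun y : vec R * R => g y.2) (0 * derive1 g z.2).
  apply: (@is_derive_line _ (fun y : vec R * R => y.2)) => [s /=|].
    by rewrite scaler0 mul0r.
  exact: smooth1_is_derive.
have d1 : is_derive z (dir (Some i)) (fun y : vec R * R => prodf e y.1)
    (prodf (dere i e) z.1).
  have := is_derive_prodf i z.1 se.
  by case=> d1 d2; split.
apply: (is_derive_eq (is_deriveMe d0 d1)).
by rewrite /stprod /GRing.scale/=; ring.
Qed.

Lemma partial_time_stprod g e : smooth1 g -> smooth3 e ->
  partial None (stprod g e) = stprod (derive1 g) e.
Proof.
move=> sg se; apply/funext => z; have h := is_derive_stprod_time z sg se.
exact: derive_val.
Qed.

Lemma partial_space_stprod i g e : smooth1 g -> smooth3 e ->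
  partial (Some i) (stprod g e) = stprod g (dere i e).
Proof.
move=> sg se; apply/funext => z; have h := is_derive_stprod_space i z sg se.
exact: derive_val.
Qed.

(** Products are stable under all partial derivatives, so the iterated
    derivatives of a product stay explicit. *)
Lemma smooth_stprod g e : smooth1 g -> smooth3 e -> smooth (stprod g e).
Proof.
move=> sg se s.
have [g' [e' [sg' se' ->]]] : exists g' e', [/\ smooth1 g', smooth3 e' &
    partials s (stprod g e) = stprod g' e'].
  elim: s => [|o s [g' [e' [sg' se' IH]]]] /=; first by exists g, e.
  rewrite IH; case: o => [i|].
    exists g', (dere i e'); split => //; first exact: smooth3_dere.
    exact: partial_space_stprod.
  exists (derive1 g'), e'; split => //; first exact: smooth1_derive.
  exact: partial_time_stprod.
split; first exact: continuous_stprod.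
move=> [i|] z.
  by have h := is_derive_stprod_space i z sg' se'; exact: ex_derive.
by have h := is_derive_stprod_time z sg' se'; exact: ex_derive.
Qed.

Definition periodic3 e := forall i (x : R) (k : int), e i (x + k%:~R) = e i x.

Lemma prodf_periodic e : periodic3 e -> z_periodic (prodf e).
Proof.
by move=> pe x k; rewrite /prodf /zvec /= !pe.
Qed.

Lemma test_function_stprod g e (a b : R) : 0 < a -> a < b ->
  (forall t, g t != 0 -> a <= t <= b) -> smooth1 g -> smooth3 e ->
  periodic3 e -> test_function (stprod g e).
Proof.
move=> a0 ab gab sg se pe; split.
- exact: smooth_stprod.
- by move=> t x k; rewrite /stprod/= prodf_periodic.
- exists a, b; split => // x t; rewrite /stprod/= => h; apply: gab.
  by apply: contra_neq h => ->; rewrite mul0r.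
Qed.

End ProductFunctions.

(** * Real-valued integrals and the measure of the torus *)

Section RealIntegrals.
Context d (T : measurableType d) {R : realType}.
Variable mu : {measure set T -> \bar R}.
Implicit Types (f g h : T -> R).

Definition summ f := mu.-integrable setT (EFin \o f).

Local Notation I f := (Rintegral mu setT f).

Lemma summ_meas f : summ f -> measurable_fun setT f.
Proof. by move=> /integrableP[+ _] => /measurable_EFinP. Qed.

Lemma summD f g : summ f -> summ g -> summ (fun x => f x + g x).
Proof. by move=> sf sg; have := integrableD measurableT sf sg. Qed.

Lemma summZ (c : R) f : summ f -> summ (fun x => c * f x).
Proof. by move=> sf; have := integrableZl measurableT c sf. Qed.

Lemma summB f g : summ f -> summ g -> summ (fun x => f x - g x).
Proof. by move=> sf sg; have := integrableB measurableT sf sg. Qed.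

Lemma summ0 : summ (fun=> 0).
Proof. exact: integrable0. Qed.

Lemma summ_sum (J : Type) (s : seq J) (F : J -> T -> R) :
  (forall j, summ (F j)) -> summ (fun x => \sum_(j <- s) F j x).
Proof.
move=> sF; elim: s => [|j s ih].
  by under [fun _ => _]funext => x do rewrite big_nil; exact: summ0.
by under [fun _ => _]funext => x do rewrite big_cons; exact: summD.
Qed.

Lemma summ_le f g : measurable_fun setT f -> (forall x, `|f x| <= g x) ->
  summ g -> summ f.
Proof.
move=> mf fg; apply: le_integrable => //; first exact/measurable_EFinP.
by move=> x _; rewrite /= lee_fin (le_trans (fg x))// ler_norm.
Qed.

Lemma summM_bounded f h (M : R) : summ f -> measurable_fun setT h ->
  (forall x, `|h x| <= M) -> summ (fun x => f x * h x).
Proof.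
move=> sf mh hM; apply: (@summ_le _ (fun x => M * `|f x|)).
- exact: measurable_funM (summ_meas sf) mh.
- by move=> x; rewrite normrM mulrC ler_wpM2r.
- by apply: summZ; exact: integrable_norm.
Qed.

Lemma summ_norm f : summ f -> summ (fun x => `|f x|).
Proof. exact: integrable_norm. Qed.

Lemma ID f g : summ f -> summ g -> I (fun x => f x + g x) = I f + I g.
Proof. exact: RintegralD. Qed.

Lemma IB f g : summ f -> summ g -> I (fun x => f x - g x) = I f - I g.
Proof. exact: RintegralB. Qed.

Lemma IZ c f : summ f -> I (fun x => c * f x) = c * I f.
Proof. by move=> sf; exact: RintegralZl. Qed.

Lemma I0 : I (fun=> 0) = 0.
Proof. by rewrite Rintegral_cst// mul0r. Qed.

Lemma Isum (J : Type) (s : seq J) (F : J -> T -> R) :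
  (forall j, summ (F j)) ->
  I (fun x => \sum_(j <- s) F j x) = \sum_(j <- s) I (F j).
Proof.
move=> sF; elim: s => [|j s ih].
  by rewrite big_nil; under [fun _ => _]funext => x do rewrite big_nil; exact: I0.
rewrite big_cons -ih -ID//; last exact: summ_sum.
by under [fun _ => _]funext => x do rewrite big_cons.
Qed.

Lemma le_I f g : summ f -> summ g -> (forall x, f x <= g x) -> I f <= I g.
Proof. by move=> sf sg fg; apply: le_Rintegral. Qed.

Lemma I_ge0 f : (forall x, 0 <= f x) -> 0 <= I f.
Proof. by move=> f0; exact: Rintegral_ge0. Qed.

Lemma norm_I_le f g : summ f -> summ g -> (forall x, `|f x| <= g x) ->
  `|I f| <= I g.
Proof.
move=> sf sg fg; apply: (le_trans (le_normr_Rintegral measurableT sf)).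
by apply: le_I => //; exact: summ_norm.
Qed.

Lemma eq_I f g : (forall x, f x = g x) -> I f = I g.
Proof. by move=> fg; congr (Rintegral _ _ _); exact/funext. Qed.

Lemma dominated_I (f_ : nat -> T -> R) f g :
  (forall n, measurable_fun setT (f_ n)) -> measurable_fun setT f ->
  (forall x, f_ n x @[n --> \oo] --> f x) -> summ g ->
  (forall n x, `|f_ n x| <= g x) ->
  I (f_ n) @[n --> \oo] --> I f.
Proof.
move=> mf_ mf ff sg fg.
have [] := @dominated_convergence _ _ _ mu setT measurableT (fun n => EFin \o f_ n)
    (EFin \o f) (EFin \o g).
- by move=> n; exact/measurable_EFinP.
- exact/measurable_EFinP.
- by apply/aeW => x _; apply: cvg_EFin; [exact: nearW|exact: ff].
- exact: sg.
- by apply/aeW => x n _; rewrite /= lee_fin.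
move=> sf _ cf; apply: fine_cvg; rewrite fineK//.
exact: (integrable_fin_num measurableT sf).
Qed.

Lemma I_EFin f : summ f -> (\int[mu]_x (f x)%:E = (I f)%:E)%E.
Proof. by move=> sf; rewrite /Rintegral fineK//; exact: integrable_fin_num. Qed.

Lemma summ_bounded f (M : R) : (mu setT < +oo)%E -> measurable_fun setT f ->
  (forall x, `|f x| <= M) -> summ f.
Proof.
move=> muT mf fM; apply: (@summ_le _ (fun=> M)) => //.
apply: measurable_bounded_integrable => //.
by exists `|M|; split => // y /ltW My x _ /=.
Qed.

End RealIntegrals.

Section RealFubini.
Context d1 d2 (T1 : measurableType d1) (T2 : measurableType d2) {R : realType}.
Variable m1 : {sigma_finite_measure set T1 -> \bar R}.
Variable m2 : {sigma_finite_measure set T2 -> \bar R}.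

Lemma summ_tensor (a : T1 -> R) (b : T2 -> R) : summ m1 a -> summ m2 b ->
  summ (m1 \x m2)%E (fun z => a z.1 * b z.2).
Proof.
move=> sa sb; have ma := summ_meas sa; have mb := summ_meas sb.
have mab : measurable_fun setT (fun z : T1 * T2 => a z.1 * b z.2).
  by apply: measurable_funM; apply: measurableT_comp.
apply/integrable12ltyP; first exact/measurable_EFinP.
rewrite (_ : (fun x => _) = (fun x => `|a x|%:E * (\int[m2]_y `|b y|%:E))%E); last first.
  apply/funext => x.
  under eq_integral => y _ do rewrite /= normrM EFinM.
  by rewrite ge0_integralZl// ?lee_fin//; do 2 apply: measurableT_comp => //.
have [_ ioo] := integrableP _ _ _ sb.
rewrite ge0_integralZr//; last 2 first.
- by do 2 apply: measurableT_comp => //.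
- by apply: integral_ge0 => y _; rewrite lee_fin.
apply: lte_mul_pinfty.
- by apply: integral_ge0 => y _; rewrite lee_fin.
- rewrite ge0_fin_numE; last by apply: integral_ge0 => y _; rewrite lee_fin.
  by have /integrableP[_] := sa.
- exact: ioo.
Qed.

Lemma I_tensor (a : T1 -> R) (b : T2 -> R) : summ m1 a -> summ m2 b ->
  Rintegral (m1 \x m2)%E setT (fun z => a z.1 * b z.2) =
  Rintegral m1 setT a * Rintegral m2 setT b.
Proof.
move=> sa sb; rewrite [LHS]/Rintegral -integral12_prod_meas1; last exact: summ_tensor.
rewrite /fubini_F.
under eq_integral => x _.
  under eq_integral => y _ do rewrite /= EFinM.
  rewrite (integralZl measurableT sb) (I_EFin sb).
  over.
by rewrite (integralZr measurableT sa) (I_EFin sa).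
Qed.

Lemma I_fubini (f : T1 * T2 -> R) : summ (m1 \x m2)%E f ->
  (forall x, summ m2 (fun y => f (x, y))) ->
  Rintegral (m1 \x m2)%E setT f =
  Rintegral m1 setT (fun x => Rintegral m2 setT (fun y => f (x, y))).
Proof.
move=> sf sfx; rewrite [LHS]/Rintegral -integral12_prod_meas1//.
by congr fine; apply: eq_integral => x _; rewrite /fubini_F (I_EFin (sfx x)).
Qed.

End RealFubini.

Lemma integral_restr d (T : measurableType d) (R : realType)
    (mu mu' : {measure set T -> \bar R}) (D : set T) (f : T -> \bar R) :
  measurable D -> (forall A, measurable A -> mu' A = mu (A `&` D)) ->
  measurable_fun setT f ->
  (\int[mu]_(x in D) f x = \int[mu']_x f x)%E.
Proof.
move=> mD muD mf; have mDC : measurable (~` D) by exact: measurableC.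
rewrite -(setUv D) (integral_setU mu' mD mDC)//; last 2 first.
- by rewrite setUv.
- by apply/disj_set2P; rewrite setICr.
rewrite [X in (_ + X)%E]null_set_integral//; last 2 first.
- exact: measurable_funS mf.
- by rewrite /= muD// setICl measure0.
rewrite adde0; apply: eq_measure_integral => A mA Ac.
by rewrite muD// setIidl.
Qed.

(** The same set may carry two copies of one sigma-algebra; integrals do not
    see the difference. *)
Lemma integral_transport d1 d2 (X : measurableType d1) (Y : measurableType d2)
    (R : realType) (mu : {measure set X -> \bar R}) (phi : X -> Y)
    (mphi : measurable_fun setT phi) (f : Y -> \bar R) :
  measurable_fun setT f ->
  (\int[mu]_x f (phi x) = \int[pushforward mu phi]_y f y)%E.
Proof.
move=> mf; rewrite -[fun x => f (phi x)]/(f \o phi) integralE funepos_comp.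
rewrite funeneg_comp [RHS]integralE.
have H (g : Y -> \bar R) : measurable_fun setT g -> (forall y, 0 <= g y)%E ->
    (\int[mu]_x g (phi x) = \int[pushforward mu phi]_y g y)%E.
  move=> mg g0; have gin : {in [set: Y], forall y, (0 <= g y)%E} by [].
  have E := @ge0_integral_pushforward _ _ X Y R phi mphi mu setT g measurableT mg gin.
  by rewrite preimage_setT in E; exact: esym.
have Hp := H _ (measurable_funepos mf) (fun y => funepos_ge0 f y).
have Hn := H _ (measurable_funeneg mf) (fun y => funeneg_ge0 f y).
by rewrite -Hp -Hn.
Qed.

Section TorusMeasure.
Context {R : realType}.

Let mitv : measurable (`[0, 1[ : set R).
Proof. exact: measurable_itv. Qed.

Let fin_itv : (@lebesgue_measure R `[0%R, 1%R[ < +oo)%E.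
Proof. by rewrite lebesgue_measure_itv/= lte_fin ltr01 sube0 ltry. Qed.

(** The Lebesgue measure is defined on a copy of [R] with its own sigma-algebra;
    this one is a measure for the canonical sigma-algebra of [R], so that it
    forms products with the measurability structure used everywhere else. *)
Definition circle_measure (A : set R) : \bar R :=
  lebesgue_measure (A `&` `[0, 1[).

Let restr := @mfrestr _ _ _ _ (@lebesgue_measure R) mitv fin_itv.

Let circle0 : circle_measure set0 = 0%E.
Proof. exact: (@measure0 _ _ _ restr). Qed.

Let circle_ge0 A : (0 <= circle_measure A)%E.
Proof. exact: (@measure_ge0 _ _ _ restr). Qed.

Let circle_sigma_additive : semi_sigma_additive circle_measure.
Proof. exact: (@measure_semi_sigma_additive _ _ _ restr). Qed.

HB.instance Definition _ := isMeasure.Build _ R R circle_measure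
  circle0 circle_ge0 circle_sigma_additive.

Let circle_fin : fin_num_fun circle_measure.
Proof. exact: (@fin_num_measure _ _ _ restr). Qed.

HB.instance Definition _ := Measure_isFinite.Build _ _ _ circle_measure
  circle_fin.

Definition circle : {finite_measure set R -> \bar R} := circle_measure.

Definition torus : {sigma_finite_measure set (vec R) -> \bar R} :=
  sfprod (sfprod circle circle) circle.

Lemma circleT : circle setT = 1%E.
Proof.
by rewrite /circle/= /circle_measure setTI lebesgue_measure_itv/= lte_fin ltr01 sube0.
Qed.

Lemma torusT : torus setT = 1%E.
Proof.
rewrite /torus /= /sfprod -setXTT product_measure1E//=.
by rewrite /sfprod -setXTT product_measure1E//= circleT !mule1.
Qed.

Lemma cellE : @cell R = (`[0, 1[ `*` `[0, 1[) `*` `[0, 1[.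
Proof.
apply/seteqP; split => [[[x y] z] h|[[x y] z]].
  have := h 0; have := h 1; have := h 2.
  by rewrite /coord3/= => h2 h1 h0; split; [split|]; rewrite /= in_itv.
rewrite /= !in_itv/= => -[[h0 h1] h2] i.
by have [->|->|->] := ord3P i; rewrite /coord3.
Qed.

Lemma measurable_cell : measurable (@cell R).
Proof. by rewrite cellE; apply: measurableX => //; exact: measurableX. Qed.

Let cell2 : set (R * R) := `[0, 1[ `*` `[0, 1[.
Let mcell2 : measurable cell2. Proof. exact: measurableX. Qed.

Let leb2 := sfprod (@lebesgue_measure R) (@lebesgue_measure R).

(** The restrictions of the Lebesgue measures to the cell, seen as measures for
    the product sigma-algebra of the canonical one on [R]. *)
Definition cell2_measure (A : set (R * R)) : \bar R := leb2 (A `&` cell2).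

Let restr2 := @mrestr _ _ _ _ leb2 mcell2.

Let cell2_0 : cell2_measure set0 = 0%E.
Proof. exact: (@measure0 _ _ _ restr2). Qed.

Let cell2_ge0 A : (0 <= cell2_measure A)%E.
Proof. exact: (@measure_ge0 _ _ _ restr2). Qed.

Let cell2_sigma_additive : semi_sigma_additive cell2_measure.
Proof. exact: (@measure_semi_sigma_additive _ _ _ restr2). Qed.

HB.instance Definition _ := isMeasure.Build _ (R * R)%type R cell2_measure
  cell2_0 cell2_ge0 cell2_sigma_additive.

Definition cell_measure (A : set (vec R)) : \bar R := leb3 (A `&` cell).

Let restr3 := @mrestr _ _ _ _ (@leb3 R) measurable_cell.

Let cell_0 : cell_measure set0 = 0%E.
Proof. exact: (@measure0 _ _ _ restr3). Qed.

Let cell_ge0 A : (0 <= cell_measure A)%E.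
Proof. exact: (@measure_ge0 _ _ _ restr3). Qed.

Let cell_sigma_additive : semi_sigma_additive cell_measure.
Proof. exact: (@measure_semi_sigma_additive _ _ _ restr3). Qed.

HB.instance Definition _ := isMeasure.Build _ (vec R) R cell_measure
  cell_0 cell_ge0 cell_sigma_additive.

Let torus2E (A : set (R * R)) : measurable A ->
  sfprod circle circle A = leb2 (A `&` cell2).
Proof.
move=> mA; apply: (@product_measure_unique _ _ _ _ _ circle circle
  cell2_measure) => // B C mB mC.
rewrite /= /cell2_measure -setXI /leb2 /= /sfprod product_measure1E//.
- exact: measurableI.
- exact: measurableI.
Qed.

Lemma torusE (A : set (vec R)) : measurable A -> torus A = leb3 (A `&` cell).
Proof.
move=> mA; apply: (@product_measure_unique _ _ _ _ _ (sfprod circle circle) circle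
  cell_measure) => // B C mB mC.
rewrite /= /cell_measure cellE -setXI /leb3 /= {1}/sfprod product_measure1E//.
- by rewrite (torus2E mB).
- exact: measurableI.
- exact: measurableI.
Qed.

Lemma integral_torus (f : vec R -> \bar R) : measurable_fun setT f ->
  (\int[leb3]_(x in cell) f x = \int[torus]_x f x)%E.
Proof.
move=> mf.
have Hid : measurable_fun setT (idfun : _ -> vec R) by exact: measurable_id.
have E1 := @integral_restr _ _ _ leb3 restr3 cell f measurable_cell
  (fun A _ => erefl) mf.
have E2 := @integral_transport _ _ _ (vec R) R restr3 idfun Hid f mf.
apply: (etrans E1); apply: (etrans E2).
apply: eq_measure_integral => A mA _; symmetry; exact: torusE.
Qed.

Lemma Rintegral_circle (f : R -> R) : measurable_fun setT f ->
  Rintegral lebesgue_measure `[0%R, 1%R[ f = Rintegral circle setT f.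
Proof.
move=> mf.
have mf' : measurable_fun setT (EFin \o f) by exact: measurableT_comp.
have Hid : measurable_fun setT (idfun : _ -> R) by exact: measurable_id.
have E1 := @integral_restr _ _ _ lebesgue_measure restr `[0, 1[ (EFin \o f) mitv
  (fun A _ => erefl) mf'.
have E2 := @integral_transport _ _ _ R R restr idfun Hid (EFin \o f) mf'.
apply: (f_equal fine); apply: (etrans E1); apply: (etrans E2).
by apply: eq_measure_integral.
Qed.

Lemma I_prod3 (a b c : R -> R) : summ circle a -> summ circle b ->
  summ circle c ->
  summ torus (fun y : vec R => a y.1.1 * b y.1.2 * c y.2) /\
  Rintegral torus setT (fun y : vec R => a y.1.1 * b y.1.2 * c y.2) =
  Rintegral circle setT a * Rintegral circle setT b * Rintegral circle setT c.
Proof.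
move=> sa sb sc; have sab := summ_tensor sa sb; split.
  exact: (summ_tensor (m1 := sfprod circle circle) sab sc).
rewrite -(I_tensor sa sb).
exact: (I_tensor (m1 := sfprod circle circle) sab sc).
Qed.

Lemma summ_circle_bounded (f : R -> R) (M : R) : measurable_fun setT f ->
  (forall x, `|f x| <= M) -> summ circle f.
Proof.
move=> mf fM; have cT : (circle setT < +oo)%E by rewrite circleT ltry.
exact: (@summ_bounded _ _ _ circle f M cT mf fM).
Qed.

Lemma summ_torus_bounded (f : vec R -> R) (M : R) : measurable_fun setT f ->
  (forall x, `|f x| <= M) -> summ torus f.
Proof.
move=> mf fM; have cT : (torus setT < +oo)%E by rewrite torusT ltry.
exact: (@summ_bounded _ _ _ torus f M cT mf fM).
Qed.

Lemma I_torus_cst (c : R) : Rintegral torus setT (fun=> c) = c.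
Proof. by rewrite Rintegral_cst// [X in fine X]torusT mulr1.
Qed.

End TorusMeasure.

(** * A smooth distance on the torus *)

Section SineDistance.
Context {R : realType}.
Implicit Types (x y : vec R) (t w : R).

Lemma norm_sin_le t : `|sin t| <= `|t|.
Proof.
have H (a : R) : 0 <= a -> `|sin a| <= a.
  rewrite le_eqVlt => /predU1P[<-|a0]; first by rewrite sin0 normr0.
  have [c _] := @MVT_segment R sin cos 0 a (ltW a0) (fun z _ => is_derive_sin z)
    (continuous_subspaceT (@continuous_sin R)).
  rewrite sin0 !subr0 => ->; rewrite normrM (gtr0_norm a0).
  by rewrite ger_pMl// cos_max.
have [t0|t0] := leP 0 t; first by rewrite (ger0_norm t0) H.
by rewrite -[in leLHS](opprK t) sinN normrN (ltr0_norm t0) H// oppr_ge0 ltW.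
Qed.

Lemma cos_pifourth_sq : cos (pi / 4 : R) ^+ 2 = 2^-1.
Proof.
have := cos_mulr2n (pi / 4 : R).
have -> : (pi / 4 : R) *+ 2 = pi / 2 by field.
rewrite cos_pihalf mulr2n; lra.
Qed.

Lemma sin_ge_half t : 0 <= t <= pi / 2 -> t / 2 <= sin t.
Proof.
move=> /andP[t0 t1]; have pi0 := pi_gt0 R.
have cdecr a : 0 <= a <= pi / 4 -> cos (pi / 4) <= cos a :> R.
  move=> /andP[a0 a1]; rewrite leNgt ltr_cos -?leNgt// ?in_itv/=; lra.
have c4 : 0 <= cos (pi / 4 : R) by apply: cos_ge0_pihalf; lra.
have [t00|tp] := eqVneq t 0; first by rewrite t00 sin0 mul0r.
have tpos : 0 < t / 2 by rewrite divr_gt0// lt_def tp.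
have [c /[!in_itv]/= /andP[c0 c1]] := @MVT_segment R sin cos 0 (t / 2) (ltW tpos)
  (fun z _ => is_derive_sin z) (continuous_subspaceT (@continuous_sin R)).
rewrite sin0 !subr0 => E.
have -> : sin t = (cos (t / 2) * sin (t / 2)) *+ 2.
  by rewrite -sin_mulr2n; congr sin; field.
rewrite E.
have h1 : cos (pi / 4) <= cos (t / 2) :> R by apply: cdecr; lra.
have h2 : cos (pi / 4) <= cos c :> R by apply: cdecr; lra.
have h3 : 2^-1 <= cos (t / 2) * cos c.
  by rewrite (le_trans _ (ler_pM c4 c4 h1 h2))// -expr2 cos_pifourth_sq.
rewrite (_ : _ *+ 2 = (cos (t / 2) * cos c) * t); last by field.
by have := ler_wpM2r t0 h3; rewrite (mulrC 2^-1 t).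
Qed.

(** Jordan's inequality, with the constant 1 instead of 2. *)
Lemma norm_sinpi_ge w : `|w| <= 2^-1 -> `|w| <= `|sin (pi * w)|.
Proof.
have H (a : R) : 0 <= a -> a <= 2^-1 -> a <= `|sin (pi * a)|.
  move=> a0 a1; have pi2 := pi_ge2 R.
  have h : 0 <= pi * a <= pi / 2.
    by rewrite mulr_ge0 ?pi_ge0//= ler_wpM2l// pi_ge0.
  rewrite (le_trans _ (ler_norm _))// (le_trans _ (sin_ge_half h))//.
  by nra.
have [w0|w0] := leP 0 w; first by rewrite (ger0_norm w0) => ?; exact: H.
rewrite (ltr0_norm w0) => h.
have := H (- w) _ h; rewrite mulrN sinN normrN; apply.
by rewrite oppr_ge0 ltW.
Qed.

Lemma sin_sq_shift t (k : int) : sin (pi * (t + k%:~R)) ^+ 2 = sin (pi * t) ^+ 2.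
Proof.
have Hn (n : nat) (u : R) : sin (pi * (u + n%:R)) ^+ 2 = sin (pi * u) ^+ 2.
  elim: n u => [|n ih] u; first by rewrite addr0.
  rewrite (_ : pi * (u + n.+1%:R) = pi * (u + n%:R) + pi).
    by rewrite sinDpi sqrrN ih.
  by rewrite -natr1; ring.
case: k => n; first exact: Hn.
by rewrite -(Hn n.+1 (t + (Negz n)%:~R)) NegzE mulrNz subrK.
Qed.

Lemma nearest_int t : exists k : int, `|t + k%:~R| <= 2^-1.
Proof.
exists (- Num.floor (t + 2^-1)).
have := floor_itv (t + 2^-1).
rewrite mulrNz intrD1 ler_norml => /andP[h1 h2].
by apply/andP; split; lra.
Qed.

(** A function comparable to the distance on the torus, but smooth away from the
    diagonal and adapted to the kernel, a power of cosines. *)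
Definition sd x y : R :=
  Num.sqrt (\sum_(i < 3) sin (pi * (coord3 x i - coord3 y i)) ^+ 2).

Lemma sd_ge0 x y : 0 <= sd x y. Proof. exact: sqrtr_ge0. Qed.

Lemma sum_sin2_ge0 x y :
  0 <= \sum_(i < 3) sin (pi * (coord3 x i - coord3 y i)) ^+ 2.
Proof. by apply: sumr_ge0 => i _; exact: sqr_ge0. Qed.

Lemma sd_sq x y :
  sd x y ^+ 2 = \sum_(i < 3) sin (pi * (coord3 x i - coord3 y i)) ^+ 2.
Proof. by rewrite sqr_sqrtr// sum_sin2_ge0. Qed.

Lemma sdC x y : sd x y = sd y x.
Proof.
rewrite /sd; congr (Num.sqrt _); apply: eq_bigr => i _.
by rewrite -opprB mulrN sinN sqrrN.
Qed.

Lemma norm_sin_le_sd x y i : `|sin (pi * (coord3 x i - coord3 y i))| <= sd x y.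
Proof.
rewrite -sqrtr_sqr ler_wsqrtr// (bigD1 i)//= lerDl.
by apply: sumr_ge0 => j _; exact: sqr_ge0.
Qed.

Lemma coord3D x y i : coord3 (x + y) i = coord3 x i + coord3 y i.
Proof. by have [->|->|->] := ord3P i. Qed.

Lemma coord3N x i : coord3 (- x) i = - coord3 x i.
Proof. by have [->|->|->] := ord3P i. Qed.

Lemma coord3B x y i : coord3 (x - y) i = coord3 x i - coord3 y i.
Proof. by rewrite coord3D coord3N. Qed.

Lemma coord3_inj x y : (forall i, coord3 x i = coord3 y i) -> x = y.
Proof.
case: x y => [[x0 x1] x2] [[y0 y1] y2] h.
by move: (h 0) (h 1) (h 2); rewrite /coord3/= => -> -> ->.
Qed.

Lemma coord3_zvec (k : int * int * int) i :
  exists m : int, coord3 (zvec k : vec R) i = m%:~R.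
Proof.
by have [->|->|->] := ord3P i; [exists k.1.1|exists k.1.2|exists k.2].
Qed.

(** The representative of [x - y] in the centred unit cube realises the distance
    up to a constant. *)
Lemma nearest_zvec x y : exists k : int * int * int, forall i,
  `|coord3 (x - y + zvec k) i| <= 2^-1.
Proof.
have [k0 h0] := nearest_int (coord3 (x - y) 0).
have [k1 h1] := nearest_int (coord3 (x - y) 1).
have [k2 h2] := nearest_int (coord3 (x - y) 2).
exists (k0, k1, k2) => i; rewrite coord3D.
by have [->|->|->] := ord3P i.
Qed.

Lemma sin_sq_zvec x y k i :
  sin (pi * coord3 (x - y + zvec k) i) ^+ 2 =
  sin (pi * (coord3 x i - coord3 y i)) ^+ 2.
Proof.
have [m hm] := coord3_zvec k i.
by rewrite coord3D hm sin_sq_shift coord3B.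
Qed.

Lemma dotpp x : dotp x x = \sum_(i < 3) coord3 x i ^+ 2.
Proof. by apply: eq_bigr => i _; rewrite expr2. Qed.

Lemma dotpp_ge0 x : 0 <= dotp x x.
Proof. by rewrite dotpp sumr_ge0// => i _; exact: sqr_ge0. Qed.

Lemma enorm_ge0 x : 0 <= enorm x. Proof. exact: sqrtr_ge0. Qed.

Lemma norm_coord3_le x i : `|coord3 x i| <= enorm x.
Proof.
rewrite -sqrtr_sqr ler_wsqrtr// dotpp (bigD1 i)//= lerDl.
by apply: sumr_ge0 => j _; exact: sqr_ge0.
Qed.

Lemma enorm_le_coord x (M : R) : (forall i, `|coord3 x i| <= M) ->
  enorm x <= 2 * M.
Proof.
move=> h; have M0 : 0 <= M := le_trans (normr_ge0 _) (h 0).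
rewrite -[leRHS]ger0_norm ?mulr_ge0// -sqrtr_sqr ler_wsqrtr// dotpp.
have H i : coord3 x i ^+ 2 <= M ^+ 2.
  by rewrite -real_normK ?num_real// lerXn2r// nnegrE.
rewrite !big_ord_recl big_ord0 addr0.
by have := H ord0; have := H (lift ord0 ord0); have := H (lift ord0 (lift ord0 ord0)); nra.
Qed.

Lemma tdist_has_inf x y : has_inf [set enorm (x - y + zvec k) | k in setT].
Proof.
split; first by exists (enorm (x - y + zvec (0, 0, 0))), (0, 0, 0).
by exists 0 => _ [k _ <-]; exact: enorm_ge0.
Qed.

Lemma tdist_le x y k : tdist x y <= enorm (x - y + zvec k).
Proof.
by apply: ge_inf; [have [] := tdist_has_inf x y|exists k].
Qed.

Lemma tdist_ge0 x y : 0 <= tdist x y.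
Proof.
apply: lb_le_inf; first by have [] := tdist_has_inf x y.
by move=> _ [k _ <-]; exact: enorm_ge0.
Qed.

Lemma tdist_le_sd x y : tdist x y <= sd x y.
Proof.
have [k hk] := nearest_zvec x y.
apply: (le_trans (tdist_le x y k)); rewrite ler_wsqrtr// dotpp.
apply: ler_sum => i _; rewrite -(sin_sq_zvec x y k).
rewrite -real_normK ?num_real// -[leRHS]real_normK ?num_real//.
by rewrite lerXn2r ?nnegrE// norm_sinpi_ge.
Qed.

Lemma tdist_le1 x y : tdist x y <= 1.
Proof.
have [k hk] := nearest_zvec x y.
apply: (le_trans (tdist_le x y k)).
by rewrite (le_trans (enorm_le_coord hk))// divff.
Qed.

Lemma sd_le_tdist x y : sd x y <= 4 * tdist x y.
Proof.
rewrite mulrC -ler_pdivrMr//; apply: lb_le_inf.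
  by have [] := tdist_has_inf x y.
move=> _ [k _ <-]; rewrite ler_pdivrMr// mulrC.
rewrite -[leRHS]ger0_norm ?mulr_ge0 ?enorm_ge0// -sqrtr_sqr ler_wsqrtr//.
rewrite exprMn sqr_sqrtr ?dotpp_ge0// dotpp mulr_sumr.
apply: ler_sum => i _; rewrite -(sin_sq_zvec x y k) -exprMn.
rewrite -real_normK ?num_real// -[leRHS]real_normK ?num_real//.
rewrite lerXn2r ?nnegrE//; apply: (le_trans (norm_sin_le _)).
rewrite !normrM ler_wpM2r// (ger0_norm (pi_ge0 R)) ger0_norm//.
by have := pihalf_02 R; lra.
Qed.

Lemma tdist0_sd0 x y : tdist x y = 0 -> sd x y = 0.
Proof.
move=> t0; apply/eqP; rewrite eq_le sd_ge0 andbT.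
by rewrite (le_trans (sd_le_tdist x y))// t0 mulr0.
Qed.

Lemma sd0_same_point x y : sd x y = 0 -> same_point x y.
Proof.
move=> s0; have [[[k0 k1] k2] hk] := nearest_zvec x y.
have H i : coord3 (x - y + zvec (k0, k1, k2)) i = 0.
  apply/eqP; rewrite -normr_eq0 eq_le normr_ge0 andbT.
  rewrite (le_trans (norm_sinpi_ge (hk i)))//.
  by rewrite -sqrtr_sqr sin_sq_zvec sqrtr_sqr (le_trans (norm_sin_le_sd x y i))// s0.
exists (- k0, - k1, - k2); apply: coord3_inj => i; rewrite coord3D.
have -> : coord3 (zvec (- k0, - k1, - k2)) i = - coord3 (zvec (k0, k1, k2)) i :> R.
  by have [->|->|->] := ord3P i; rewrite /coord3 /zvec/= mulrNz.
by have := H i; rewrite coord3D coord3B; lra.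
Qed.

End SineDistance.

(** * A one-dimensional kernel of finite rank *)

Section Kernel1.
Context {R : realType}.
Implicit Types (g : R -> R) (N : nat) (x y : R).

Definition periodic1 g := forall (x : R) (k : int), g (x + k%:~R) = g x.

Lemma periodic1P g : (forall x, g (x + 1) = g x) -> periodic1 g.
Proof.
move=> g1; have gn (n : nat) (x : R) : g (x + n%:R) = g x.
  elim: n x => [|n ih] x; first by rewrite addr0.
  by rewrite -natr1 addrA g1.
move=> x [n|n]; first exact: gn.
by rewrite -[in RHS](subrK n.+1%:R x) gn NegzE mulrNz.
Qed.

Lemma smooth1_measurable g : smooth1 g -> measurable_fun setT g.
Proof.
by move=> sg; apply: continuous_measurable_fun; exact: smooth1_continuous.
Qed.

Lemma periodic1_bounded g : smooth1 g -> periodic1 g ->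
  exists M, forall x, `|g x| <= M.
Proof.
move=> sg pg.
have cg : {within `[0, 1], continuous (fun x => `|g x|)}.
  apply/continuous_subspaceT => x; apply: continuous_comp.
    exact: smooth1_continuous.
  exact: norm_continuous.
have [c _ hc] := EVT_max ler01 cg.
exists `|g c| => x; rewrite -(pg x (- Num.floor x)); apply: hc.
rewrite in_itv/= mulrNz; have := floor_itv x.
by rewrite intrD1 => /andP[h1 h2]; apply/andP; split; lra.
Qed.

Lemma I_circle_derive g : smooth1 g ->
  Rintegral circle setT (derive1 g) = g 1 - g 0.
Proof.
move=> sg; have sg' := smooth1_derive sg.
have cg' : {within `[0, 1], continuous (derive1 g)}.
  by apply: continuous_subspaceT => x; exact: smooth1_continuous.
have ig' : lebesgue_measure.-integrable `[0%R, 1%R] (EFin \o derive1 g).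
  apply: continuous_compact_integrable => //; exact: segment_compact.
rewrite -Rintegral_circle; last exact: smooth1_measurable.
rewrite Rintegral_itv_bndo_bndc; last first.
  apply: integrableS ig' => //; apply: subset_itvl => /=; by rewrite bnd_simp.
rewrite /Rintegral (@continuous_FTC2 _ (derive1 g) g 0 1)//.
split; first by move=> x _; exact: smooth1_derivable.
  by apply: cvg_at_right_filter; exact: smooth1_continuous.
by apply: cvg_at_left_filter; exact: smooth1_continuous.
Qed.

(** The addition formula for the cosine and the binomial theorem split
    [cos (pi (x - y)) ^ (2N + 2)] into products of these; their total
    degree is even, hence they have period 1 although [cos (pi x)] has period 2. *)
Definition ebase N (m : nat) x : R :=
  cos (pi * x) ^+ (N.+1.*2 - m) * sin (pi * x) ^+ m.

Lemma smooth1_ebase N m : smooth1 (ebase N m).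
Proof.
apply: smooth1M; apply: smooth1X.
  rewrite (_ : (fun x => _) = fun x => cos (pi * x + 0)).
    exact/smooth1_affine/smooth1_cos.
  by apply/funext => x; rewrite addr0.
rewrite (_ : (fun x => _) = fun x => sin (pi * x + 0)).
  exact/smooth1_affine/smooth1_sin.
by apply/funext => x; rewrite addr0.
Qed.

Lemma ebase_periodic N (m : 'I_(N.+1.*2.+1)) : periodic1 (ebase N m).
Proof.
apply: periodic1P => x; rewrite /ebase mulrDr mulr1 cosDpi sinDpi.
rewrite (exprNn (cos _)) (exprNn (sin _)) mulrACA -exprD subnK.
  by rewrite -signr_odd odd_double expr0 mul1r.
by rewrite -ltnS.
Qed.

Lemma cos_pow_expand N x y : cos (pi * (x - y)) ^+ N.+1.*2 =
  \sum_(m < N.+1.*2.+1) ('C(N.+1.*2, m))%:R * (ebase N m x * ebase N m y).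
Proof.
rewrite mulrBr cosB exprDn; apply: eq_bigr => m _.
by rewrite /ebase -[LHS]mulr_natl !exprMn; congr (_ * _); ring.
Qed.

Definition cpow N x : R := cos (pi * x) ^+ N.+1.*2.

Lemma cpowE N x : cpow N x = (1 - sin (pi * x) ^+ 2) ^+ N.+1.
Proof. by rewrite /cpow -cos2sin2 -exprM mul2n. Qed.

Lemma sin2_itv (t : R) : 0 <= sin t ^+ 2 <= 1.
Proof. by rewrite sqr_ge0/= -(cos2Dsin2 t) lerDr sqr_ge0. Qed.

Lemma cpow_itv N x : 0 <= cpow N x <= 1.
Proof.
rewrite cpowE; have /andP[h0 h1] := sin2_itv (pi * x).
by rewrite exprn_ge0 ?subr_ge0//= exprn_ile1// ?subr_ge0// lerBlDr lerDl.
Qed.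

Lemma smooth1_cpow N : smooth1 (cpow N).
Proof.
rewrite /cpow; apply: smooth1X.
rewrite (_ : (fun x => _) = fun x => cos (pi * x + 0)).
  exact/smooth1_affine/smooth1_cos.
by apply/funext => x; rewrite addr0.
Qed.

Definition kmass N : R := Rintegral circle setT (cpow N).

Definition sqn N : R := Num.sqrt N.+1%:R.

Lemma sqn_gt0 N : 0 < sqn N. Proof. by rewrite sqrtr_gt0. Qed.

Lemma sqnK N : sqn N ^+ 2 = N.+1%:R. Proof. by rewrite sqr_sqrtr. Qed.

(** Bernoulli's inequality, in the form that bounds the kernel from below near
    its peak. *)
Lemma bernoulli (a : R) n : 0 <= a <= 1 -> 1 - n%:R * a <= (1 - a) ^+ n.
Proof.
move=> /andP[a0 a1]; elim: n => [|n ih]; first by rewrite expr0 mul0r subr0.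
have h : 0 <= n%:R * a by rewrite mulr_ge0.
have := ler_wpM2r (_ : 0 <= 1 - a) ih; rewrite subr_ge0 => /(_ a1).
by rewrite -exprSr; apply: le_trans; rewrite -natr1; nra.
Qed.

Lemma pow_le_exp (a : R) n : 0 <= a <= 1 -> (1 - a) ^+ n <= expR (- (n%:R * a)).
Proof.
move=> /andP[a0 a1]; rewrite -mulrN expRM_natl lerXn2r ?nnegrE ?subr_ge0 ?expR_ge0//.
exact: expR_ge1Dx.
Qed.

(** On an interval of length [1 / (6 sqrt(N + 1))] the power of the cosine is at
    least 1/2, by Bernoulli's inequality and [sin (pi x) <= 4 x]. *)
Lemma kmass_ge N : (12 * sqn N)^-1 <= kmass N.
Proof.
have q0 := sqn_gt0 N; have q2 := sqnK N.
have q1 : 1 <= sqn N by rewrite -sqrtr1 ler_wsqrtr// ler1n.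
(* small enough for [(N + 1) (4 D)^2 <= 1/2], which Bernoulli needs *)
pose D : R := (6 * sqn N)^-1.
have D0 : 0 < D by rewrite invr_gt0 mulr_gt0.
have Dq : D * (6 * sqn N) = 1 by rewrite mulVf// gt_eqF// mulr_gt0.
have D1 : D < 1 by rewrite invf_lt1 ?mulr_gt0//; lra.
have mA : measurable (`[0, D] : set R) by exact: measurable_itv.
have sA : summ circle (\1_(`[0, D] : set R)).
  by apply: (@summ_circle_bounded _ _ 1) => // x; rewrite indicE; case: (_ \in _); rewrite ?normr1 ?normr0.
have scp : summ circle (cpow N).
  apply: (@summ_circle_bounded _ _ 1).
    exact: (smooth1_measurable (smooth1_cpow N)).
  by move=> x; have /andP[h0 h1] := cpow_itv N x; rewrite ger0_norm.
apply: (@le_trans _ _ (Rintegral circle setT (fun x => 2^-1 * \1_(`[0, D] : set R) x))).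
  rewrite (IZ _ sA) /Rintegral integral_indic// setIT /=.
  rewrite /circle_measure setIidl; last first.
    by apply: subset_itvl; rewrite bnd_simp.
  rewrite lebesgue_measure_itv/= lte_fin D0 sube0 /= /D.
  by rewrite -invfM le_eqVlt; apply/orP; left; apply/eqP; congr (_^-1); ring.
apply: le_I => //; first exact: summZ.
move=> x; rewrite indicE; case: (boolP (x \in _)); last first.
  by rewrite mulr0; have /andP[] := cpow_itv N x.
rewrite inE/= in_itv/= => /andP[x0 xD]; rewrite mulr1 cpowE.
have h := sin2_itv (pi * x).
apply: (le_trans _ (bernoulli _ h)).
have s2 : sin (pi * x) ^+ 2 <= (4 * x) ^+ 2.
  rewrite -real_normK ?num_real// lerXn2r ?nnegrE//; first by rewrite mulr_ge0.
  rewrite (le_trans (norm_sin_le _))// normrM (ger0_norm x0) ler_wpM2r//.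
  by rewrite ger0_norm ?pi_ge0//; have := pihalf_02 R; lra.
have s3 : (4 * x) ^+ 2 <= (4 * D) ^+ 2.
  by rewrite lerXn2r ?nnegrE ?mulr_ge0 ?ler_wpM2l// ltW.
have : N.+1%:R * sin (pi * x) ^+ 2 <= N.+1%:R * (4 * D) ^+ 2.
  by rewrite ler_wpM2l// (le_trans s2).
rewrite -q2 => /le_trans h2.
suff : sqn N ^+ 2 * (4 * D) ^+ 2 <= 2^-1 by move=> /h2; lra.
rewrite -exprMn (_ : sqn N * (4 * D) = 2 / 3 * (D * (6 * sqn N))); last by field.
rewrite Dq; lra.
Qed.

Lemma kmass_gt0 N : 0 < kmass N.
Proof.
by apply: lt_le_trans (kmass_ge N); rewrite invr_gt0 mulr_gt0// sqn_gt0.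
Qed.

Definition knorm N : R := (kmass N)^-1.

Lemma knorm_ge0 N : 0 <= knorm N.
Proof. by rewrite invr_ge0 ltW// kmass_gt0. Qed.

Lemma knorm_le N : knorm N <= 12 * sqn N.
Proof.
rewrite -[leRHS]invrK lef_pV2 ?posrE ?kmass_gt0//; first exact: kmass_ge.
by rewrite invr_gt0 mulr_gt0// sqn_gt0.
Qed.

Definition kcoef N (m : nat) : R := knorm N * ('C(N.+1.*2, m))%:R.

Definition k1 N x y : R := knorm N * cpow N (x - y).

Lemma k1E N x y : k1 N x y =
  \sum_(m < N.+1.*2.+1) kcoef N m * (ebase N m x * ebase N m y).
Proof.
rewrite /k1 /cpow cos_pow_expand mulr_sumr; apply: eq_bigr => m _.
by rewrite mulrA.
Qed.

(** Defined through the finite rank expansion, like the kernel: this is the form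
    in which derivatives meet the moments of a field. *)
Definition dk1 N x y : R :=
  \sum_(m < N.+1.*2.+1) kcoef N m * (derive1 (ebase N m) x * ebase N m y).

Lemma is_derive1_sum (J : Type) (s : seq J) (F : J -> R -> R) (F' : J -> R)
    (x : R) : (forall j, is_derive x 1 (F j) (F' j)) ->
  is_derive x 1 (fun y => \sum_(j <- s) F j y) (\sum_(j <- s) F' j).
Proof.
move=> dF; elim: s => [|j s ih].
  rewrite big_nil; under [fun _ => _]funext => y do rewrite big_nil.
  exact: is_derive_cst.
rewrite big_cons; under [fun _ => _]funext => y do rewrite big_cons.
exact: is_derive1D.
Qed.

Lemma is_derive1X (f : R -> R) (n : nat) (x a : R) : is_derive x 1 f a ->
  is_derive x 1 (fun y => f y ^+ n.+1) (n.+1%:R * f x ^+ n * a).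
Proof.
move=> df; elim: n => [|n ih].
  by rewrite expr0 !mul1r; exact: df.
under [fun _ => _]funext => y do rewrite exprS.
apply: (is_derive_eq (is_derive1M df ih)).
by rewrite exprS -[n.+2%:R]natr1; ring.
Qed.

Lemma is_derive_k1 N x y : is_derive x 1 (fun x => k1 N x y) (dk1 N x y).
Proof.
under [fun x => k1 _ _ _]funext => z do rewrite k1E.
apply: is_derive1_sum => m.
under [fun _ => _]funext => z do rewrite mulrA.
apply: (is_derive_eq (is_derive1M
  (is_derive1Z (kcoef N m) (smooth1_is_derive x (smooth1_ebase N m)))
  (is_derive_cst (ebase N m y) x (1 : R)))).
by rewrite /cst; ring.
Qed.

Lemma dk1E N x y : dk1 N x y =
  - (knorm N * (pi * N.+1.*2%:R) *
     (cos (pi * (x - y)) ^+ N.+1.*2.-1 * sin (pi * (x - y)))).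
Proof.
have h := is_derive_k1 N x y.
suff h2 : is_derive x 1 (fun x => k1 N x y) (- (knorm N * (pi * N.+1.*2%:R) *
     (cos (pi * (x - y)) ^+ N.+1.*2.-1 * sin (pi * (x - y))))).
  by rewrite -(@derive_val _ _ _ _ _ _ _ h) (@derive_val _ _ _ _ _ _ _ h2).
rewrite /k1 /cpow.
under [fun _ => _]funext => z do rewrite mulrBr -mulrN.
have dc : is_derive (x : R) 1 (fun z => cos (pi * z + pi * - y))
    (pi * - sin (pi * x + pi * - y)).
  exact: (is_derive_affine (is_derive_cos _)).
apply: (is_derive_eq (is_derive1Z (knorm N) (is_derive1X N.+1.*2.-1 dc))).
by rewrite mulrBr -mulrN doubleS /=; move: N.*2 => e; ring.
Qed.

Lemma k1C N x y : k1 N x y = k1 N y x.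
Proof. by rewrite /k1 /cpow -(opprB y x) mulrN cosN. Qed.

Lemma dk1_anti N x y : dk1 N x y = - dk1 N y x.
Proof.
by rewrite !dk1E -(opprB y x) mulrN cosN sinN; ring.
Qed.

Lemma k1_ge0 N x y : 0 <= k1 N x y.
Proof.
by rewrite mulr_ge0 ?knorm_ge0//; have /andP[] := cpow_itv N (x - y).
Qed.

Lemma summ_ebase N (m : 'I_(N.+1.*2.+1)) : summ circle (ebase N m).
Proof.
have [M hM] := periodic1_bounded (smooth1_ebase N m) (@ebase_periodic N m).
apply: (summ_circle_bounded _ hM); exact: (smooth1_measurable (smooth1_ebase N m)).
Qed.

Lemma summ_k1 N x : summ circle (k1 N x).
Proof.
rewrite (funext (k1E N x)).
apply: summ_sum => m; apply: summZ; apply: summZ; exact: summ_ebase.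
Qed.

Lemma periodic1_derive g : smooth1 g -> periodic1 g -> periodic1 (derive1 g).
Proof.
move=> sg pg x k; rewrite -[in RHS](_ : (fun x => g (1 * x + k%:~R)) = g).
  have := is_derive_affine (smooth1_is_derive (1 * x + k%:~R) sg).
  by rewrite mul1r => h; rewrite [RHS]derive1E (@derive_val _ _ _ _ _ _ _ h) mul1r.
by apply/funext => z; rewrite mul1r pg.
Qed.

Lemma I_derive_ebase N (m : 'I_(N.+1.*2.+1)) :
  Rintegral circle setT (derive1 (ebase N m)) = 0.
Proof.
rewrite I_circle_derive; last exact: smooth1_ebase.
by have := @ebase_periodic N m 0 1; rewrite add0r => ->; rewrite subrr.
Qed.

Lemma summ_derive_ebase N (m : 'I_(N.+1.*2.+1)) :
  summ circle (derive1 (ebase N m)).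
Proof.
have se := smooth1_derive (smooth1_ebase N m).
have pe := periodic1_derive (smooth1_ebase N m) (@ebase_periodic N m).
have [M hM] := periodic1_bounded se pe.
exact: (summ_circle_bounded (smooth1_measurable se) hM).
Qed.

Lemma I_k1 N x : Rintegral circle setT (k1 N x) = 1.
Proof.
pose f x := Rintegral circle setT (k1 N x).
have fE : f = fun x => \sum_(m < N.+1.*2.+1)
    kcoef N m * (ebase N m x * Rintegral circle setT (ebase N m)).
  apply/funext => z; rewrite /f; under eq_I do rewrite k1E.
  rewrite Isum; last by move=> m; do 2 apply: summZ; exact: summ_ebase.
  apply: eq_bigr => m _; rewrite IZ; last by apply: summZ; exact: summ_ebase.
  by rewrite IZ//; exact: summ_ebase.
have df z : is_derive (z : R) 1 f 0.
  rewrite fE.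
  have h : is_derive z 1 (fun x => \sum_(m < N.+1.*2.+1)
    kcoef N m * (ebase N m x * Rintegral circle setT (ebase N m)))
    (\sum_(m < N.+1.*2.+1) kcoef N m *
      (derive1 (ebase N m) z * Rintegral circle setT (ebase N m))).
    apply: is_derive1_sum => m.
    apply: is_derive1Z.
    apply: (is_derive_eq (is_derive1M
      (smooth1_is_derive z (smooth1_ebase N m))
      (is_derive_cst (Rintegral circle setT (ebase N m)) z (1 : R)))).
    by rewrite /cst; ring.
  apply: (is_derive_eq h).
  transitivity (Rintegral circle setT (dk1 N z)).
    rewrite /dk1 Isum; last by move=> m; do 2 apply: summZ; exact: summ_ebase.
    apply: eq_bigr => m _; rewrite IZ; last by apply: summZ; exact: summ_ebase.
    by rewrite IZ//; exact: summ_ebase.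
  under eq_I do rewrite dk1_anti -mulN1r /dk1.
  rewrite IZ; last first.
    apply: summ_sum => m; apply: summZ.
    under [fun _ => _]funext => y do rewrite mulrC.
    by apply: summZ; exact: summ_derive_ebase.
  rewrite Isum; last first.
    move=> m; apply: summZ.
    under [fun _ => _]funext => y do rewrite mulrC.
    by apply: summZ; exact: summ_derive_ebase.
  rewrite big1 ?mulr0// => m _.
  under eq_I => y do rewrite [X in _ * X]mulrC.
  rewrite IZ; last by apply: summZ; exact: summ_derive_ebase.
  by rewrite IZ; [rewrite I_derive_ebase !mulr0|exact: summ_derive_ebase].
transitivity (f 0); first exact: (@is_derive_0_is_cst _ f x 0 df).
rewrite /f /k1 IZ.
  rewrite (_ : Rintegral _ _ _ = kmass N) ?mulVf ?gt_eqF ?kmass_gt0//.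
  by apply: eq_I => y; rewrite /cpow sub0r mulrN cosN.
apply: (@summ_circle_bounded _ _ 1).
  have -> : (fun x => cpow N (0 - x)) = cpow N.
    by apply/funext => y; rewrite /cpow sub0r mulrN cosN.
  exact: (smooth1_measurable (smooth1_cpow N)).
by move=> z; have /andP[h0 h1] := cpow_itv N (0 - z); rewrite ger0_norm.
Qed.

Lemma k1_le N x y :
  k1 N x y <= 12 * sqn N * expR (- (N.+1%:R * sin (pi * (x - y)) ^+ 2)).
Proof.
rewrite /k1 ler_pM//; first exact: knorm_ge0.
- by have /andP[] := cpow_itv N (x - y).
- exact: knorm_le.
- by rewrite cpowE; exact/pow_le_exp/sin2_itv.
Qed.

(** One power of the cosine is lost to the derivative; the factor [exp 1] pays
    for it in the Gaussian bound. *)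
Lemma dk1_le N x y : `|dk1 N x y| <=
  12 * sqn N * (8 * N.+1%:R * expR 1) *
  (`|sin (pi * (x - y))| * expR (- (N.+1%:R * sin (pi * (x - y)) ^+ 2))).
Proof.
rewrite dk1E normrN normrM [X in _ <= _ * X]mulrC.
rewrite (_ : 12 * sqn N * _ * _ = 12 * sqn N * (4 * (2 * N.+1%:R)) *
   (expR 1 * expR (- (N.+1%:R * sin (pi * (x - y)) ^+ 2)) *
    `|sin (pi * (x - y))|)); last by ring.
rewrite ler_pM// ?normr_ge0//.
  rewrite !normrM (ger0_norm (knorm_ge0 N)) (ger0_norm (pi_ge0 R)) normr_nat.
  rewrite ler_pM ?mulr_ge0 ?knorm_ge0 ?pi_ge0 ?knorm_le//.
  rewrite -mul2n natrM ler_wpM2r ?mulr_ge0//.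
  by have := pihalf_02 R; lra.
rewrite normrM ler_wpM2r//.
rewrite (_ : N.+1.*2.-1 = (2 * N).+1); last by rewrite mul2n doubleS.
rewrite exprS normrM.
set s := sin (pi * (x - y)).
apply: (@le_trans _ _ (1 * expR (- (N%:R * s ^+ 2)))).
  rewrite ler_pM// ?cos_max// exprM cos2sin2 ger0_norm.
    exact/pow_le_exp/sin2_itv.
  by rewrite exprn_ge0// subr_ge0; have /andP[] := sin2_itv (pi * (x - y)).
rewrite mul1r -expRD ler_expR -natr1 mulrDl mul1r opprD.
by have /andP[_] := sin2_itv (pi * (x - y)); rewrite -/s; lra.
Qed.

End Kernel1.

(** * The kernel on the torus *)

Lemma ler_pM3 (R : numDomainType) (a0 a1 a2 b0 b1 b2 : R) :
  0 <= a0 -> 0 <= a1 -> 0 <= a2 -> a0 <= b0 -> a1 <= b1 -> a2 <= b2 ->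
  a0 * a1 * a2 <= b0 * b1 * b2.
Proof.
move=> p0 p1 p2 h0 h1 h2; apply: ler_pM => //; first exact: mulr_ge0.
exact: ler_pM.
Qed.

Section Kernel3.
Context {R : realType}.
Implicit Types (N : nat) (x y : vec R).

(** The index [J] of the expansion of the kernel: one exponent per coordinate. *)
Definition Idx N := ('I_(N.+1.*2.+1) * 'I_(N.+1.*2.+1) * 'I_(N.+1.*2.+1))%type.

Definition idx N (J : Idx N) (i : 'I_3) : 'I_(N.+1.*2.+1) :=
  if i == 0 then J.1.1 else if i == 1 then J.1.2 else J.2.

Definition ebs N (J : Idx N) : 'I_3 -> R -> R := fun i => ebase N (idx J i).

Definition coef N (J : Idx N) : R := kcoef N J.1.1 * kcoef N J.1.2 * kcoef N J.2.

Lemma smooth3_ebs N (J : Idx N) : smooth3 (ebs J).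
Proof. by move=> i; exact: smooth1_ebase. Qed.

Lemma periodic3_ebs N (J : Idx N) : periodic3 (ebs J).
Proof. by move=> i; exact: ebase_periodic. Qed.

Lemma periodic3_dere i (e : 'I_3 -> R -> R) : smooth3 e -> periodic3 e ->
  periodic3 (dere i e).
Proof.
move=> se pe j; rewrite /dere; case: ifP => // _.
exact: periodic1_derive (se j) (pe j).
Qed.

Lemma sum_Idx N (c a0 a1 a2 b0 b1 b2 : 'I_(N.+1.*2.+1) -> R) :
  \sum_(J : Idx N) (c J.1.1 * c J.1.2 * c J.2) *
     ((a0 J.1.1 * a1 J.1.2 * a2 J.2) * (b0 J.1.1 * b1 J.1.2 * b2 J.2)) =
  (\sum_m c m * (a0 m * b0 m)) * (\sum_m c m * (a1 m * b1 m)) *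
  (\sum_m c m * (a2 m * b2 m)).
Proof.
rewrite big_distrlr /= pair_big /= big_distrlr /= pair_big /=.
by apply: eq_bigr => J _; ring.
Qed.

Definition Kern N x y : R :=
  \sum_(J : Idx N) coef J * (prodf (ebs J) x * prodf (ebs J) y).

Definition dKern N i x y : R :=
  \sum_(J : Idx N) coef J * (prodf (dere i (ebs J)) x * prodf (ebs J) y).

Lemma KernE N x y :
  Kern N x y = k1 N x.1.1 y.1.1 * k1 N x.1.2 y.1.2 * k1 N x.2 y.2.
Proof. by rewrite !k1E -sum_Idx. Qed.

Definition k1d N (b : bool) (s t : R) := if b then dk1 N s t else k1 N s t.

Lemma dKernE N i x y : dKern N i x y =
  k1d N (0 == i) x.1.1 y.1.1 * k1d N (1 == i) x.1.2 y.1.2 * k1d N (2 == i) x.2 y.2.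
Proof.
have [->|->|->] := ord3P i; rewrite /k1d /=.
- by rewrite !k1E /dk1 -(sum_Idx _ (fun m => derive1 (ebase N m) _)).
- by rewrite !k1E /dk1 -(sum_Idx _ _ (fun m => derive1 (ebase N m) _)).
- by rewrite !k1E /dk1 -(sum_Idx _ _ _ (fun m => derive1 (ebase N m) _)).
Qed.

Lemma dKern_anti N i x y : dKern N i x y = - dKern N i y x.
Proof.
rewrite !dKernE; have [->|->|->] := ord3P i; rewrite /k1d /=.
- by rewrite dk1_anti [k1 N x.1.2 _]k1C [k1 N x.2 _]k1C; ring.
- by rewrite dk1_anti [k1 N x.1.1 _]k1C [k1 N x.2 _]k1C; ring.
- by rewrite dk1_anti [k1 N x.1.1 _]k1C [k1 N x.1.2 _]k1C; ring.
Qed.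

Lemma dKern_anti_sum N i x y :
  \sum_(J : Idx N) coef J * (prodf (ebs J) x * prodf (dere i (ebs J)) y) =
  - \sum_(J : Idx N) coef J * (prodf (dere i (ebs J)) x * prodf (ebs J) y).
Proof.
rewrite -/(dKern N i x y) dKern_anti opprK; apply: eq_bigr => J _.
by congr (_ * _); exact: mulrC.
Qed.

Lemma is_derive_sumV (V : normedModType R) (z v : V) (J : Type) (s : seq J)
    (F : J -> V -> R) (F' : J -> R) : (forall j, is_derive z v (F j) (F' j)) ->
  is_derive z v (fun w => \sum_(j <- s) F j w) (\sum_(j <- s) F' j).
Proof.
move=> dF; elim: s => [|j s ih].
  rewrite big_nil; under [fun _ => _]funext => w do rewrite big_nil.
  exact: is_derive_cst.
rewrite big_cons; under [fun _ => _]funext => w do rewrite big_cons.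
exact: is_deriveD.
Qed.

Lemma is_derive_prodf_sum N j (e : Idx N -> 'I_3 -> R -> R) (c : Idx N -> R) x :
  (forall J, smooth3 (e J)) ->
  is_derive x (basis3 j) (fun x => \sum_J c J * prodf (e J) x)
    (\sum_J c J * prodf (dere j (e J)) x).
Proof.
move=> se; apply: is_derive_sumV => J.
exact: (is_deriveZ (c J) (is_derive_prodf j x (se J))).
Qed.

Lemma Kern_ge0 N x y : 0 <= Kern N x y.
Proof.
by rewrite KernE; apply: mulr_ge0; [apply: mulr_ge0|]; exact: k1_ge0.
Qed.

Lemma I_Kern N x : Rintegral torus setT (Kern N x) = 1.
Proof.
have [_ h] := I_prod3 (summ_k1 N x.1.1) (summ_k1 N x.1.2) (summ_k1 N x.2).
by rewrite (eq_I _ (KernE N x)) h !I_k1 !mulr1.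
Qed.

Lemma summ_Kern N x : summ torus (Kern N x).
Proof.
have [h _] := I_prod3 (summ_k1 N x.1.1) (summ_k1 N x.1.2) (summ_k1 N x.2).
by rewrite (_ : Kern N x = fun y => k1 N x.1.1 y.1.1 * k1 N x.1.2 y.1.2 * k1 N x.2 y.2) //;
  apply/funext => y; rewrite KernE.
Qed.

Let gauss N x y : R := expR (- (N.+1%:R * sd x y ^+ 2)).

Lemma sum3E (F : 'I_3 -> R) : \sum_(i < 3) F i = F 0 + F 1 + F 2.
Proof.
rewrite !big_ord_recl big_ord0 addr0 addrA.
by congr (F _ + F _ + F _); exact: val_inj.
Qed.

Lemma gaussE N x y : gauss N x y =
  expR (- (N.+1%:R * sin (pi * (x.1.1 - y.1.1)) ^+ 2)) *
  expR (- (N.+1%:R * sin (pi * (x.1.2 - y.1.2)) ^+ 2)) *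
  expR (- (N.+1%:R * sin (pi * (x.2 - y.2)) ^+ 2)).
Proof. by rewrite /gauss sd_sq sum3E /coord3/= -!expRD; congr expR; ring. Qed.

Lemma Kern_le N x y : Kern N x y <= (12 * sqn N) ^+ 3 * gauss N x y.
Proof.
rewrite KernE gaussE.
have h a b := @k1_le R N a b; have k0 a b := @k1_ge0 R N a b.
apply: (@le_trans _ _ ((12 * sqn N * expR (- (N.+1%:R * sin (pi * (x.1.1 - y.1.1)) ^+ 2))) *
  (12 * sqn N * expR (- (N.+1%:R * sin (pi * (x.1.2 - y.1.2)) ^+ 2))) *
  (12 * sqn N * expR (- (N.+1%:R * sin (pi * (x.2 - y.2)) ^+ 2))))).
  exact: ler_pM3.
by rewrite le_eqVlt; apply/orP; left; apply/eqP; ring.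
Qed.

(** The sine in the derivative of one factor is at most the distance, so that
    a derivative costs a factor [N * sd]. *)
Lemma dKern_le N i x y : `|dKern N i x y| <=
  (12 * sqn N) ^+ 3 * (8 * N.+1%:R * expR 1) * (sd x y * gauss N x y).
Proof.
rewrite dKernE gaussE.
have h a b := @k1_le R N a b; have k0 a b := @k1_ge0 R N a b.
have h' a b := @dk1_le R N a b.
pose e0 := expR (- (N.+1%:R * sin (pi * (x.1.1 - y.1.1)) ^+ 2)).
pose e1 := expR (- (N.+1%:R * sin (pi * (x.1.2 - y.1.2)) ^+ 2)).
pose e2 := expR (- (N.+1%:R * sin (pi * (x.2 - y.2)) ^+ 2)).
have e00 : 0 <= e0 := expR_ge0 _.
have e10 : 0 <= e1 := expR_ge0 _.
have e20 : 0 <= e2 := expR_ge0 _.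
have C0 : 0 <= 8 * N.+1%:R * expR 1 :> R by rewrite !mulr_ge0// expR_ge0.
have q0 : 0 <= 12 * sqn N :> R by rewrite mulr_ge0// sqrtr_ge0.
apply: (@le_trans _ _ ((12 * sqn N) ^+ 3 * (8 * N.+1%:R * expR 1) *
    (`|sin (pi * (coord3 x i - coord3 y i))| * (e0 * e1 * e2)))); last first.
  apply: ler_wpM2l; first by apply: mulr_ge0 => //; exact: exprn_ge0.
  apply: ler_wpM2r; last exact: norm_sin_le_sd.
  by apply: mulr_ge0 => //; exact: mulr_ge0.
rewrite !normrM; have [->|->|->] := ord3P i; rewrite /k1d /coord3 /=.
- rewrite !(ger0_norm (k0 _ _)).
  apply: (@le_trans _ _ ((12 * sqn N * (8 * N.+1%:R * expR 1) *
    (`|sin (pi * (x.1.1 - y.1.1))| * e0)) * (12 * sqn N * e1) * (12 * sqn N * e2))).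
    by apply: ler_pM3 => //; exact: h'.
  by rewrite le_eqVlt; apply/orP; left; apply/eqP; ring.
- rewrite !(ger0_norm (k0 _ _)).
  apply: (@le_trans _ _ ((12 * sqn N * e0) * (12 * sqn N * (8 * N.+1%:R * expR 1) *
    (`|sin (pi * (x.1.2 - y.1.2))| * e1)) * (12 * sqn N * e2))).
    by apply: ler_pM3 => //; exact: h'.
  by rewrite le_eqVlt; apply/orP; left; apply/eqP; ring.
- rewrite !(ger0_norm (k0 _ _)).
  apply: (@le_trans _ _ ((12 * sqn N * e0) * (12 * sqn N * e1) *
    (12 * sqn N * (8 * N.+1%:R * expR 1) * (`|sin (pi * (x.2 - y.2))| * e2)))).
    by apply: ler_pM3 => //; exact: h'.
  by rewrite le_eqVlt; apply/orP; left; apply/eqP; ring.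
Qed.

Lemma pow6_gauss (z : R) : z ^+ 6 * expR (- z ^+ 2) <= 6.
Proof.
rewrite expRN ler_pdivrMr ?expR_gt0//.
have := @expR_ge1Dxn R (z ^+ 2) 2 (sqr_ge0 z).
rewrite -exprM -[(2 * 3)%N]/6%N (_ : 3`! = 6)//.
have h : 0 <= z ^+ 6 by rewrite (exprM z 3 2) sqr_ge0.
by lra.
Qed.

Lemma gauss_pow_le (z : R) (n : nat) : 0 <= z -> (3 <= n <= 5)%N ->
  z ^+ n * expR (- z ^+ 2) <= 7 /\ z * (z ^+ n * expR (- z ^+ 2)) <= 7.
Proof.
move=> z0 /andP[n3 n5]; have h6 := pow6_gauss z.
have e0 := expR_ge0 (- z ^+ 2).
have e1 : expR (- z ^+ 2) <= 1 by rewrite expR_le1 oppr_le0 sqr_ge0.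
have key m : (m <= 6)%N -> z ^+ m * expR (- z ^+ 2) <= 7.
  move=> m6; have [z1|z1] := leP z 1.
    have : z ^+ m <= 1 by rewrite exprn_ile1.
    have : 0 <= z ^+ m by rewrite exprn_ge0.
    by nra.
  apply: (@le_trans _ _ (z ^+ 6 * expR (- z ^+ 2))); last by lra.
  by rewrite ler_wpM2r// ler_weXn2l// ltW.
split; first by apply: key; rewrite (leq_trans n5).
by rewrite mulrA -exprS key.
Qed.

(** One constant for all the uniform bounds on the weighted kernels. *)
Definition Kbound : R := 12 ^+ 3 * 8 * expR 1 * 7.

Lemma Kbound_ge0 : 0 <= Kbound.
Proof. by rewrite /Kbound !mulr_ge0// expR_ge0. Qed.

Lemma gauss_sq N x y : gauss N x y = expR (- (sqn N * sd x y) ^+ 2).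
Proof. by rewrite /gauss exprMn sqnK. Qed.

Lemma sqn_sd_ge0 N x y : 0 <= sqn N * sd x y.
Proof. by rewrite mulr_ge0 ?sd_ge0// ltW// sqn_gt0. Qed.

(** Up to constants the left-hand side is [z^5 exp(-z^2)] with
    [z = sqrt(N + 1) sd x y]: bounded, and small when [z] is large.  The second
    estimate is the quantitative form of the convergence to 0. *)
Lemma dKern_weight N i x y :
  `|dKern N i x y| * sd x y ^+ 4 <= Kbound /\
  sqn N * sd x y * (`|dKern N i x y| * sd x y ^+ 4) <= Kbound.
Proof.
have z0 := sqn_sd_ge0 N x y.
set z := sqn N * sd x y in z0 *.
have [h1 h2] := @gauss_pow_le z 5 z0 isT.
have A : `|dKern N i x y| * sd x y ^+ 4 <=
    12 ^+ 3 * 8 * expR 1 * (z ^+ 5 * expR (- z ^+ 2)).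
  apply: (le_trans (ler_wpM2r (exprn_ge0 4 (sd_ge0 x y)) (dKern_le N i x y))).
  rewrite gauss_sq -/z -(sqnK N) le_eqVlt; apply/orP; left; apply/eqP.
  by move: (expR (- z ^+ 2)) => E; rewrite /z; ring.
have C0 : 0 <= 12 ^+ 3 * 8 * expR 1 :> R by rewrite !mulr_ge0// expR_ge0.
split; first by apply: (le_trans A); rewrite /Kbound ler_wpM2l.
apply: (le_trans (ler_wpM2l z0 A)); rewrite mulrCA /Kbound ler_wpM2l//.
Qed.

Lemma sd_le2 x y : sd x y <= 2.
Proof.
rewrite -[leRHS]ger0_norm// -sqrtr_sqr ler_wsqrtr// sum3E.
have H i := sin2_itv (pi * (coord3 x i - coord3 y i)).
have /andP[_ h0] := H 0; have /andP[_ h1] := H 1; have /andP[_ h2] := H 2.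
by rewrite expr2; lra.
Qed.

(** The same for the kernel itself: [3 + al] stays between 3 and 4, and both
    powers of the distance are controlled. *)
Lemma Kern_weight (al : R) N x y : 0 < al < 1 ->
  Kern N x y * (sd x y `^ (3 + al)) <= Kbound /\
  sqn N * sd x y * (Kern N x y * (sd x y `^ (3 + al))) <= Kbound.
Proof.
move=> /andP[al0 al1].
have z0 := sqn_sd_ge0 N x y.
have [s0|s0] := eqVneq (sd x y) 0.
  by rewrite s0 powR0 ?gt_eqF// ?addr_gt0// !mulr0; split; exact: Kbound_ge0.
have spos : 0 < sd x y by rewrite lt_def s0 sd_ge0.
set z := sqn N * sd x y in z0 *.
have [h1 h2] := @gauss_pow_le z 3 z0 isT.
have pw : sd x y `^ (3 + al) <= 2 * sd x y ^+ 3.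
  rewrite powRD ?s0 ?implybT// powR_mulrn ?sd_ge0// mulrC ler_wpM2r ?exprn_ge0 ?sd_ge0//.
  apply: (@le_trans _ _ (2 `^ al)).
    by apply: ge0_ler_powR => //; rewrite ?nnegrE ?sd_ge0 ?sd_le2// ltW.
  by apply: ler1_powR; rewrite ?ler1n// ltW.
have A : Kern N x y * (sd x y `^ (3 + al)) <=
    12 ^+ 3 * 2 * (z ^+ 3 * expR (- z ^+ 2)).
  apply: (le_trans (ler_pM (Kern_ge0 _ _ _) (powR_ge0 _ _) (Kern_le N x y) pw)).
  rewrite gauss_sq -/z le_eqVlt; apply/orP; left; apply/eqP.
  by move: (expR (- z ^+ 2)) => E; rewrite /z; ring.
have C0 : 0 <= 12 ^+ 3 * 2 :> R by rewrite !mulr_ge0.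
have D0 : 12 ^+ 3 * 2 * 7 <= Kbound.
  have e1 : 1 <= expR 1 :> R by have := expR_ge1Dx (1 : R); lra.
  rewrite /Kbound ler_wpM2r// -mulrA ler_wpM2l//; lra.
split; first by rewrite (le_trans A)// (le_trans _ D0)// ler_wpM2l.
apply: (le_trans (ler_wpM2l z0 A)); rewrite (le_trans _ D0)// mulrCA ler_wpM2l//.
Qed.

Lemma sqn_cvg_weight (w : nat -> R) (s : R) : 0 < s ->
  (forall N, 0 <= w N) -> (forall N, sqn N * s * w N <= Kbound) ->
  w N @[N --> \oo] --> 0.
Proof.
move=> s0 w0 wK; apply/cvgrPdist_le => e e0.
near=> N.
rewrite sub0r normrN ger0_norm//.
have q0 := @sqn_gt0 R N.
have qs : 0 < sqn N * s by rewrite mulr_gt0.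
rewrite -(ler_pM2l qs) (le_trans (wK N))//.
have h : (Kbound / (s * e)) ^+ 2 <= N.+1%:R.
  apply: (@le_trans _ _ N%:R); last by rewrite ler_nat.
  by near: N; exact: nbhs_infty_ger.
have h2 : Kbound / (s * e) <= sqn N.
  rewrite -[leLHS]ger0_norm; last by rewrite divr_ge0 ?Kbound_ge0// mulr_ge0// ltW.
  by rewrite -sqrtr_sqr ler_wsqrtr.
by rewrite -mulrA -ler_pdivrMr// mulr_gt0.
Unshelve. all: by end_near. Qed.

Lemma k1_sin2_le N (s t : R) :
  k1 N s t * sin (pi * (s - t)) ^+ 2 <= 12 / sqn N.
Proof.
have q0 := @sqn_gt0 R N.
apply: (le_trans (ler_wpM2r (sqr_ge0 _) (k1_le N s t))).
set a := sin _ ^+ 2; have a0 : 0 <= a := sqr_ge0 _.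
rewrite ler_pdivlMr// expRN.
have e0 : 0 < expR (N.+1%:R * a) := expR_gt0 _.
rewrite (_ : _ * a * sqn N = 12 * (N.+1%:R * a) / expR (N.+1%:R * a)).
  rewrite ler_pdivrMr// ler_wpM2l//.
  by have := expR_ge1Dx (N.+1%:R * a); lra.
by rewrite -(sqnK N); field; rewrite sqnK gt_eqF.
Qed.

Lemma I_Kern_sd2 N x :
  Rintegral torus setT (fun y => Kern N x y * sd x y ^+ 2) <= 36 / sqn N.
Proof.
have q0 := @sqn_gt0 R N.
have c1 : summ circle (fun=> 1 : R) by apply: (@summ_circle_bounded _ _ 1) => // z; rewrite normr1.
have I1 : Rintegral circle setT (fun=> 1 : R) = 1.
  by rewrite Rintegral_cst// [X in fine X]circleT mulr1.
have s0 := summ_k1 N x.1.1; have s1 := summ_k1 N x.1.2; have s2 := summ_k1 N x.2.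
have [h0 i0] := I_prod3 c1 s1 s2.
have [h1 i1] := I_prod3 s0 c1 s2.
have [h2 i2] := I_prod3 s0 s1 c1.
pose g y := 12 / sqn N * (1 * k1 N x.1.2 y.1.2 * k1 N x.2 y.2) +
  12 / sqn N * (k1 N x.1.1 y.1.1 * 1 * k1 N x.2 y.2) +
  12 / sqn N * (k1 N x.1.1 y.1.1 * k1 N x.1.2 y.1.2 * 1).
have sg : summ torus g by apply: summD; first apply: summD; apply: summZ.
have Ig : Rintegral torus setT g = 36 / sqn N.
  rewrite /g ID; [|by apply: summD; apply: summZ|exact: summZ].
  rewrite ID; [|exact: summZ|exact: summZ].
  rewrite (IZ _ h0) (IZ _ h1) (IZ _ h2) i0 i1 i2 !I_k1 I1.
  by field; rewrite gt_eqF.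
have bd y : 0 <= Kern N x y * sd x y ^+ 2 <= g y.
  rewrite mulr_ge0 ?Kern_ge0 ?exprn_ge0 ?sd_ge0//=.
  rewrite sd_sq sum3E KernE /coord3 /= /g.
  have K0 := k1_sin2_le N x.1.1 y.1.1; have K1 := k1_sin2_le N x.1.2 y.1.2.
  have K2 := k1_sin2_le N x.2 y.2.
  have p0 := @k1_ge0 R N x.1.1 y.1.1; have p1 := @k1_ge0 R N x.1.2 y.1.2.
  have p2 := @k1_ge0 R N x.2 y.2.
  have Q0 := ler_wpM2r (mulr_ge0 p1 p2) K0.
  have Q1 := ler_wpM2r (mulr_ge0 p0 p2) K1.
  have Q2 := ler_wpM2r (mulr_ge0 p0 p1) K2.
  by move: Q0 Q1 Q2; nra.
rewrite -Ig; apply: le_I => //; last by move=> y; have /andP[] := bd y.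
apply: (summ_le _ _ sg); last first.
  by move=> y; have /andP[b0 b1] := bd y; rewrite ger0_norm.
apply: measurable_funM; first exact: summ_meas (summ_Kern N x).
under [fun _ => _]funext => y do rewrite sd_sq.
apply: measurable_sum => i; apply: measurable_funX.
apply: (measurableT_comp (@continuous_measurable_fun R sin (@continuous_sin R))).
apply: measurable_funM => //; apply: measurable_funB => //.
by have [->|->|->] := ord3P i; rewrite /coord3 /=; do ?apply: measurableT_comp.
Qed.

End Kernel3.

(** * Mollification by the kernel *)

Section TrigPolynomials.
Context {R : realType}.
Implicit Types (f g : vec R -> R) (e : 'I_3 -> R -> R).

(** Finite sums of products of smooth periodic functions of one coordinate: the
    algebra in which the mollified fields live. *)
Inductive TP : (vec R -> R) -> Prop :=
| TP_prodf e : smooth3 e -> periodic3 e -> TP (prodf e)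
| TPD f g : TP f -> TP g -> TP (fun x => f x + g x).

Lemma TP_cst (c : R) : TP (fun=> c).
Proof.
rewrite (_ : (fun=> c) = prodf (fun i x => if i == 0 then c else 1)).
  by apply: TP_prodf => // i; case: (i == 0) => //; exact: smooth1_cst.
by apply/funext => x; rewrite /prodf /= !mulr1.
Qed.

Lemma TPM f g : TP f -> TP g -> TP (fun x => f x * g x).
Proof.
move=> tf tg; elim: tf => [e se pe|f1 f2 _ ih1 _ ih2]; last first.
  rewrite (_ : (fun x => _) = (fun x => f1 x * g x + f2 x * g x)).
    exact: TPD.
  by apply/funext => x; rewrite mulrDl.
elim: tg => [e' se' pe'|f1 f2 _ ih1 _ ih2]; last first.
  rewrite (_ : (fun x => _) = (fun x => prodf e x * f1 x + prodf e x * f2 x)).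
    exact: TPD.
  by apply/funext => x; rewrite mulrDr.
rewrite (_ : (fun x => _) = prodf (fun i x => e i x * e' i x)).
  apply: TP_prodf; first by move=> i; apply: smooth1M.
  by move=> i x k; rewrite pe pe'.
by apply/funext => x; rewrite /prodf; ring.
Qed.

Lemma TPZ (c : R) f : TP f -> TP (fun x => c * f x).
Proof. by move=> tf; apply: TPM => //; exact: TP_cst. Qed.

Lemma TPB f g : TP f -> TP g -> TP (fun x => f x - g x).
Proof.
move=> tf tg; rewrite (_ : (fun x => _) = fun x => f x + -1 * g x).
  by apply: TPD => //; exact: TPZ.
by apply/funext => x; rewrite mulN1r.
Qed.

Lemma TP_sum (J : Type) (s : seq J) (F : J -> vec R -> R) :
  (forall j, TP (F j)) -> TP (fun x => \sum_(j <- s) F j x).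
Proof.
move=> tF; elim: s => [|j s ih].
  by under [fun _ => _]funext => x do rewrite big_nil; exact: TP_cst.
by under [fun _ => _]funext => x do rewrite big_cons; exact: TPD.
Qed.

Lemma measurable_prodf e : smooth3 e -> measurable_fun setT (prodf e).
Proof.
move=> se; have me i : measurable_fun setT (e i) by exact: smooth1_measurable.
rewrite /prodf; apply: measurable_funM; first apply: measurable_funM.
- apply: (measurableT_comp (me 0)); exact: measurableT_comp.
- apply: (measurableT_comp (me 1)); exact: measurableT_comp.
- exact: (measurableT_comp (me 2)).
Qed.

Lemma TP_measurable f : TP f -> measurable_fun setT f.
Proof.
elim=> [e se pe|f1 f2 _ m1 _ m2]; first exact: measurable_prodf.
exact: measurable_funD.
Qed.

Lemma TP_bounded f : TP f -> exists M : R, forall x, `|f x| <= M.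
Proof.
elim=> [e se pe|f1 f2 _ [M1 h1] _ [M2 h2]].
  have [M0 h0] := periodic1_bounded (se 0) (pe 0).
  have [M1 h1] := periodic1_bounded (se 1) (pe 1).
  have [M2 h2] := periodic1_bounded (se 2) (pe 2).
  exists (M0 * M1 * M2) => x; rewrite /prodf !normrM.
  by apply: ler_pM3.
exists (M1 + M2) => x; apply: (le_trans (ler_normD _ _)).
exact: lerD.
Qed.

Lemma TP_summ f : TP f -> summ torus f.
Proof.
move=> tf; have [M hM] := TP_bounded tf.
exact: summ_torus_bounded (TP_measurable tf) hM.
Qed.

Lemma summM_TP f g : summ torus f -> TP g -> summ torus (fun x => f x * g x).
Proof.
move=> sf tg; have [M hM] := TP_bounded tg.
exact: (summM_bounded sf (TP_measurable tg) hM).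
Qed.

Lemma I_prodf_dere j e : smooth3 e -> periodic3 e ->
  Rintegral torus setT (prodf (dere j e)) = 0.
Proof.
move=> se pe; have sd := smooth3_dere j se; have pd := periodic3_dere j se pe.
have sc (h : R -> R) : smooth1 h -> periodic1 h -> summ circle h.
  move=> sh ph; have [M hM] := periodic1_bounded sh ph.
  exact: summ_circle_bounded (smooth1_measurable sh) hM.
have [_ ->] := I_prod3 (sc _ (sd 0) (pd 0)) (sc _ (sd 1) (pd 1)) (sc _ (sd 2) (pd 2)).
have z : Rintegral circle setT (dere j e j) = 0.
  rewrite /dere eqxx (I_circle_derive (se j)).
  by have := pe j 0 1; rewrite add0r => ->; rewrite subrr.
by have [E|E|E] := ord3P j; rewrite E in z *; rewrite z ?mulr0 ?mul0r.
Qed.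

Lemma TP_derive j f : TP f -> exists2 f', TP f' &
  (forall x, is_derive x (basis3 j) f (f' x)) /\ Rintegral torus setT f' = 0.
Proof.
elim=> [e se pe|f1 f2 _ [f1' t1 [d1 i1]] _ [f2' t2 [d2 i2]]].
  exists (prodf (dere j e)).
    by apply: TP_prodf; [exact: smooth3_dere|exact: periodic3_dere].
  by split; [move=> x; exact: is_derive_prodf|exact: I_prodf_dere].
exists (fun x => f1' x + f2' x); first exact: TPD.
split; first by move=> x; exact: is_deriveD.
by rewrite ID ?i1 ?i2 ?addr0//; exact: TP_summ.
Qed.

(** Stokes' theorem on the torus. *)
Lemma I_TP_derive j f f' : TP f -> (forall x, is_derive x (basis3 j) f (f' x)) ->
  Rintegral torus setT f' = 0.
Proof.
move=> /(TP_derive j)[h _ [dh <-]] df; congr (Rintegral _ _ _).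
apply/funext => x.
by rewrite -(@derive_val _ _ _ _ _ _ _ (df x)) (@derive_val _ _ _ _ _ _ _ (dh x)).
Qed.

End TrigPolynomials.

Section Projections.
Context {R : realType}.
Implicit Types (f : vec R -> R) (N : nat) (x y : vec R) (s : seq 'I_3).

Local Notation I f := (Rintegral torus setT f).

(** The coefficients of [f] and of its distributional derivative, up to sign, in
    the finite rank expansion of the kernel. *)
Definition moment N (J : Idx N) f : R := I (fun y => f y * prodf (ebs J) y).

Definition dmoment N (J : Idx N) b f : R :=
  I (fun y => f y * prodf (dere b (ebs J)) y).

(** The derivative along the directions in [s] of the mollification of [f] by
    the kernel. *)
Definition PS N s f x : R :=
  \sum_(J : Idx N) coef J * (prodf (foldr dere (ebs J) s) x * moment J f).

Lemma smooth3_foldr N (J : Idx N) s : smooth3 (foldr dere (ebs J) s : 'I_3 -> R -> R).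
Proof.
elim: s => [|j s ih] /=; first exact: smooth3_ebs.
exact: smooth3_dere.
Qed.

Lemma periodic3_foldr N (J : Idx N) s :
  periodic3 (foldr dere (ebs J) s : 'I_3 -> R -> R).
Proof.
elim: s => [|j s ih] /=; first exact: periodic3_ebs.
by apply: periodic3_dere => //; exact: smooth3_foldr.
Qed.

Lemma TP_foldr N (J : Idx N) s : TP (prodf (foldr dere (ebs J) s) : vec R -> R).
Proof. by apply: TP_prodf; [exact: smooth3_foldr|exact: periodic3_foldr]. Qed.

Lemma PS_TP N s f : TP (PS N s f).
Proof.
apply: TP_sum => J; apply: TPZ.
under [fun _ => _]funext => x do rewrite mulrC.
by apply: TPZ; exact: TP_foldr.
Qed.

Lemma is_derive_PS N s f j x :
  is_derive x (basis3 j) (PS N s f) (PS N (j :: s) f x).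
Proof.
have h := @is_derive_prodf_sum _ N j (fun J => foldr dere (ebs J) s)
  (fun J => coef J * moment J f) x (fun J => smooth3_foldr J s).
have E1 : PS N s f = fun z : vec R => \sum_(J : Idx N) coef J * moment J f * prodf (foldr dere (ebs J) s) z.
  by apply/funext => z; apply: eq_bigr => J _; ring.
have E2 : PS N (j :: s) f x =
    \sum_(J : Idx N) coef J * moment J f * prodf (dere j (foldr dere (ebs J) s)) x.
  by apply: eq_bigr => J _ /=; ring.
by rewrite E1 E2.
Qed.

Lemma PS_swap N j b s f x : PS N (j :: b :: s) f x = PS N (b :: j :: s) f x.
Proof. by apply: eq_bigr => J _ /=; rewrite dereC. Qed.

Lemma moment_summ N (J : Idx N) s f : summ torus f ->
  summ torus (fun y => f y * prodf (foldr dere (ebs J) s) y).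
Proof. by move=> sf; apply: summM_TP => //; exact: TP_foldr. Qed.

Lemma summ_I_sum_kernel (J : finType) (c a : J -> R) (B : J -> vec R -> R) f :
  (forall j, summ torus (fun y => f y * B j y)) ->
  summ torus (fun y => (\sum_j c j * (a j * B j y)) * f y) /\
  I (fun y => (\sum_j c j * (a j * B j y)) * f y) =
    \sum_j c j * (a j * I (fun y => f y * B j y)).
Proof.
move=> sB.
have -> : (fun y => (\sum_j c j * (a j * B j y)) * f y) =
    (fun y => \sum_j (c j * a j) * (f y * B j y)).
  by apply/funext => y; rewrite mulr_suml; apply: eq_bigr => j _; ring.
split; first by apply: summ_sum => j; exact: summZ.
rewrite Isum; last by move=> j; exact: summZ.
by apply: eq_bigr => j _; rewrite IZ// mulrA.
Qed.

Lemma PS_kernel N s f x : summ torus f -> PS N s f x =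
  I (fun y => (\sum_(J : Idx N) coef J *
     (prodf (foldr dere (ebs J) s) x * prodf (ebs J) y)) * f y).
Proof.
move=> sf; have [_ ->] := @summ_I_sum_kernel (Idx N) (@coef R N)
  (fun J => prodf (foldr dere (ebs J) s) x) (fun J => prodf (ebs J)) f
  (fun J => moment_summ J [::] sf).
by [].
Qed.

Lemma PS0_kernel N f x : summ torus f ->
  PS N [::] f x = I (fun y => Kern N x y * f y).
Proof. exact: PS_kernel. Qed.

(** Integrating by parts against the kernel: a derivative of the test function
    is minus a derivative of the mollified function. *)
Lemma PS_dmoment N s b f x : summ torus f ->
  \sum_(J : Idx N) coef J *
     (prodf (foldr dere (ebs J) s) x * dmoment J b f) =
  - PS N (rcons s b) f x.
Proof.
move=> sf.
have K z y : \sum_(J : Idx N) coef J * (prodf (foldr dere (ebs J) s) z * prodf (dere b (ebs J)) y) =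
    - \sum_(J : Idx N) coef J * (prodf (foldr dere (ebs J) (rcons s b)) z * prodf (ebs J) y).
  elim: s z => [|j s ih] z /=; first exact: dKern_anti_sum.
  have h1 := @is_derive_prodf_sum _ N j (fun J => foldr dere (ebs J) s)
    (fun J => coef J * prodf (dere b (ebs J)) y) z (fun J => smooth3_foldr J s).
  have h2 := @is_derive_prodf_sum _ N j (fun J => foldr dere (ebs J) (rcons s b))
    (fun J => - (coef J * prodf (ebs J) y)) z (fun J => smooth3_foldr J (rcons s b)).
  have E : (fun x => \sum_(J : Idx N) coef J * prodf (dere b (ebs J)) y * prodf (foldr dere (ebs J) s) x) =
    (fun x => \sum_(J : Idx N) - (coef J * prodf (ebs J) y) * prodf (foldr dere (ebs J) (rcons s b)) x).
    apply/funext => t; transitivity (\sum_(J : Idx N) coef J *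
      (prodf (foldr dere (ebs J) s) t * prodf (dere b (ebs J)) y)).
      by apply: eq_bigr => J _; ring.
    by rewrite ih -sumrN; apply: eq_bigr => J _; ring.
  rewrite E in h1.
  have := @derive_val _ _ _ _ _ _ _ h1; rewrite (@derive_val _ _ _ _ _ _ _ h2) => E2.
  transitivity (\sum_(J : Idx N) coef J * prodf (dere b (ebs J)) y *
     prodf (dere j (foldr dere (ebs J) s)) z).
    by apply: eq_bigr => J _; ring.
  by rewrite -E2 -sumrN; apply: eq_bigr => J _; ring.
have [_ <-] := @summ_I_sum_kernel (Idx N) (@coef R N)
  (fun J => prodf (foldr dere (ebs J) s) x) (fun J => prodf (dere b (ebs J))) f
  (fun J => moment_summ J [:: b] sf).
rewrite PS_kernel//; under eq_I => y do rewrite K mulNr -mulN1r.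
rewrite IZ ?mulN1r//.
by have [] := @summ_I_sum_kernel (Idx N) (@coef R N)
  (fun J => prodf (foldr dere (ebs J) (rcons s b)) x) (fun J => prodf (ebs J)) f
  (fun J => moment_summ J [::] sf).
Qed.

End Projections.

(** * Increments against the gradient of the kernel *)

Section BilinearForm.
Context {R : realType}.
Implicit Types (a b : vec R -> R) (N : nat) (x y : vec R).

Local Notation I f := (Rintegral torus setT f).
Local Notation mu2 := ((@torus R) \x (@torus R))%E.

Lemma summM_PS N s a b : summ torus a -> summ torus (fun x => a x * PS N s b x).
Proof. by move=> sa; apply: summM_TP => //; exact: PS_TP. Qed.

Lemma I_mul_PS N s a b : summ torus a -> I (fun x => a x * PS N s b x) =
  \sum_(J : Idx N) coef J *
    (I (fun x => a x * prodf (foldr dere (ebs J) s) x) * moment J b).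
Proof.
move=> sa.
have -> : (fun x => a x * PS N s b x) = (fun x => \sum_(J : Idx N)
    (coef J * moment J b) * (a x * prodf (foldr dere (ebs J) s) x)).
  by apply/funext => x; rewrite mulr_sumr; apply: eq_bigr => J _; ring.
rewrite Isum; last by move=> J; apply: summZ; exact: moment_summ.
apply: eq_bigr => J _; rewrite IZ; last exact: moment_summ.
by ring.
Qed.

(** Integration by parts, from the oddness of the gradient of the kernel. *)
Lemma I_mul_PS1_anti N j a b : summ torus a -> summ torus b ->
  I (fun x => a x * PS N [:: j] b x) = - I (fun x => b x * PS N [:: j] a x).
Proof.
move=> sa sb.
transitivity (I (fun x => -1 * (\sum_(J : Idx N) (coef J * dmoment J j b) * (a x * prodf (ebs J) x)))).
  apply: eq_I => x; have := @PS_dmoment R N [::] j b x sb.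
  rewrite /= => /(congr1 (fun t => - t)); rewrite opprK => <-.
  rewrite mulrN mulN1r mulr_sumr; congr (- _); apply: eq_bigr => J _; ring.
have sm (J : Idx N) : summ torus (fun x => a x * prodf (ebs J) x).
  exact: (moment_summ J [::] sa).
rewrite IZ ?mulN1r; last by apply: summ_sum => J; exact: summZ.
rewrite Isum; last by move=> J; exact: summZ.
rewrite I_mul_PS//; congr (- _); apply: eq_bigr => J _.
by rewrite IZ// /moment /dmoment /=; ring.
Qed.

(** The mollification of a constant is that constant. *)
Lemma PS1_one N j x : PS N [:: j] (fun=> 1) x = 0.
Proof.
have s1 : summ torus (fun=> 1 : R) by apply: TP_summ; exact: TP_cst.
apply/eqP; rewrite -oppr_eq0; apply/eqP.
rewrite -(@PS_dmoment R N [::] j (fun=> 1) x s1) big1// => J _.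
rewrite /dmoment; under eq_I => y do rewrite mul1r.
by rewrite I_prodf_dere ?mulr0//; [exact: smooth3_ebs|exact: periodic3_ebs].
Qed.

Lemma dKern_tensor N j a b : summ torus a -> summ torus b ->
  summ mu2 (fun z => dKern N j z.1 z.2 * (a z.1 * b z.2)) /\
  Rintegral mu2 setT (fun z => dKern N j z.1 z.2 * (a z.1 * b z.2)) =
    I (fun x => a x * PS N [:: j] b x).
Proof.
move=> sa sb.
have -> : (fun z => dKern N j z.1 z.2 * (a z.1 * b z.2)) =
   (fun z => \sum_(J : Idx N) coef J *
     ((a z.1 * prodf (dere j (ebs J)) z.1) * (b z.2 * prodf (ebs J) z.2))).
  by apply/funext => z; rewrite mulr_suml; apply: eq_bigr => J _; ring.
have s1 (J : Idx N) : summ torus (fun x => a x * prodf (dere j (ebs J)) x).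
  exact: (moment_summ J [:: j] sa).
have s2 (J : Idx N) : summ torus (fun x => b x * prodf (ebs J) x).
  exact: (moment_summ J [::] sb).
have s12 (J : Idx N) := summ_tensor (s1 J) (s2 J).
split; first by apply: summ_sum => J; apply: summZ; exact: s12.
rewrite Isum; last by move=> J; apply: summZ; exact: s12.
rewrite I_mul_PS//; apply: eq_bigr => J _.
rewrite (IZ _ (s12 J)); congr (_ * _); exact: (I_tensor (s1 J) (s2 J)).
Qed.

(** The gradient of the kernel is odd and has zero average, so that in the expansion of the
    triple increment the terms pair up and the pure ones vanish. *)
Lemma dKern_trilinear N j (f1 f2 f3 : vec R -> R) (M : R) :
  measurable_fun setT f1 -> measurable_fun setT f2 ->
  (forall x, `|f1 x| <= M) -> (forall x, `|f2 x| <= M) -> summ torus f3 ->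
  Rintegral mu2 setT (fun z => dKern N j z.1 z.2 *
    ((f1 z.1 - f1 z.2) * (f2 z.1 - f2 z.2) * (f3 z.1 - f3 z.2))) =
  - 2 * (I (fun x => f1 x * f2 x * PS N [:: j] f3 x) +
         I (fun x => f1 x * f3 x * PS N [:: j] f2 x) +
         I (fun x => f2 x * f3 x * PS N [:: j] f1 x)).
Proof.
move=> m1 m2 b1 b2 s3.
have s1 : summ torus f1 := summ_torus_bounded m1 b1.
have s2 : summ torus f2 := summ_torus_bounded m2 b2.
have s0 : summ torus (fun=> 1 : R) by apply: TP_summ; exact: TP_cst.
have s12 : summ torus (fun x => f1 x * f2 x) := summM_bounded s1 m2 b2.
have s13 : summ torus (fun x => f1 x * f3 x).
  by under [fun _ => _]funext => x do rewrite mulrC; exact: summM_bounded s3 m1 b1.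
have s23 : summ torus (fun x => f2 x * f3 x).
  by under [fun _ => _]funext => x do rewrite mulrC; exact: summM_bounded s3 m2 b2.
have s123 : summ torus (fun x => f1 x * f2 x * f3 x).
  under [fun _ => _]funext => x do rewrite mulrAC.
  exact: summM_bounded s13 m2 b2.
pose A := I (fun x => f1 x * f2 x * PS N [:: j] f3 x).
pose B := I (fun x => f1 x * f3 x * PS N [:: j] f2 x).
pose C := I (fun x => f2 x * f3 x * PS N [:: j] f1 x).
pose p a b (z : vec R * vec R) := dKern N j z.1 z.2 * (a z.1 * b z.2).
have P a b : summ torus a -> summ torus b -> summ mu2 (p a b).
  by move=> sa sb; have [] := dKern_tensor N j sa sb.
have Q a b : summ torus a -> summ torus b -> Rintegral mu2 setT (p a b) =
    I (fun x => a x * PS N [:: j] b x).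
  by move=> sa sb; have [] := dKern_tensor N j sa sb.
have Qanti a b : summ torus a -> summ torus b ->
    Rintegral mu2 setT (p a b) = - I (fun x => b x * PS N [:: j] a x).
  by move=> sa sb; rewrite (Q _ _ sa sb) I_mul_PS1_anti.
pose f12 x := f1 x * f2 x; pose f13 x := f1 x * f3 x.
pose f23 x := f2 x * f3 x; pose f123 x := f1 x * f2 x * f3 x.
pose c1 (x : vec R) : R := 1.
have z1 : I (fun x => f123 x * PS N [:: j] c1 x) = 0.
  by rewrite (@eq_I _ _ _ _ _ (fun=> 0)) ?I0// => x; rewrite PS1_one mulr0.
rewrite (_ : (fun z => _) = (fun z =>
   ((p f123 c1 z - p c1 f123 z) + (p f1 f23 z - p f23 f1 z)) +
   (p f2 f13 z - p f13 f2 z) + (p f3 f12 z - p f12 f3 z))); last first.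
  by apply/funext => z; rewrite /p /f123 /f12 /f13 /f23 /c1; ring.
have D1 := summB (P _ _ s123 s0) (P _ _ s0 s123).
have D2 := summB (P _ _ s1 s23) (P _ _ s23 s1).
have D3 := summB (P _ _ s2 s13) (P _ _ s13 s2).
have D4 := summB (P _ _ s3 s12) (P _ _ s12 s3).
rewrite (ID (summD (summD D1 D2) D3) D4) (ID (summD D1 D2) D3) (ID D1 D2).
rewrite (IB (P _ _ s123 s0) (P _ _ s0 s123)) (IB (P _ _ s1 s23) (P _ _ s23 s1)).
rewrite (IB (P _ _ s2 s13) (P _ _ s13 s2)) (IB (P _ _ s3 s12) (P _ _ s12 s3)).
rewrite (Q _ _ s123 s0) (Qanti _ _ s0 s123) z1.
rewrite (Q _ _ s23 s1) (Qanti _ _ s1 s23) (Q _ _ s13 s2) (Qanti _ _ s2 s13).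
rewrite (Q _ _ s12 s3) (Qanti _ _ s3 s12).
rewrite -/A -/B -/C.
by move: A B C => A' B' C'; ring.
Qed.

Lemma measurable_sd :
  measurable_fun setT (fun z : vec R * vec R => sd z.1 z.2).
Proof.
apply: (measurableT_comp (continuous_measurable_fun (@sqrt_continuous R))).
apply: measurable_sum => i; apply: measurable_funX.
apply: (measurableT_comp (continuous_measurable_fun (@continuous_sin R))).
apply: measurable_funM => //; apply: measurable_funB.
  by have [->|->|->] := ord3P i; rewrite /coord3 /=; do ?apply: measurableT_comp.
by have [->|->|->] := ord3P i; rewrite /coord3 /=; do ?apply: measurableT_comp.
Qed.

Lemma measurable_dKern N j :
  measurable_fun setT (fun z : vec R * vec R => dKern N j z.1 z.2).
Proof.
have s0 : summ torus (fun=> 1 : R) by apply: TP_summ; exact: TP_cst.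
have [+ _] := dKern_tensor N j s0 s0.
by under [fun _ => _]funext => z do rewrite !mulr1; exact: summ_meas.
Qed.

Lemma measurable_Kern N :
  measurable_fun setT (fun z : vec R * vec R => Kern N z.1 z.2).
Proof.
apply: measurable_sum => J; apply: measurable_funM => //.
apply: measurable_funM.
  exact: (measurableT_comp (measurable_prodf (smooth3_ebs J)) measurable_fst).
exact: (measurableT_comp (measurable_prodf (smooth3_ebs J)) measurable_snd).
Qed.

End BilinearForm.

Section SmoothIdentity.
Context {R : realType}.
Local Notation I f := (Rintegral torus setT f).

(** The determinant of three vectors. *)
Definition triple (a b c : 'I_3 -> R) : R :=
  (a 1 * b 2 - a 2 * b 1) * c 0 + (a 2 * b 0 - a 0 * b 2) * c 1 +
  (a 0 * b 1 - a 1 * b 0) * c 2.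

(** For smooth divergence free fields this is the Lamb form of the transport
    term, div (v (x) v) = curl v x v + grad (|v|^2 / 2), tested against a
    divergence free field. *)
Lemma lamb_identity (v Phi : 'I_3 -> vec R -> R)
    (dv dPhi : 'I_3 -> 'I_3 -> vec R -> R) (om : 'I_3 -> vec R -> R) :
  (forall i, TP (v i)) -> (forall i, TP (Phi i)) ->
  (forall i j, TP (dv j i)) -> (forall i j, TP (dPhi j i)) ->
  (forall i j x, is_derive x (basis3 j) (v i) (dv j i x)) ->
  (forall i j x, is_derive x (basis3 j) (Phi i) (dPhi j i x)) ->
  (forall x, \sum_j dv j j x = 0) -> (forall x, \sum_j dPhi j j x = 0) ->
  (forall l x, om l x = dv (l + 1) (l + 2) x - dv (l + 2) (l + 1) x) ->
  I (fun x => \sum_i \sum_j v i x * v j x * dPhi j i x) =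
  I (fun x => triple (v ^~ x) (om ^~ x) (Phi ^~ x)).
Proof.
move=> tv tP tdv tdP dv_ dP_ v0 P0 omE.
pose vP x := v 0 x * Phi 0 x + v 1 x * Phi 1 x + v 2 x * Phi 2 x.
pose vv x := v 0 x * v 0 x + v 1 x * v 1 x + v 2 x * v 2 x.
(* the difference of the integrands is the divergence of this field *)
pose F j x := v j x * vP x + - 2^-1 * (vv x * Phi j x).
pose dvP j x := (v 0 x * dPhi j 0 x + Phi 0 x * dv j 0 x) +
  (v 1 x * dPhi j 1 x + Phi 1 x * dv j 1 x) + (v 2 x * dPhi j 2 x + Phi 2 x * dv j 2 x).
pose dvv j x := (v 0 x * dv j 0 x + v 0 x * dv j 0 x) +
  (v 1 x * dv j 1 x + v 1 x * dv j 1 x) + (v 2 x * dv j 2 x + v 2 x * dv j 2 x).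
pose dF j x := (v j x * dvP j x + vP x * dv j j x) +
  - 2^-1 * (vv x * dPhi j j x + Phi j x * dvv j x).
have tF j : TP (F j).
  by apply: TPD; [|apply: TPZ]; apply: TPM => //; do !apply: TPD; exact: TPM.
have dF_ j x : is_derive x (basis3 j) (F j) (dF j x).
  have d1 : is_derive x (basis3 j) vP (dvP j x).
    exact: (is_deriveD (is_deriveD (is_deriveMe (dv_ 0 j x) (dP_ 0 j x))
      (is_deriveMe (dv_ 1 j x) (dP_ 1 j x))) (is_deriveMe (dv_ 2 j x) (dP_ 2 j x))).
  have d2 : is_derive x (basis3 j) vv (dvv j x).
    exact: (is_deriveD (is_deriveD (is_deriveMe (dv_ 0 j x) (dv_ 0 j x))
      (is_deriveMe (dv_ 1 j x) (dv_ 1 j x))) (is_deriveMe (dv_ 2 j x) (dv_ 2 j x))).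
  exact: (is_deriveD (is_deriveMe (dv_ j j x) d1)
    (is_deriveZ (- 2^-1) (is_deriveMe d2 (dP_ j j x)))).
have tdF j : TP (dF j).
  have t1 : TP (dvP j) by do !apply: TPD; exact: TPM.
  have t2 : TP (dvv j) by do !apply: TPD; exact: TPM.
  have t3 : TP vP by do !apply: TPD; exact: TPM.
  have t4 : TP vv by do !apply: TPD; exact: TPM.
  by apply: TPD; [|apply: TPZ]; apply: TPD; exact: TPM.
have IF j : I (dF j) = 0 by exact: I_TP_derive (tF j) (dF_ j).
apply/eqP; rewrite -subr_eq0 -IB; last 2 first.
- by apply: TP_summ; apply: TP_sum => i; apply: TP_sum => j; apply: TPM => //; exact: TPM.
- apply: TP_summ; have tom l : TP (om l).
    by rewrite (funext (omE l)); exact: TPB.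
  by apply: TPD; [apply: TPD|]; apply: TPM => //; apply: TPB; exact: TPM.
have sF j : summ torus (dF j) by exact: TP_summ.
rewrite (_ : Rintegral _ _ _ = I (fun x => dF 0 x + dF 1 x + dF 2 x)).
  by rewrite (ID (summD (sF 0) (sF 1)) (sF 2)) (ID (sF 0) (sF 1)) !IF !addr0.
apply: eq_I => x; have := v0 x; have := P0 x.
rewrite !sum3E /triple !omE => P0x v0x.
have e1 : (1 + 1 : 'I_3) = 2 by exact: val_inj.
have e2 : (1 + 2 : 'I_3) = 0 by exact: val_inj.
have e3 : (2 + 1 : 'I_3) = 0 by exact: val_inj.
have e4 : (2 + 2 : 'I_3) = 1 by exact: val_inj.
rewrite !add0r e1 e2 e3 e4.
have v0x' : dv 2 2 x = - dv 0 0 x - dv 1 1 x by lra.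
have P0x' : dPhi 2 2 x = - dPhi 0 0 x - dPhi 1 1 x by lra.
by rewrite /dF /dvP /dvv /vP /vv v0x' P0x'; field.
Qed.

End SmoothIdentity.

(** * The helicity flux of a field at a fixed time *)

Lemma cvg_bigsum (R : realType) (J : Type) (s : seq J) (F : J -> nat -> R)
    (l : J -> R) : (forall j, F j n @[n --> \oo] --> l j) ->
  \sum_(j <- s) F j n @[n --> \oo] --> \sum_(j <- s) l j.
Proof.
move=> Fl; elim: s => [|j s ih].
  by rewrite big_nil; under eq_cvg do rewrite big_nil; exact: cvg_cst.
by rewrite big_cons; under eq_cvg do rewrite big_cons; exact: cvgD.
Qed.

Lemma Isum2 d (T : measurableType d) (R : realType)
    (mu : {measure set T -> \bar R}) (J K : finType) (F : J -> K -> T -> R) :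
  (forall i j, summ mu (F i j)) ->
  summ mu (fun x => \sum_i \sum_j F i j x) /\
  Rintegral mu setT (fun x => \sum_i \sum_j F i j x) =
    \sum_i \sum_j Rintegral mu setT (F i j).
Proof.
move=> sF; have sF1 i : summ mu (fun x => \sum_j F i j x).
  exact: (summ_sum _ (sF i)).
split; first exact: (summ_sum _ sF1).
rewrite (Isum _ sF1); apply: eq_bigr => i _; exact: (Isum _ (sF i)).
Qed.

Section Slice.
Context {R : realType}.
Local Notation I f := (Rintegral torus setT f).
Local Notation mu2 := ((@torus R) \x (@torus R))%E.

Variables (al g : R) (u w : 'I_3 -> vec R -> R).
Hypothesis hal : 0 < al < 1.
Hypothesis mu_ : forall i, measurable_fun setT (u i).
Hypothesis ub : forall i x, `|u i x| <= g.
Hypothesis uh : forall i x y,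
  `|u i x - u i y| <= g * sd x y `^ ((1 - al) / 2).
Hypothesis sw : forall i, summ torus (w i).
Hypothesis wper : forall i x y, sd x y = 0 -> w i x = w i y.

Definition wquot (z : vec R * vec R) : R :=
  (\sum_i `|w i z.1 - w i z.2|) / sd z.1 z.2 `^ (3 + al).

Hypothesis sq : summ mu2 wquot.
Hypothesis hcurl : forall N (J : Idx N) l,
  moment J (w l) = dmoment J (l + 2) (u (l + 1)) - dmoment J (l + 1) (u (l + 2)).
Hypothesis hdiv : forall N (J : Idx N), \sum_j dmoment J j (u j) = 0.

Let g0 : 0 <= g. Proof. exact: le_trans (normr_ge0 _) (ub 0 0). Qed.

Let al0 : 0 < al. Proof. by case/andP: hal. Qed.
Let al1 : al < 1. Proof. by case/andP: hal. Qed.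

Let su i : summ torus (u i). Proof. exact: summ_torus_bounded (mu_ i) (ub i). Qed.

Lemma PS0_bound N i x : `|PS N [::] (u i) x| <= g.
Proof.
rewrite PS0_kernel//.
rewrite (_ : g = I (fun y => g * Kern N x y)); last first.
  by rewrite IZ ?I_Kern ?mulr1//; exact: summ_Kern.
apply: norm_I_le; last first.
  by move=> y; rewrite normrM (ger0_norm (Kern_ge0 N x y)) mulrC ler_wpM2r// Kern_ge0.
  by apply: summZ; exact: summ_Kern.
exact: summM_bounded (summ_Kern N x) (mu_ i) (ub i).
Qed.

Lemma PS0_sub N (f : vec R -> R) x : summ torus f ->
  summ torus (fun y => Kern N x y * (f y - f x)) /\
  PS N [::] f x - f x = I (fun y => Kern N x y * (f y - f x)).
Proof.
move=> sf.
have s1 : summ torus (fun y => Kern N x y * f y).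
  have [+ _] := @summ_I_sum_kernel R (Idx N) (@coef R N)
    (fun J => prodf (ebs J) x) (fun J => prodf (ebs J)) f
    (fun J => moment_summ J [::] sf).
  by [].
have s2 : summ torus (fun y => f x * Kern N x y) by apply: summZ; exact: summ_Kern.
have E : (fun y => Kern N x y * (f y - f x)) =
    (fun y => Kern N x y * f y - f x * Kern N x y).
  by apply/funext => y; ring.
rewrite E; split; first exact: summB.
by rewrite IB// -PS0_kernel// IZ ?I_Kern ?mulr1//; exact: summ_Kern.
Qed.

(** Near the diagonal the increment is small by Hoelder continuity; away from it,
    the second moment of the kernel is. *)
Lemma PS0_cvg i x : PS N [::] (u i) x @[N --> \oo] --> u i x.
Proof.
apply/cvgrPdist_le => e e0.
pose th := (1 - al) / 2.
have th0 : 0 < th by rewrite divr_gt0// subr_gt0.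
(* within this distance the increment is at most e / 2 *)
pose d := (e / (2 * (g + 1))) `^ (th^-1).
have g1 : 0 < g + 1 by rewrite ltr_wpDl.
have b0 : 0 < e / (2 * (g + 1)) by rewrite divr_gt0// mulr_gt0.
have d0 : 0 < d by exact: powR_gt0.
have D0 : 0 <= 2 * g / d ^+ 2.
  by apply: divr_ge0; [exact: mulr_ge0|exact: sqr_ge0].
have inc y : `|u i y - u i x| <= e / 2 + (2 * g / d ^+ 2) * sd x y ^+ 2.
  have [sd_d|d_sd] := leP (sd x y) d.
    apply: (@le_trans _ _ (e / 2)); last first.
      by rewrite lerDl; apply: mulr_ge0 => //; exact: sqr_ge0.
    apply: (le_trans (uh i y x)); rewrite sdC -/th.
    have : sd x y `^ th <= d `^ th.
      by apply: ge0_ler_powR => //; rewrite ?nnegrE ?sd_ge0// ltW.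
    rewrite -powRrM mulVf ?gt_eqF// powRr1; last exact: ltW.
    move=> h; apply: (le_trans (ler_wpM2l g0 h)).
    rewrite (_ : e / 2 = (g + 1) * (e / (2 * (g + 1)))); last by field; rewrite gt_eqF.
    by rewrite ler_wpM2r ?ltW//; lra.
  apply: (@le_trans _ _ (2 * g)).
    by apply: (le_trans (ler_normB _ _)); have := ub i x; have := ub i y; lra.
  rewrite -[leLHS]add0r lerD//; first by rewrite divr_ge0// ltW.
  rewrite mulrAC ler_pdivlMr ?exprn_gt0// ler_wpM2l ?mulr_ge0//.
  by rewrite lerXn2r ?nnegrE ?sd_ge0// ltW.
have key N : `|u i x - PS N [::] (u i) x| <= e / 2 + (2 * g / d ^+ 2) * (36 / sqn N).
  have [s1 E] := PS0_sub N x (su i).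
  rewrite distrC E.
  have s2 := summ_Kern N x.
  have s3 : summ torus (fun y => Kern N x y * sd x y ^+ 2).
    apply: (summM_bounded s2 (M := 4)).
      apply: measurable_funX.
      exact: (measurableT_comp measurable_sd (measurable_pair1 x)).
    move=> y; rewrite ger0_norm ?exprn_ge0 ?sd_ge0//.
    have := sd_le2 x y; have := sd_ge0 x y; nra.
  have s4 : summ torus (fun y => e / 2 * Kern N x y +
      (2 * g / d ^+ 2) * (Kern N x y * sd x y ^+ 2)).
    by apply: summD; exact: summZ.
  apply: (@le_trans _ _ (I (fun y => e / 2 * Kern N x y +
      (2 * g / d ^+ 2) * (Kern N x y * sd x y ^+ 2)))).
    apply: norm_I_le => // y.
    rewrite normrM (ger0_norm (Kern_ge0 N x y)).
    by have := ler_wpM2l (Kern_ge0 N x y) (inc y); lra.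
  rewrite ID; [|exact: summZ|exact: summZ].
  rewrite (IZ (e / 2) s2) (IZ (2 * g / d ^+ 2) s3) I_Kern mulr1 lerD2l ler_wpM2l//.
  exact: I_Kern_sd2.
near=> N.
apply: (le_trans (key N)).
suff : (2 * g / d ^+ 2) * (36 / sqn N) <= e / 2 by lra.
have q0 := @sqn_gt0 R N.
rewrite mulrA ler_pdivrMr//.
have h : ((2 * g / d ^+ 2 * 36) / (e / 2)) ^+ 2 <= N.+1%:R.
  apply: (@le_trans _ _ N%:R); last by rewrite ler_nat.
  by near: N; exact: nbhs_infty_ger.
have h2 : (2 * g / d ^+ 2 * 36) / (e / 2) <= sqn N.
  rewrite -[leLHS]ger0_norm; last by apply: divr_ge0; [exact: mulr_ge0|exact/ltW/divr_gt0].
  by rewrite -sqrtr_sqr ler_wsqrtr.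
by rewrite [leRHS]mulrC -ler_pdivrMr//; exact: divr_gt0.
Unshelve. all: by end_near. Qed.

Lemma wquot_ge0 z : 0 <= wquot z.
Proof. by rewrite divr_ge0 ?powR_ge0// sumr_ge0. Qed.

(** Dominated convergence: the weights are bounded and tend to 0 off the
    diagonal; on it the quotient is 0 by the convention on [r / 0]. *)
Lemma cvg_weight (W : nat -> vec R * vec R -> R) :
  (forall N, measurable_fun setT (W N)) -> (forall N z, 0 <= W N z) ->
  (forall N z, W N z <= @Kbound R) ->
  (forall N z, sqn N * sd z.1 z.2 * W N z <= @Kbound R) ->
  Rintegral mu2 setT (fun z => W N z * wquot z) @[N --> \oo] --> 0.
Proof.
move=> mW W0 WK WsK; rewrite -[X in _ --> X](I0 mu2).
apply: (@dominated_I _ _ _ mu2 _ _ (fun z => @Kbound R * wquot z)) => //.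
- by move=> N; apply: measurable_funM => //; exact: summ_meas sq.
- move=> z; have [s0|s0] := eqVneq (sd z.1 z.2) 0.
    rewrite (_ : (fun N => _) = fun=> 0); first exact: cvg_cst.
    apply/funext => N; rewrite /wquot s0 powR0 ?gt_eqF// ?addr_gt0//.
    by rewrite invr0 !mulr0.
  have spos : 0 < sd z.1 z.2 by rewrite lt_def s0 sd_ge0.
  rewrite -[X in _ --> X](mul0r (wquot z)).
  apply: cvgM; last exact: cvg_cst.
  exact: (sqn_cvg_weight spos).
- exact: summZ.
- move=> N z; rewrite normrM !ger0_norm ?wquot_ge0//.
  by rewrite ler_wpM2r ?wquot_ge0.
Qed.

Lemma wdiff_le i z :
  `|w i z.1 - w i z.2| <= sd z.1 z.2 `^ (3 + al) * wquot z.
Proof.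
have [s0|s0] := eqVneq (sd z.1 z.2) 0.
  by rewrite (wper i s0) subrr normr0 mulr_ge0 ?powR_ge0 ?wquot_ge0.
rewrite /wquot mulrC divfK ?powR_eq0 ?(negbTE s0)//.
by rewrite (bigD1 i)//= lerDl sumr_ge0.
Qed.

Lemma I_fubini_le (f : vec R * vec R -> R) (h : vec R -> R) :
  summ mu2 f -> (forall x, summ torus (fun y => f (x, y))) ->
  measurable_fun setT h -> (forall x, `|h x| <= `|I (fun y => f (x, y))|) ->
  summ torus h /\ I (fun x => `|h x|) <= Rintegral mu2 setT (fun z => `|f z|).
Proof.
move=> sf sfx mh hf.
have sn : summ mu2 (fun z => `|f z|) := summ_norm sf.
have snx x : summ torus (fun y => `|f (x, y)|) := summ_norm (sfx x).
have sF : summ torus (fun x => I (fun y => `|f (x, y)|)).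
  have := integrable_fubini_F sn; congr (_.-integrable _ _).
  by apply/funext => x; rewrite /fubini_F (I_EFin (snx x)).
have le x : `|h x| <= I (fun y => `|f (x, y)|).
  by rewrite (le_trans (hf x))//; exact: (norm_I_le (sfx x) (snx x)).
have sh : summ torus h := summ_le mh le sF.
split=> //; rewrite (I_fubini sn snx).
by apply: le_I => //; exact: summ_norm.
Qed.

(** The fractional Sobolev seminorm controls the error of mollification in
    [L^1], through the kernel weighted by the distance to the power [3 + al]. *)
Lemma PS0_L1_cvg i :
  I (fun x => `|PS N [::] (w i) x - w i x|) @[N --> \oo] --> 0.
Proof.
pose W N (z : vec R * vec R) := Kern N z.1 z.2 * sd z.1 z.2 `^ (3 + al).
have mW N : measurable_fun setT (W N).
  apply: measurable_funM; first exact: measurable_Kern.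
  apply: (measurableT_comp (measurable_powR (3 + al))); exact: measurable_sd.
have W0 N z : 0 <= W N z by rewrite mulr_ge0 ?Kern_ge0 ?powR_ge0.
have WK := cvg_weight mW W0 (fun N z => (Kern_weight N z.1 z.2 hal).1)
  (fun N z => (Kern_weight N z.1 z.2 hal).2).
apply: (squeeze_cvgr _ (cvg_cst 0) WK); near=> N.
rewrite I_ge0//=.
pose f (z : vec R * vec R) := Kern N z.1 z.2 * (w i z.2 - w i z.1).
have mwi := summ_meas (sw i).
have mf : measurable_fun setT f.
  apply: measurable_funM; first exact: measurable_Kern.
  by apply: measurable_funB; exact: measurableT_comp.
have fW z : `|f z| <= W N z * wquot z.
  rewrite normrM (ger0_norm (Kern_ge0 _ _ _)) distrC /W -mulrA.
  by rewrite ler_wpM2l ?Kern_ge0// wdiff_le.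
have sWq : summ mu2 (fun z => W N z * wquot z).
  apply: (summ_le _ _ (summZ (@Kbound R) sq)).
    by apply: measurable_funM => //; exact: summ_meas sq.
  move=> z; rewrite normrM !ger0_norm ?wquot_ge0// ler_wpM2r ?wquot_ge0//.
  exact: (Kern_weight N z.1 z.2 hal).1.
have sf : summ mu2 f := summ_le mf fW sWq.
have sfx x : summ torus (fun y => f (x, y)) by have [] := PS0_sub N x (sw i).
have [] := I_fubini_le (h := fun x => PS N [::] (w i) x - w i x) sf sfx.
- apply: measurable_funB => //; exact: TP_measurable (PS_TP _ _ _).
- by move=> x; have [_ ->] := PS0_sub N x (sw i).
move=> _ /le_trans; apply; apply: le_I => //; exact: summ_norm.
Unshelve. all: by end_near. Qed.

(** The identities between moments are exactly what is needed for the mollified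
    fields to be smooth, divergence free and curl of each other. *)
Lemma PS0_curl N l x : PS N [::] (w l) x =
  PS N [:: l + 1] (u (l + 2)) x - PS N [:: l + 2] (u (l + 1)) x.
Proof.
have h1 := @PS_dmoment R N [::] (l + 2) (u (l + 1)) x (su _).
have h2 := @PS_dmoment R N [::] (l + 1) (u (l + 2)) x (su _).
rewrite {1}/PS; under eq_bigr => J _ do rewrite hcurl mulrBr mulrBr.
by rewrite sumrB h1 h2 opprK addrC.
Qed.

Lemma PS1_div N x : \sum_j PS N [:: j] (u j) x = 0.
Proof.
have h j := @PS_dmoment R N [::] j (u j) x (su _).
under eq_bigr => j _ do rewrite -[PS _ _ _ _]opprK -(h j).
rewrite sumrN exchange_big/= big1 ?oppr0// => J _.
by rewrite -mulr_sumr -mulr_sumr hdiv !mulr0.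
Qed.

Lemma PS1_curl N j l x : PS N [:: j] (w l) x =
  PS N [:: j; l + 1] (u (l + 2)) x - PS N [:: j; l + 2] (u (l + 1)) x.
Proof.
have d0 := is_derive_PS N [::] (w l) j x.
have d1 := is_derive_PS N [:: l + 1] (u (l + 2)) j x.
have d2 := is_derive_PS N [:: l + 2] (u (l + 1)) j x.
rewrite (funext (PS0_curl N l)) in d0.
have d12 := is_deriveB d1 d2.
by rewrite -(@derive_val _ _ _ _ _ _ _ d0) (@derive_val _ _ _ _ _ _ _ d12).
Qed.

Lemma PS1_div_curl N x : \sum_j PS N [:: j] (w j) x = 0.
Proof.
under eq_bigr => j _ do rewrite PS1_curl.
rewrite sum3E.
have e1 : (1 + 1 : 'I_3) = 2 by exact: val_inj.
have e2 : (1 + 2 : 'I_3) = 0 by exact: val_inj.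
have e3 : (2 + 1 : 'I_3) = 0 by exact: val_inj.
have e4 : (2 + 2 : 'I_3) = 1 by exact: val_inj.
rewrite !add0r e1 e2 e3 e4.
rewrite (PS_swap N 1 0) (PS_swap N 2 0) (PS_swap N 2 1); ring.
Qed.

(** The transfer of helicity to scales that the kernel does not resolve. *)
Definition flux N : R :=
  I (fun x => \sum_i \sum_j u i x * u j x * PS N [:: j] (w i) x).

Let mPS N s f : measurable_fun setT (@PS R N s f).
Proof. exact: (TP_measurable (PS_TP _ _ _)). Qed.

(** The Lamb identity passes to the limit of the mollified fields. *)
Lemma flux_lamb N :
  flux N = I (fun x => triple (u ^~ x) (w ^~ x) (fun i => PS N [::] (w i) x)).
Proof.
pose lhs M := I (fun x => \sum_i \sum_j PS M [::] (u i) x * PS M [::] (u j) x *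
   PS N [:: j] (w i) x).
pose V M i x := PS M [::] (u i) x.
pose Ph i x := PS N [::] (w i) x.
have hP s i : exists C : R, 0 <= C /\ forall x, `|PS N s (w i) x| <= C.
  by have [C hC] := TP_bounded (PS_TP N s (w i)); exists `|C|; split => // x;
    rewrite (le_trans (hC x))// ler_norm.
have lim1 : lhs M @[M --> \oo] --> flux N.
  have [C hC] : exists C : 'I_3 -> 'I_3 -> R, forall i j x, `|PS N [:: j] (w i) x| <= C i j.
    have /choice[C hC] : forall ij : 'I_3 * 'I_3, exists c : R, forall x,
        `|PS N [:: ij.2] (w ij.1) x| <= c.
      by move=> ij; have [c [_ hc]] := hP [:: ij.2] ij.1; exists c.
    by exists (fun i j => C (i, j)) => i j x; exact: (hC (i, j)).
  apply: (@dominated_I _ _ _ torus _ _ (fun=> \sum_i \sum_j g * g * C i j)).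
  - move=> M; apply: measurable_sum => i; apply: measurable_sum => j.
    by do 2 ?[apply: measurable_funM].
  - apply: measurable_sum => i; apply: measurable_sum => j.
    by do 2 ?[apply: measurable_funM].
  - move=> x; apply: cvg_bigsum => i; apply: cvg_bigsum => j.
    by apply: cvgM; [apply: cvgM; exact: PS0_cvg|exact: cvg_cst].
  - by apply: TP_summ; exact: TP_cst.
  - move=> M x; rewrite (le_trans (ler_norm_sum _ _ _))//; apply: ler_sum => i _.
    rewrite (le_trans (ler_norm_sum _ _ _))//; apply: ler_sum => j _.
    rewrite 2!normrM; apply: ler_pM => //.
    by apply: ler_pM => //; exact: PS0_bound.
have lamb : forall K, lhs K =
    I (fun x => triple (V K ^~ x) (fun i => PS K [::] (w i) x) (Ph ^~ x)).
  move=> K; apply: (@lamb_identity R (V K) Ph (fun j i => PS K [:: j] (u i))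
    (fun j i => PS N [:: j] (w i)) (fun i => PS K [::] (w i))).
  - by move=> i; exact: PS_TP.
  - by move=> i; exact: PS_TP.
  - by move=> i j; exact: PS_TP.
  - by move=> i j; exact: PS_TP.
  - by move=> i j x; exact: is_derive_PS.
  - by move=> i j x; exact: is_derive_PS.
  - by move=> x; exact: PS1_div.
  - by move=> x; exact: PS1_div_curl.
  - by move=> l x; exact: PS0_curl.
pose cr (M : nat) (l : 'I_3) (x : vec R) : R := if l == 0 then Ph 1 x * V M 2 x - Ph 2 x * V M 1 x
  else if l == 1 then Ph 2 x * V M 0 x - Ph 0 x * V M 2 x
  else Ph 0 x * V M 1 x - Ph 1 x * V M 0 x.
pose cr' (l : 'I_3) (x : vec R) : R := if l == 0 then Ph 1 x * u 2 x - Ph 2 x * u 1 x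
  else if l == 1 then Ph 2 x * u 0 x - Ph 0 x * u 2 x
  else Ph 0 x * u 1 x - Ph 1 x * u 0 x.
have [C [C0 hC]] : exists C : R, 0 <= C /\ forall i x, `|Ph i x| <= C.
  have [c0 [p0 h0]] := hP [::] 0; have [c1 [p1 h1]] := hP [::] 1.
  have [c2 [p2 h2]] := hP [::] 2.
  exists (c0 + c1 + c2); split; first by rewrite !addr_ge0.
  move=> i x; have := h0 x; have := h1 x; have := h2 x; rewrite /Ph.
  by have [->|->|->] := ord3P i; lra.
have crb M l x : `|cr M l x| <= 2 * (C * g).
  have H i j : `|Ph i x * V M j x| <= C * g by rewrite normrM ler_pM// PS0_bound.
  have L (a b : R) : `|a| <= C * g -> `|b| <= C * g -> `|a - b| <= 2 * (C * g).
    by move=> ha hb; apply: (le_trans (ler_normB _ _)); lra.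
  by have [->|->|->] := ord3P l; rewrite /cr /=; exact: L.
have mcr M l : measurable_fun setT (cr M l).
  by have [->|->|->] := ord3P l; rewrite /cr /=; apply: measurable_funB;
    apply: measurable_funM; exact: mPS.
have mcr' l : measurable_fun setT (cr' l).
  by have [->|->|->] := ord3P l; rewrite /cr' /=; apply: measurable_funB;
    apply: measurable_funM => //; exact: mPS.
have crc l x : cr M l x @[M --> \oo] --> cr' l x.
  by have [->|->|->] := ord3P l; rewrite /cr /cr' /=; apply: cvgB; apply: cvgM;
    do ?[exact: cvg_cst|exact: PS0_cvg].
have lim2 : lhs M @[M --> \oo] --> I (fun x => triple (u ^~ x) (w ^~ x) (Ph ^~ x)).
  have sA M l : summ torus (fun x => (PS M [::] (w l) x - w l x) * cr M l x).
    apply: summM_bounded (mcr M l) (crb M l).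
    by apply: summB => //; exact: (TP_summ (PS_TP _ _ _)).
  have sB M l : summ torus (fun x => w l x * cr M l x).
    exact: summM_bounded (mcr M l) (crb M l).
  have E M : lhs M = \sum_l I (fun x => (PS M [::] (w l) x - w l x) * cr M l x) +
     \sum_l I (fun x => w l x * cr M l x).
    rewrite lamb -(Isum _ (sA M)) -(Isum _ (sB M)) -ID; last 2 first.
    - exact: (summ_sum _ (sA M)).
    - exact: (summ_sum _ (sB M)).
    by apply: eq_I => x; rewrite !sum3E /triple /cr /=; ring.
  have -> : I (fun x => triple (u ^~ x) (w ^~ x) (Ph ^~ x)) =
      \sum_(l < 3) 0 + \sum_l I (fun x => w l x * cr' l x).
    have c'b l x : `|cr' l x| <= 2 * (C * g).
      have H i j : `|Ph i x * u j x| <= C * g by rewrite normrM ler_pM.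
      have L (a b : R) : `|a| <= C * g -> `|b| <= C * g -> `|a - b| <= 2 * (C * g).
        by move=> ha hb; apply: (le_trans (ler_normB _ _)); lra.
      by have [->|->|->] := ord3P l; rewrite /cr' /=; exact: L.
    have sB' l : summ torus (fun x => w l x * cr' l x).
      exact: summM_bounded (mcr' l) (c'b l).
    rewrite big1// add0r -(Isum _ sB').
    by apply: eq_I => x; rewrite sum3E /triple /cr' /=; ring.
  rewrite (funext E); apply: cvgD; apply: cvg_bigsum => l.
    have c0 : 2 * (C * g) * I (fun x => `|PS M [::] (w l) x - w l x|)
        @[M --> \oo] --> 2 * (C * g) * 0.
      by apply: cvgM; [exact: cvg_cst|exact: PS0_L1_cvg].
    rewrite mulr0 in c0.
    apply/cvgrPdist_le => e e0; move/cvgrPdist_le : c0 => /(_ e e0).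
    apply: filterS => M; rewrite !sub0r !normrN; apply: le_trans.
    rewrite [leRHS]ger0_norm; last first.
      by apply: mulr_ge0; [do !apply: mulr_ge0|exact: I_ge0].
    rewrite -IZ; last first.
      by apply: summ_norm; apply: summB => //; exact: (TP_summ (PS_TP _ _ _)).
    apply: norm_I_le => //.
      by apply/summZ/summ_norm; apply: summB => //; exact: (TP_summ (PS_TP _ _ _)).
    by move=> x; rewrite normrM mulrC ler_wpM2r.
  apply: (@dominated_I _ _ _ torus _ _ (fun x => 2 * (C * g) * `|w l x|)).
  - by move=> M; apply: measurable_funM => //; exact: summ_meas (sw l).
  - by apply: measurable_funM => //; exact: summ_meas (sw l).
  - by move=> x; apply: cvgM; [exact: cvg_cst|exact: crc].
  - by apply/summZ/summ_norm.
  - by move=> M x; rewrite normrM mulrC ler_wpM2r.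
exact: (cvg_unique _ lim1 lim2).
Unshelve. all: by end_near. Qed.

Let increments N j (f1 f2 f3 : vec R -> R) : R :=
  Rintegral mu2 setT (fun z => dKern N j z.1 z.2 *
    ((f1 z.1 - f1 z.2) * (f2 z.1 - f2 z.2) * (f3 z.1 - f3 z.2))).

Let weight N j (z : vec R * vec R) : R := `|dKern N j z.1 z.2| * sd z.1 z.2 ^+ 4.

Let mweight N j : measurable_fun setT (weight N j).
Proof.
apply: measurable_funM.
  by apply: measurableT_comp => //; exact: measurable_dKern.
by apply: measurable_funX; exact: measurable_sd.
Qed.

Let weight_ge0 N j z : 0 <= weight N j z.
Proof. by apply: mulr_ge0 => //; apply: exprn_ge0; exact: sd_ge0. Qed.

Let weight_le N j z : weight N j z <= @Kbound R.
Proof. exact: (dKern_weight N j z.1 z.2).1. Qed.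

Let sweight N j : summ mu2 (fun z => weight N j z * wquot z).
Proof.
apply: (summ_le _ _ (summZ (@Kbound R) sq)).
  by apply: measurable_funM => //; exact: summ_meas sq.
move=> z; rewrite normrM !ger0_norm ?wquot_ge0 ?weight_ge0//.
by rewrite ler_wpM2r ?wquot_ge0// weight_le.
Qed.

(** Two increments of [u] and one of [w] absorb exactly the singularity of the
    gradient of the kernel, because 2 th + al = 1. *)
Lemma increments_le N j a b c : `|increments N j (u a) (u b) (w c)| <=
  g ^+ 2 * Rintegral mu2 setT (fun z => weight N j z * wquot z).
Proof.
rewrite -IZ; last exact: sweight.
have le z : `|dKern N j z.1 z.2 *
    ((u a z.1 - u a z.2) * (u b z.1 - u b z.2) * (w c z.1 - w c z.2))| <=
    g ^+ 2 * (weight N j z * wquot z).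
  pose s := sd z.1 z.2; pose th := (1 - al) / 2.
  have s0 : 0 <= s := sd_ge0 _ _.
  have h1 := uh a z.1 z.2; have h2 := uh b z.1 z.2; have h3 := wdiff_le c z.
  have E : s `^ th * s `^ th * s `^ (3 + al) = s ^+ 4.
    have [->|sn0] := eqVneq s 0.
      by rewrite (@powR0 _ (3 + al)) ?mulr0 ?expr0n// gt_eqF// addr_gt0.
    rewrite -!powRD ?sn0 ?implybT//.
    by rewrite (_ : th + th + (3 + al) = 4%:R) ?powR_mulrn// /th; field.
  rewrite !normrM.
  apply: (@le_trans _ _ (`|dKern N j z.1 z.2| *
     ((g * s `^ th) * (g * s `^ th) * (s `^ (3 + al) * wquot z)))).
    by apply: ler_wpM2l => //; apply: ler_pM3.
  rewrite /weight -/s -E le_eqVlt; apply/orP; left; apply/eqP; ring.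
apply: norm_I_le => //; last by apply: summZ; exact: sweight.
apply: (summ_le _ le); last by apply: summZ; exact: sweight.
apply: measurable_funM; first exact: measurable_dKern.
have mi (f : vec R -> R) : measurable_fun setT f ->
    measurable_fun setT (fun z : vec R * vec R => f z.1 - f z.2).
  move=> mf; apply: measurable_funB.
    exact: (measurableT_comp mf measurable_fst).
  exact: (measurableT_comp mf measurable_snd).
apply: measurable_funM; last exact: mi (summ_meas (sw c)).
by apply: measurable_funM; exact: mi.
Qed.

Let s_uu i j : summ torus (fun x => u i x * u j x).
Proof. exact: (summM_bounded (su i) (mu_ j) (ub j)). Qed.

Let s_uw i j : summ torus (fun x => u i x * w j x).
Proof.
under [fun _ => _]funext => x do rewrite mulrC.
exact: (summM_bounded (sw j) (mu_ i) (ub i)).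
Qed.

(** Expanding the increments by [dKern_trilinear] gives five families of sums:
    [a] is the flux, [c] and [d] vanish because [u] and [w] are divergence free,
    and the Lamb form of the flux says that [a = b - e].  The increments sum to
    [- 2 (a + b)] and [- 4 e], from which [a] is recovered. *)
Lemma flux_increments N : flux N =
  (\sum_i \sum_j increments N j (u i) (u i) (w j)) / 8 -
  (\sum_i \sum_j increments N j (u j) (u i) (w i)) / 4.
Proof.
pose a i j := I (fun x => u i x * u j x * PS N [:: j] (w i) x).
pose b i j := I (fun x => u j x * w i x * PS N [:: j] (u i) x).
pose c i j := I (fun x => u i x * w i x * PS N [:: j] (u j) x).
pose d i j := I (fun x => u i x * u i x * PS N [:: j] (w j) x).
pose e i j := I (fun x => u i x * w j x * PS N [:: j] (u i) x).
have TE i j : increments N j (u j) (u i) (w i) = - 2 * (a i j + b i j + c i j).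
  rewrite /increments (dKern_trilinear N j (mu_ j) (mu_ i) (ub j) (ub i) (sw i)).
  by congr (_ * (_ + _ + _)); apply: eq_I => x; rewrite (mulrC (u j x) (u i x)).
have SE i j : increments N j (u i) (u i) (w j) = - 2 * (d i j + e i j + e i j).
  by rewrite /increments (dKern_trilinear N j (mu_ i) (mu_ i) (ub i) (ub i) (sw j)).
have c0 i : \sum_j c i j = 0.
  rewrite /c -Isum; last by move=> j; exact: summM_PS.
  rewrite (@eq_I _ _ _ _ _ (fun=> 0)) ?I0// => x.
  by rewrite -mulr_sumr PS1_div mulr0.
have d0 i : \sum_j d i j = 0.
  rewrite /d -Isum; last by move=> j; exact: summM_PS.
  rewrite (@eq_I _ _ _ _ _ (fun=> 0)) ?I0// => x.
  by rewrite -mulr_sumr PS1_div_curl mulr0.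
have aE : flux N = \sum_i \sum_j a i j.
  exact: (Isum2 (fun i j => summM_PS N [:: j] (w i) (s_uu i j))).2.
have beE : flux N = \sum_i \sum_j b i j - \sum_i \sum_j e i j.
  have [sb <-] := Isum2 (fun i j => summM_PS N [:: j] (u i) (s_uw j i)).
  have [se <-] := Isum2 (fun i j => summM_PS N [:: j] (u i) (s_uw i j)).
  rewrite -IB// flux_lamb; apply: eq_I => x.
  rewrite !sum3E /triple !PS0_curl.
  have e1 : (1 + 1 : 'I_3) = 2 by exact: val_inj.
  have e2 : (1 + 2 : 'I_3) = 0 by exact: val_inj.
  have e3 : (2 + 1 : 'I_3) = 0 by exact: val_inj.
  have e4 : (2 + 2 : 'I_3) = 1 by exact: val_inj.
  by rewrite !add0r e1 e2 e3 e4; ring.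
clearbody a b c d e.
have -> : \sum_i \sum_j increments N j (u i) (u i) (w j) =
    - 4 * \sum_i \sum_j e i j.
  rewrite mulr_sumr; apply: eq_bigr => i _.
  transitivity (- 2 * \sum_j d i j + - 4 * \sum_j e i j).
    by rewrite !mulr_sumr -big_split/=; apply: eq_bigr => j _; rewrite SE; ring.
  by rewrite (d0 i) [X in X + _]mulr0 add0r.
have -> : \sum_i \sum_j increments N j (u j) (u i) (w i) =
    - 2 * (\sum_i \sum_j a i j + \sum_i \sum_j b i j).
  rewrite -big_split mulr_sumr/=; apply: eq_bigr => i _.
  transitivity (- 2 * (\sum_j a i j + \sum_j b i j) + - 2 * \sum_j c i j).
    rewrite -big_split/= !mulr_sumr -big_split/=; apply: eq_bigr => j _.
    by rewrite TE; ring.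
  by rewrite (c0 i) [X in _ + X]mulr0 addr0.
by move: aE beE; lra.
Qed.

Lemma flux_le_weights N : `|flux N| <=
  2 * g ^+ 2 * \sum_j Rintegral mu2 setT (fun z => weight N j z * wquot z).
Proof.
pose r j := Rintegral mu2 setT (fun z => weight N j z * wquot z).
have bnd (F : 'I_3 -> 'I_3 -> R) : (forall i j, `|F i j| <= g ^+ 2 * r j) ->
    `|\sum_i \sum_j F i j| <= 3 * (g ^+ 2 * \sum_j r j).
  move=> hF; apply: (le_trans (ler_norm_sum _ _ _)).
  apply: (@le_trans _ _ (\sum_(i < 3) (g ^+ 2 * \sum_j r j))).
    apply: ler_sum => i _; apply: (le_trans (ler_norm_sum _ _ _)).
    by rewrite mulr_sumr; apply: ler_sum => j _.
  by rewrite sumr_const card_ord; lra.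
have h1 := bnd (fun i j => increments N j (u i) (u i) (w j))
  (fun i j => increments_le N j i i j).
have h2 := bnd (fun i j => increments N j (u j) (u i) (w i))
  (fun i j => increments_le N j j i i).
rewrite flux_increments -/r.
move: h1 h2; rewrite -mulrA !ler_norml => /andP[h1 h1'] /andP[h2 h2'].
have p : 0 <= g ^+ 2 * \sum_j r j.
  apply: mulr_ge0; first exact: sqr_ge0.
  apply: sumr_ge0 => j _; apply: I_ge0 => z.
  by apply: mulr_ge0; [exact: weight_ge0|exact: wquot_ge0].
by apply/andP; split; lra.
Qed.

Lemma flux_le N : `|flux N| <= 6 * @Kbound R * (g ^+ 2 * Rintegral mu2 setT wquot).
Proof.
apply: (le_trans (flux_le_weights N)).
rewrite (_ : 6 * _ * _ = 2 * g ^+ 2 * (3 * (@Kbound R * Rintegral mu2 setT wquot))); last by ring.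
apply: ler_wpM2l; first by apply: mulr_ge0 => //; exact: sqr_ge0.
rewrite (_ : 3 * _ = \sum_(j < 3) @Kbound R * Rintegral mu2 setT wquot); last first.
  by rewrite sumr_const card_ord; move: (Kbound * _) => t; ring.
apply: ler_sum => j _; rewrite -IZ//; apply: le_I; first exact: sweight.
  exact: summZ.
by move=> z; apply: ler_wpM2r; [exact: wquot_ge0|exact: weight_le].
Qed.

Lemma flux_cvg0 : flux N @[N --> \oo] --> 0.
Proof.
have lim j : Rintegral mu2 setT (fun z => weight N j z * wquot z) @[N --> \oo] --> 0.
  apply: cvg_weight => // N z; exact: (dKern_weight N j z.1 z.2).2.
have c0 : 2 * g ^+ 2 * \sum_j Rintegral mu2 setT (fun z => weight N j z * wquot z)
    @[N --> \oo] --> 2 * g ^+ 2 * \sum_(j < 3) 0.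
  by apply: cvgM; [exact: cvg_cst|exact: cvg_bigsum].
rewrite big1// mulr0 in c0.
apply/cvgrPdist_le => e e0; move/cvgrPdist_le : c0 => /(_ e e0).
apply: filterS => N; rewrite !sub0r !normrN; apply: le_trans.
exact: (le_trans (flux_le_weights N) (ler_norm _)).
Qed.

Definition hel N : R :=
  \sum_(J : Idx N) coef J * \sum_i moment J (u i) * moment J (w i).

(** The mollified velocity converges pointwise and stays bounded by [g], while
    the vorticity is integrable. *)
Lemma hel_cvg : hel N @[N --> \oo] --> I (fun x => \sum_i u i x * w i x).
Proof.
have E N : hel N = \sum_i I (fun x => w i x * PS N [::] (u i) x).
  under [RHS]eq_bigr => i _ do rewrite I_mul_PS//.
  rewrite exchange_big/=; apply: eq_bigr => J _; rewrite mulr_sumr.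
  by apply: eq_bigr => i _; rewrite /moment/=; ring.
rewrite (funext E) Isum//; apply: cvg_bigsum => i.
apply: (@dominated_I _ _ _ torus _ _ (fun x => g * `|w i x|)).
- by move=> N; apply: measurable_funM => //; exact: summ_meas (sw i).
- by apply: measurable_funM => //; exact: summ_meas (sw i).
- move=> x; rewrite mulrC; apply: cvgM; [exact: cvg_cst|exact: PS0_cvg].
- by apply/summZ/summ_norm.
- by move=> N x; rewrite normrM mulrC ler_wpM2r// PS0_bound.
Qed.

End Slice.

(** * Test functions and Lebesgue points in time *)

Section TimeMeasure.
Context {R : realType}.

(** The Lebesgue measure for the canonical sigma-algebra of [R]. *)
Definition time_measure (A : set R) : \bar R := lebesgue_measure A.

Let time0 : time_measure set0 = 0%E. Proof. exact: measure0. Qed.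

Let time_ge0 A : (0 <= time_measure A)%E. Proof. exact: measure_ge0. Qed.

Let time_sigma_additive : semi_sigma_additive time_measure.
Proof. exact: (@measure_semi_sigma_additive _ _ _ lebesgue_measure). Qed.

HB.instance Definition _ := isMeasure.Build _ R R time_measure
  time0 time_ge0 time_sigma_additive.

Let time_sigma_finite : sigma_finite setT time_measure.
Proof. exact: (sigma_finiteT lebesgue_measure). Qed.

HB.instance Definition _ := Measure_isSigmaFinite.Build _ _ _ time_measure
  time_sigma_finite.

Definition time : {sigma_finite_measure set R -> \bar R} := time_measure.

Lemma integral_time (f : R -> \bar R) : measurable_fun setT f ->
  (\int[lebesgue_measure]_x f x = \int[time]_x f x)%E.
Proof.
move=> mf; have Hid : measurable_fun setT (idfun : _ -> R) by exact: measurable_id.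
apply: (etrans (@integral_transport _ _ _ R R lebesgue_measure idfun Hid f mf)).
by apply: eq_measure_integral.
Qed.

Lemma Rintegral_time (f : R -> R) : measurable_fun setT f ->
  Rintegral lebesgue_measure setT f = Rintegral time setT f.
Proof.
move=> mf; apply: (f_equal fine); apply: integral_time.
exact: measurableT_comp.
Qed.

Lemma summ_time (f : R -> R) : summ lebesgue_measure f <-> summ time f.
Proof.
split=> /integrableP[mf fi]; apply/integrableP; split => //.
  by rewrite -integral_time//; exact: measurableT_comp.
by rewrite integral_time//; exact: (measurableT_comp _ mf).
Qed.

Lemma summ_itv (a b : R) : summ time \1_(`[a, b] : set R).
Proof. by apply/summ_time; exact: integrable_indic_itv. Qed.

End TimeMeasure.

Section TimeTests.
Context {R : realType}.
Local Notation leb := (@lebesgue_measure R).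
Implicit Types (f g : R -> R) (a b s t : R) (n : nat).

Lemma Rintegral_derive g a b : a < b -> smooth1 g ->
  Rintegral leb `[a, b] (derive1 g) = g b - g a.
Proof.
move=> ab sg; have sg' := smooth1_derive sg.
have cg' : {within `[a, b], continuous (derive1 g)}.
  by apply: continuous_subspaceT => x; exact: smooth1_continuous.
rewrite /Rintegral (@continuous_FTC2 _ (derive1 g) g a b)//.
split; first by move=> x _; exact: smooth1_derivable.
  by apply: cvg_at_right_filter; exact: smooth1_continuous.
by apply: cvg_at_left_filter; exact: smooth1_continuous.
Qed.

Lemma step'_out t : ~~ (0 <= t <= 1) -> derive1 (@step R) t = 0.
Proof.
have z c : is_derive t 1 (fun=> c : R) 0 by exact: is_derive_cst.
rewrite negb_and -!ltNge => /orP[t0|t1].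
  have h : is_derive t 1 (@step R) 0.
    apply: near_eq_is_derive (z 0); near=> x.
    by rewrite step_le0//; apply/ltW; near: x; exact: lt_nbhsl.
  by rewrite derive1E; exact: derive_val.
have h : is_derive t 1 (@step R) 0.
  apply: near_eq_is_derive (z 1); near=> x.
  by rewrite step_ge1//; apply/ltW; near: x; exact: lt_nbhsr.
by rewrite derive1E; exact: derive_val.
Unshelve. all: by end_near. Qed.

Lemma step'_bounded : exists2 B : R, 0 <= B & forall t, `|derive1 (@step R) t| <= B.
Proof.
have ss := smooth1_derive (@smooth1_step R).
have cg : {within `[0, 1], continuous (fun x => `|derive1 (@step R) x|)}.
  apply/continuous_subspaceT => x; apply: continuous_comp.
    exact: smooth1_continuous.
  exact: norm_continuous.
have [c _ hc] := EVT_max ler01 cg.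
exists `|derive1 (@step R) c|; [exact: normr_ge0|move=> t].
have [ht|ht] := boolP (0 <= t <= 1); first by apply: hc; rewrite in_itv.
by rewrite step'_out// normr0.
Qed.

(** A smooth approximation of the indicator function of the times after [s], and
    its derivative, an approximation of the Dirac mass at [s]. *)
Definition ramp n s t : R := step (n.+1%:R * t + - (n.+1%:R * s)).

Definition bump n s t : R := n.+1%:R * derive1 (@step R) (n.+1%:R * t + - (n.+1%:R * s)).

Lemma smooth1_ramp n s : smooth1 (ramp n s).
Proof. exact/smooth1_affine/smooth1_step. Qed.

Lemma derive1_ramp n s : derive1 (ramp n s) = bump n s.
Proof.
apply: is_derive1_eq => x; apply: is_derive_affine.
exact/smooth1_is_derive/smooth1_step.
Qed.

Lemma smooth1_bump n s : smooth1 (bump n s).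
Proof. by rewrite -derive1_ramp; exact/smooth1_derive/smooth1_ramp. Qed.

Lemma measurable_bump n s : measurable_fun setT (bump n s).
Proof. exact: (smooth1_measurable (smooth1_bump n s)). Qed.

Lemma bump_support n s t : bump n s t != 0 -> s <= t <= s + n.+1%:R^-1.
Proof.
have n0 : 0 < n.+1%:R :> R by [].
have [|/step'_out E] := boolP (0 <= n.+1%:R * t + - (n.+1%:R * s) <= 1); last first.
  by rewrite /bump E mulr0 eqxx.
rewrite -mulrBr pmulr_rge0// subr_ge0 => /andP[-> h] _ /=.
by rewrite addrC -lerBlDr -div1r ler_pdivlMr// mulrC.
Qed.

Lemma bump_bounded : exists2 B : R, 0 <= B & forall n s t, `|bump n s t| <= n.+1%:R * B.
Proof.
have [B B0 hB] := step'_bounded; exists B => // n s t.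
by rewrite /bump normrM ger0_norm// ler_wpM2l.
Qed.

Lemma summ_compact g a b (M : R) : measurable_fun setT g ->
  (forall t, g t != 0 -> a <= t <= b) -> (forall t, `|g t| <= M) -> summ time g.
Proof.
move=> mg sg gM; apply: (@summ_le _ _ _ _ _ (fun t => M * \1_(`[a, b] : set R) t)) => //.
  move=> t; rewrite indicE; have [->|/sg ab] := eqVneq (g t) 0.
    by rewrite normr0 mulr_ge0// (le_trans _ (gM t)).
  by rewrite mem_set ?mulr1//= in_itv.
by apply: summZ; exact: summ_itv.
Qed.

Lemma Rintegral_support g a b : measurable_fun setT g -> (forall t, g t != 0 -> a <= t <= b) ->
  Rintegral time setT g = Rintegral leb `[a, b] g.
Proof.
move=> mg sg; rewrite [RHS]Rintegral_mkcond -Rintegral_time//.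
congr (Rintegral _ _ _); apply/funext => t.
rewrite patchE; case: ifPn => //; rewrite notin_setE/= in_itv/= => /negP h.
by apply/eqP; apply: contraNT h => /sg.
Qed.

Lemma summ_bump n s : summ time (bump n s).
Proof.
have [B B0 hB] := bump_bounded.
exact: (summ_compact (measurable_bump n s) (@bump_support n s) (hB n s)).
Qed.

Lemma I_bump n s : Rintegral time setT (bump n s) = 1.
Proof.
have n0 : 0 < n.+1%:R :> R by [].
rewrite (Rintegral_support (measurable_bump n s) (@bump_support n s)) -derive1_ramp.
rewrite Rintegral_derive ?ltrDl ?invr_gt0//; last exact: smooth1_ramp.
by rewrite /ramp -!mulrBr addrAC subrr add0r mulr0 divff// step_ge1// step_le0// subr0.
Qed.

(** The bump is at most [(n + 1) B] and lives in a ball of radius [2 / (n + 1)]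
    around [s], so the error is at most [4 B] times the average oscillation that
    defines a Lebesgue point. *)
Lemma bump_cvg h s : summ time h -> lebesgue_pt h s ->
  Rintegral time setT (fun t => h t * bump n s t) @[n --> \oo] --> h s.
Proof.
move=> sh lp; have [B B0 hB] := bump_bounded.
have mb n := measurable_bump n s.
have shb n : summ time (fun t => h t * bump n s t) by apply: summM_bounded (hB n s).
have key n : ((`|Rintegral time setT (fun t => h t * bump n s t) - h s|)%:E <=
    (4 * B)%:E * davg h s (2 / n.+1%:R))%E.
  have n0 : 0 < n.+1%:R :> R by [].
  have r0 : 0 < 2 / n.+1%:R :> R by rewrite divr_gt0.
  have -> : h s = Rintegral time setT (fun t => h s * bump n s t).
    by rewrite IZ ?I_bump ?mulr1//; exact: summ_bump.
  rewrite -IB//; last by apply: summZ; exact: summ_bump.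
  have sd : summ time (fun t => h t * bump n s t - h s * bump n s t).
    by apply: summB => //; apply: summZ; exact: summ_bump.
  apply: (@le_trans _ _ (\int[time]_t (`|h t * bump n s t - h s * bump n s t|)%:E)%E).
    rewrite (I_EFin (summ_norm sd)) lee_fin.
    exact: (le_normr_Rintegral measurableT sd).
  rewrite /davg /iavg lebesgue_measure_ball; last exact: ltW.
  rewrite inver mulrn_eq0/= gt_eqF//= muleA -EFinM.
  have -> : 4 * B * (2 / n.+1%:R *+ 2)^-1 = n.+1%:R * B by field; rewrite nat1r pnatr_eq0.
  have mh := summ_meas sh.
  have mc : measurable_fun setT (fun t => `|(h t - h s)%:E|)%E.
    by apply: measurableT_comp => //; apply/measurable_EFinP; exact: measurable_funB.
  have mB : measurable (ball s (2 / n.+1%:R) : set R) by exact: measurable_ball.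
  rewrite -ge0_integralZl//; last 2 first.
    - exact: measurable_funS mc.
    - by rewrite lee_fin mulr_ge0.
  rewrite integral_mkcond integral_time; last first.
    apply/(measurable_restrictT _ _).1 => //.
    by apply: measurable_funeM; exact: measurable_funS mc.
  apply: ge0_le_integral => //.
    - by apply/measurable_EFinP; exact: measurableT_comp (summ_meas sd).
    - apply/(measurable_restrictT _ _).1 => //.
      by apply: measurable_funeM; exact: measurable_funS mc.
  move=> t _; rewrite -mulrBl normrM.
  have [->|/bump_support/andP[st ts]] := eqVneq (bump n s t) 0.
    rewrite normr0 mulr0 patchE; case: ifPn => // _.
    by rewrite mule_ge0// lee_fin mulr_ge0.
  rewrite patchE mem_set.
    by rewrite /= lee_fin mulrC ler_wpM2r.
  rewrite /ball/= distrC ger0_norm ?subr_ge0// ltrBlDl (le_lt_trans ts)//.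
  by rewrite ltrD2l mulrC ltr_pMr ?invr_gt0// ltr1n.
apply/cvgrPdist_lt => e e0.
have e1 : 0 < e / (4 * B + 1) by rewrite divr_gt0// ltr_wpDl// mulr_ge0.
have [d /= d0 hd] : \forall x \near 0^'+, (davg h s x < (e / (4 * B + 1))%:E)%E.
  have e2 : (0%:E < (e / (4 * B + 1))%:E :> \bar R)%E by rewrite lte_fin.
  exact: (lp _ (open_ereal_lt' e2)).
near=> n.
have n1 : (n.+1%:R : R)^-1 < d / 2.
  by near: n; apply: (near_infty_natSinv_lt (PosNum (divr_gt0 d0 (@ltr0n _ 2)))).
rewrite distrC -lte_fin (le_lt_trans (key n))//.
have [->|B1] := eqVneq B 0; first by rewrite mulr0 mul0e lte_fin.
have {}B1 : 0 < B by rewrite lt_def B1.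
apply: (@lt_le_trans _ _ ((4 * B)%:E * (e / (4 * B + 1))%:E)%E).
  rewrite lte_pmul2l//; last by rewrite lte_fin mulr_gt0.
  apply: hd => /=; last by rewrite divr_gt0.
  by rewrite sub0r normrN ger0_norm 1?ltW ?divr_gt0// mulrC -ltr_pdivlMr.
rewrite -EFinM lee_fin mulrCA ler_piMr ?ltW//.
by rewrite ltr_pdivrMr ?mul1r ?ltrDl// ltr_wpDl// mulr_ge0// ltW.
Unshelve. all: by end_near. Qed.

(** Compact subsets that exhaust the positive times.  Functions of time are
    controlled on each of them only. *)
Definition slab k : set R := `[k.+1%:R^-1, k.+1%:R].

Definition locsumm f := forall k, summ time (fun t => \1_(slab k) t * f t).

Definition lpt f t := forall k, lebesgue_pt (fun x => \1_(slab k) x * f x) t.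

Definition ttest f := smooth1 f /\
  exists a b, [/\ 0 < a, a < b & forall t, f t != 0 -> a <= t <= b].

Lemma slab_itv a b : 0 < a -> exists k, forall t, a <= t <= b -> slab k t.
Proof.
move=> a0; have [m hm] : exists m : nat, Num.max a^-1 b <= m%:R.
  by exists (Num.truncn (Num.max a^-1 b)).+1; apply/ltW/truncnS_gt.
exists m => t /andP[at_ tb]; rewrite /slab/= in_itv/=.
move: hm; rewrite ge_max => /andP[am bm].
have m1 : m%:R <= m.+1%:R :> R by rewrite ler_nat.
rewrite (le_trans tb (le_trans bm m1)) andbT (le_trans _ at_)//.
by rewrite -[leRHS]invrK lef_pV2 ?posrE ?invr_gt0// (le_trans am).
Qed.

Lemma ae_time (P : R -> Prop) : {ae (@lebesgue_measure R), forall t, P t} <-> {ae (@time R), forall t, P t}.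
Proof. by split=> -[B [mB B0 hB]]; exists B; split. Qed.

Lemma ae_lpt f : locsumm f -> {ae (@time R), forall t, lpt f t}.
Proof.
move=> sf; apply/ae_foralln => k; apply/ae_time.
apply: lebesgue_differentiation; apply: open_integrable_locally; first exact: openT.
by have /summ_time := sf k.
Qed.

Lemma ttest_bump n s : 0 < s -> ttest (bump n s).
Proof.
move=> s0; split; first exact: smooth1_bump.
exists s, (s + n.+1%:R^-1); split; rewrite ?ltrDl ?invr_gt0//.
exact: bump_support.
Qed.

Lemma fundamental_lemma f s : locsumm f ->
  (forall g, ttest g -> Rintegral time setT (fun t => f t * g t) = 0) ->
  0 < s -> lpt f s -> f s = 0.
Proof.
move=> sf hf s0 ls; have [k hk] := slab_itv (s + 1) s0.
have E n t : f t * bump n s t = \1_(slab k) t * f t * bump n s t.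
  have [->|/bump_support/andP[st ts]] := eqVneq (bump n s t) 0; first by rewrite !mulr0.
  rewrite indicE mem_set ?mul1r//; apply: hk; rewrite st (le_trans ts)//.
  by rewrite lerD2l invf_le1// ler1n.
have := bump_cvg (sf k) (ls k); under eq_fun.
  move=> n; rewrite -(eq_I _ (E n)) hf; last exact: ttest_bump.
  over.
have -> : \1_(slab k) s * f s = f s.
  by rewrite indicE mem_set ?mul1r//; apply: hk; rewrite lexx lerDl ler01.
move=> h; apply: esym.
exact: (cvg_unique _ (cvg_cst 0) h).
Qed.

Lemma ramp_le0 n s t : t <= s -> ramp n s t = 0.
Proof. by move=> ts; rewrite /ramp step_le0// -mulrBr mulr_ge0_le0// subr_le0. Qed.

Lemma ramp_ge1 n s t : s + n.+1%:R^-1 <= t -> ramp n s t = 1.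
Proof.
move=> h; rewrite /ramp step_ge1// -mulrBr -ler_pdivrMl// mulr1.
by rewrite lerBrDl.
Qed.

Lemma ramp_cvg s t : ramp n s t @[n --> \oo] --> (\1_[set x | s < x] t : R).
Proof.
rewrite indicE; have [ts|st] := leP t s.
  rewrite memNset/=; last by apply/negP; rewrite -leNgt.
  by under eq_fun do rewrite ramp_le0//; exact: cvg_cst.
rewrite mem_set//=; have e0 : 0 < t - s by rewrite subr_gt0.
apply: cvg_near_cst; near=> n; apply: ramp_ge1.
rewrite -lerBrDl; apply/ltW; near: n.
exact: (near_infty_natSinv_lt (PosNum e0)).
Unshelve. all: by end_near. Qed.

(** Test with the difference of two ramps, at [s] and at [t]: its derivative
    evaluates [f] at the two Lebesgue points, and it converges to the indicator
    function of the interval. *)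
Lemma du_bois_reymond f g s t : locsumm f -> locsumm g ->
  (forall h, ttest h -> Rintegral time setT (fun x => f x * derive1 h x) =
     - Rintegral time setT (fun x => g x * h x)) ->
  0 < s -> s < t -> lpt f s -> lpt f t ->
  f t - f s = Rintegral time setT (fun x => \1_(`]s, t] : set R) x * g x).
Proof.
move=> sf sg hfg s0 st ls lt; have t0 := lt_trans s0 st.
have [k hk] := slab_itv (t + 1) s0.
pose h n x := ramp n s x - ramp n t x.
have sh n : smooth1 (h n).
  have -> : h n = fun x => ramp n s x + -1 * ramp n t x.
    by apply/funext => x; rewrite mulN1r.
  apply: smooth1D; first exact: smooth1_ramp.
  by apply: smooth1M; [exact: smooth1_cst|exact: smooth1_ramp].
have h' n : derive1 (h n) = fun x => bump n s x - bump n t x.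
  apply: is_derive1_eq => x; apply: is_derive1D.
    by rewrite -derive1_ramp; exact/smooth1_is_derive/smooth1_ramp.
  by apply: is_derive1N; rewrite -derive1_ramp; exact/smooth1_is_derive/smooth1_ramp.
have n1 n : (n.+1%:R : R)^-1 <= 1 by rewrite invf_le1// ler1n.
have hs n x : h n x != 0 -> s <= x <= t + 1.
  apply: contraR; rewrite negb_and -!ltNge => /orP[xs|tx].
    by rewrite /h !ramp_le0 ?subrr// ltW// (lt_trans xs).
  rewrite /h !ramp_ge1 ?subrr//; apply: le_trans (ltW tx); rewrite lerD//.
  exact: ltW.
have th n : ttest (h n).
  split => //; exists s, (t + 1); split => //; first by rewrite (lt_trans st)// ltrDl.
  exact: hs.
have cutE (p : R -> R) y : (forall x, p x != 0 -> s <= x <= t + 1) ->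
    forall q : R -> R, q y * p y = \1_(slab k) y * q y * p y.
  move=> ps q; have [->|/ps/hk hy] := eqVneq (p y) 0; first by rewrite !mulr0.
  by rewrite indicE mem_set ?mul1r.
have bs n x : bump n s x != 0 -> s <= x <= t + 1.
  move=> /bump_support/andP[-> /=] hx; rewrite (le_trans hx)// lerD//.
  exact: ltW.
have bt n x : bump n t x != 0 -> s <= x <= t + 1.
  move=> /bump_support/andP[hx hx']; rewrite (le_trans (ltW st) hx)/=.
  by rewrite (le_trans hx')// lerD2l.
have [B B0 hB] := bump_bounded.
have sb n c : summ time (fun x => \1_(slab k) x * f x * bump n c x).
  exact: (summM_bounded (sf k) (measurable_bump n c) (hB n c)).
have E n : Rintegral time setT (fun x => \1_(slab k) x * f x * bump n t x) -
    Rintegral time setT (fun x => \1_(slab k) x * f x * bump n s x) =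
    Rintegral time setT (fun x => \1_(slab k) x * g x * h n x).
  have E1 x : f x * derive1 (h n) x = \1_(slab k) x * f x * bump n s x -
      \1_(slab k) x * f x * bump n t x.
    by rewrite h' mulrBr; congr (_ - _); [exact: (cutE _ _ (bs n))|exact: (cutE _ _ (bt n))].
  have E2 x : g x * h n x = \1_(slab k) x * g x * h n x by exact: (cutE _ _ (hs n)).
  have E3 := hfg _ (th n).
  rewrite (eq_I time E1) (eq_I time E2) (IB (sb n s) (sb n t)) in E3.
  by apply: (can_inj opprK); rewrite -E3 opprB.
have L : (fun n => Rintegral time setT (fun x => \1_(slab k) x * g x * h n x))
    @ \oo --> f t - f s.
  rewrite -(funext E).
  have fE x : s <= x <= t + 1 -> f x = \1_(slab k) x * f x.
    by move=> /hk hx; rewrite indicE mem_set ?mul1r.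
  rewrite (fE t) ?(ltW st) ?lerDl//=; rewrite (fE s) ?lexx/= ?(le_trans (ltW st)) ?lerDl//.
  by apply: cvgB; exact: bump_cvg.
apply: (cvg_unique _ L) => //.
have -> : (fun x => \1_(`]s, t] : set R) x * g x) =
    (fun x => \1_(slab k) x * g x * \1_(`]s, t] : set R) x).
  apply/funext => x; rewrite mulrC; apply: cutE => y; rewrite indicE.
  have [|] := boolP (y \in _); last by rewrite eqxx.
  rewrite inE/= in_itv/= => /andP[sy yt] _.
  by rewrite (ltW sy) (le_trans yt)// lerDl.
have mr n c : measurable_fun setT (ramp n c) := smooth1_measurable (smooth1_ramp n c).
have mI : measurable_fun setT (\1_(`]s, t] : set R) : R -> R) by exact: measurable_indic.
apply: (@dominated_I _ _ _ _ _ _ (fun x => 2 * `|\1_(slab k) x * g x|)).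
- move=> n; apply: measurable_funM; first exact: summ_meas (sg k).
  exact: measurable_funB.
- by apply: measurable_funM => //; exact: summ_meas (sg k).
- move=> x; apply: cvgM; first exact: cvg_cst.
  have -> : (\1_(`]s, t] : set R) x : R) = \1_[set y | s < y] x - \1_[set y | t < y] x.
    rewrite !indicE; have [xs|sx] := leP x s.
      rewrite !memNset ?subrr//=; rewrite ?in_itv/= ?ltNge ?xs//.
      by rewrite (le_trans xs (ltW st)).
    have [xt|tx] := leP x t.
      rewrite mem_set/= ?in_itv/= ?sx// mem_set//= memNset ?subr0//=.
      by rewrite ltNge xt.
    rewrite memNset/= ?in_itv/= ?sx/= 1?leNgt ?tx// !mem_set//=.
    by rewrite subrr.
  by apply: cvgB; exact: ramp_cvg.
- by apply: summZ; exact: summ_norm (sg k).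
move=> n x; rewrite normrM mulrC ler_wpM2r// /h (le_trans (ler_normB _ _))//.
have rb c : `|ramp n c x| <= 1.
  by have /andP[r0 r1] := step_itv (n.+1%:R * x + - (n.+1%:R * c)); rewrite /ramp ger0_norm.
by rewrite -[2]/(1 + 1) lerD.
Qed.

End TimeTests.

(** * Riemann sums in time *)

Section AeIntegrals.
Context d (T : measurableType d) {R : realType}.
Variable mu : {measure set T -> \bar R}.
Implicit Types (f g : T -> R).
Local Notation I f := (Rintegral mu setT f).

Lemma norm_I_le_ae f g : summ mu f -> summ mu g -> (forall x, 0 <= g x) ->
  {ae mu, forall x, `|f x| <= g x} -> `|I f| <= I g.
Proof.
move=> sf sg g0 fg.
apply: (le_trans (le_normr_Rintegral measurableT sf)).
rewrite -lee_fin -!I_EFin//; last exact: summ_norm.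
apply: ae_ge0_le_integral => //.
- by apply/measurable_EFinP; exact: measurableT_comp (summ_meas sf).
- by move=> x _; rewrite lee_fin.
- by apply/measurable_EFinP; exact: summ_meas sg.
- by apply: filterS fg => x h _; rewrite lee_fin.
Qed.

Lemma eq_I_ae f g : measurable_fun setT f -> measurable_fun setT g ->
  {ae mu, forall x, f x = g x} -> I f = I g.
Proof.
move=> mf mg fg; apply: (f_equal fine); apply: ae_eq_integral => //.
- exact/measurable_EFinP.
- exact/measurable_EFinP.
- by apply: filterS fg => x -> _.
Qed.

End AeIntegrals.

Section Partition.
Context {R : realType}.
Local Notation leb := (@lebesgue_measure R).
Implicit Types (f g : R -> R) (a b s t : R).

Lemma ae_pos_dense (A : set R) s t : {ae (@time R), forall t, 0 < t -> A t} ->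
  0 < s -> s < t -> exists r, [/\ s < r, r < t & A r].
Proof.
move=> [B [mB B0 hB]] s0 st; apply: contrapT => h.
suff : (leb `]s, t[ <= leb B)%E.
  by rewrite B0 lebesgue_measure_itv/= lte_fin st -EFinB lee_fin leNgt subr_gt0 st.
apply: le_measure; rewrite ?inE//; move=> r /=; rewrite in_itv/= => /andP[sr rt].
apply: hB => /= H; apply: h; exists r; split => //; apply: H.
exact: lt_trans sr.
Qed.

Definition tint s t f := Rintegral time setT (fun x => \1_(`]s, t] : set R) x * f x).

Lemma mindic s t : measurable_fun setT (\1_(`]s, t] : set R) : R -> R).
Proof. exact: measurable_indic. Qed.

Lemma indic_le1 (D : set R) (x : R) : `|\1_D x : R| <= 1.
Proof. by rewrite indicE; case: (_ \in _); rewrite ?normr1// normr0. Qed.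

Lemma summ_tint f s t : locsumm f -> 0 < s ->
  summ time (fun x => \1_(`]s, t] : set R) x * f x).
Proof.
move=> sf s0; have [k hk] := slab_itv t s0.
have -> : (fun x => \1_(`]s, t] : set R) x * f x) =
    (fun x => \1_(slab k) x * f x * \1_(`]s, t] : set R) x).
  apply/funext => x; rewrite [\1_(`]s, t]) x]indicE.
  have [|_] := boolP (x \in _); last by rewrite mul0r mulr0.
  rewrite inE/= in_itv/= => /andP[/ltW sx xt].
  by rewrite mul1r mulr1 indicE mem_set ?mul1r//; apply: hk; rewrite sx.
exact: summM_bounded (sf k) (mindic s t) (indic_le1 _).
Qed.

Lemma tint_split f s r t : locsumm f -> 0 < s -> s <= r -> r <= t ->
  tint s t f = tint s r f + tint r t f.
Proof.
move=> sf s0 sr rt; rewrite /tint -ID; last 2 first.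
- exact: summ_tint.
- by apply: summ_tint => //; exact: lt_le_trans sr.
apply: eq_I => x; rewrite -mulrDl; congr (_ * _); rewrite !indicE.
have E (p q : R) : (x \in [set` `]p, q]]) = (p < x <= q).
  by apply/idP/idP; rewrite inE/= in_itv.
rewrite !E; have [xr|rx] := leP x r.
  by rewrite (le_trans xr rt) !andbT/= addr0.
by rewrite (le_lt_trans sr rx)/= add0r.
Qed.

Lemma tint_ge0 f s t : (forall x, 0 <= f x) -> 0 <= tint s t f.
Proof. by move=> f0; apply: I_ge0 => x; rewrite mulr_ge0// indicE. Qed.

Lemma tintZ c f s t : locsumm f -> 0 < s -> tint s t (fun x => c * f x) = c * tint s t f.
Proof.
by move=> sf s0; rewrite /tint -IZ; [|exact: summ_tint]; apply: eq_I => x; rewrite mulrCA.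
Qed.

Lemma locsummD f g : locsumm f -> locsumm g -> locsumm (fun x => f x + g x).
Proof.
move=> sf sg k; under [fun _ => _]funext => x do rewrite mulrDr.
exact: summD.
Qed.

Lemma locsummZ c f : locsumm f -> locsumm (fun x => c * f x).
Proof.
move=> sf k; under [fun _ => _]funext => x do rewrite mulrCA.
exact: summZ.
Qed.

Lemma locsumm_norm f : locsumm f -> locsumm (fun x => `|f x|).
Proof.
move=> sf k; have := summ_norm (sf k).
suff -> : (fun x => `|\1_(slab k) x * f x|) = (fun x => \1_(slab k) x * `|f x|) by [].
by apply/funext => x; rewrite normrM ger0_norm// indicE.
Qed.

Lemma locsumm_sum (K : Type) (s : seq K) (f : K -> R -> R) :
  (forall i, locsumm (f i)) -> locsumm (fun x => \sum_(i <- s) f i x).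
Proof.
move=> sf k; under [fun _ => _]funext => x do rewrite mulr_sumr.
by apply: summ_sum => i; exact: sf.
Qed.

Lemma tint_sum (K : Type) (q : seq K) (f : K -> R -> R) s t : (forall i, locsumm (f i)) ->
  0 < s -> tint s t (fun x => \sum_(i <- q) f i x) = \sum_(i <- q) tint s t (f i).
Proof.
move=> sf s0; rewrite /tint -Isum; last by move=> i; exact: summ_tint.
by apply: eq_I => x; rewrite mulr_sumr.
Qed.

Lemma tint_abs_cont f a b e : locsumm f -> (forall x, 0 <= f x) -> 0 < a -> 0 < e ->
  exists2 d, 0 < d & forall s t, a <= s -> s <= t -> t <= b -> t - s < d -> tint s t f < e.
Proof.
move=> sf f0 a0 e0; have sF := summ_tint b sf a0.
have [d [d0 hd]] := integral_normr_continuous sF e0.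
exists d => // s t as_ st tb tsd.
have mst : measurable (`]s, t] : set R) by exact: measurable_itv.
have := hd _ mst; rewrite /time/= /time_measure lebesgue_measure_itv/=.
have h : ((if (s%:E < t%:E)%E then t%:E - s%:E else 0) < d%:E)%E.
  by case: ifP => // _; rewrite -EFinB lte_fin.
move=> /(_ h); apply: le_lt_trans; rewrite le_eqVlt; apply/orP; left; apply/eqP.
rewrite /tint [RHS]Rintegral_mkcond; apply: eq_I => x.
rewrite patchE indicE; have [|_] := boolP (x \in _); last by rewrite mul0r.
rewrite inE/= in_itv/= => /andP[sx xt]; rewrite mul1r indicE mem_set ?mul1r ?ger0_norm//.
by rewrite /= in_itv/= (le_lt_trans as_ sx) (le_trans xt).
Qed.

(** Formally [F' = 2 sum W T], but [F] has no derivative to speak of.  Let [D] be the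
    difference of the two sides of the conclusion and [g] a bound for all the
    densities.  Replacing [W] inside an integral by its value at an end point
    costs one more integral of [g], so [D] is at most twice the square of the
    integral of [g] over [s, t]; being additive, it is zero, as the sum over a
    fine partition shows.  The partition points have to avoid the exceptional
    null set. *)
Lemma partition_lemma (K : finType) (W T G : K -> R -> R) (F : R -> R) (A : set R) :
  {ae (@time R), forall t, 0 < t -> A t} ->
  (forall i, locsumm (T i)) -> (forall i, locsumm (G i)) ->
  (forall i, locsumm (fun x => W i x * T i x)) ->
  (forall i s t, 0 < s -> s < t -> A s -> A t -> W i t - W i s = tint s t (G i)) ->
  (forall s t, 0 < s -> s < t -> A s -> A t ->
    F t - F s = \sum_i tint s t (T i) * (W i t + W i s)) ->
  forall s t, 0 < s -> s < t -> A s -> A t ->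
    F t - F s = 2 * tint s t (fun x => \sum_i W i x * T i x).
Proof.
move=> hA sT sG sWT hW hF.
pose g x := \sum_i (`|T i x| + `|G i x|).
have sg : locsumm g by apply: locsumm_sum => i; apply: locsummD; exact: locsumm_norm.
have g0 x : 0 <= g x by apply: sumr_ge0 => i _; rewrite addr_ge0.
pose D s t := F t - F s - 2 * tint s t (fun x => \sum_i W i x * T i x).
have sflux : locsumm (fun x => \sum_i W i x * T i x) by exact: locsumm_sum.
have DE s t : 0 < s -> s < t -> A s -> A t -> D s t =
    \sum_i tint s t (fun x => T i x * (W i t + W i s) - 2 * (W i x * T i x)).
  move=> s0 st As At; rewrite /D hF// tint_sum// mulr_sumr -sumrB; apply: eq_bigr => i _.
  rewrite -tintZ// mulrC -tintZ// -[RHS](addr0) /tint -IB; last 2 first.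
  - by apply: summ_tint => //; exact: locsummZ.
  - by apply: summ_tint => //; exact: locsummZ.
  by rewrite addr0; apply: eq_I => x; ring.
have sTW i s t : locsumm (fun x => T i x * (W i t + W i s) - 2 * (W i x * T i x)).
  have -> : (fun x => T i x * (W i t + W i s) - 2 * (W i x * T i x)) =
      (fun x => (W i t + W i s) * T i x + -2 * (W i x * T i x)).
    by apply/funext => x; ring.
  by apply: locsummD; exact: locsummZ.
have D2 s t : 0 < s -> s < t -> A s -> A t -> `|D s t| <= 2 * tint s t g * tint s t g.
  move=> s0 st As At; rewrite DE// (le_trans (ler_norm_sum _ _ _))//.
  apply: (@le_trans _ _ (\sum_i (2 * tint s t (fun x => `|G i x|)) * tint s t (fun x => `|T i x|))).
    apply: ler_sum => i _; rewrite -tintZ//; last exact: locsumm_norm.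
    have sGi := locsumm_norm (sG i); have sTi := locsumm_norm (sT i).
    apply: norm_I_le_ae.
    - exact: summ_tint.
    - by apply: summ_tint => //; exact: locsummZ.
    - move=> x; rewrite mulr_ge0// ?indicE// mulr_ge0// mulr_ge0//.
      exact: tint_ge0.
    apply: filterS hA => x Ax.
    rewrite indicE; have [|_] := boolP (x \in _); last by rewrite !mul0r normr0.
    rewrite inE/= in_itv/= => /andP[sx xt]; rewrite !mul1r.
    have x0 : 0 < x := lt_trans s0 sx.
    have {}Ax := Ax x0.
    have nJ p q : 0 < p -> `|tint p q (G i)| <= tint p q (fun x => `|G i x|).
      move=> p0; apply: norm_I_le; [exact: summ_tint..|] => y.
      by rewrite normrM ger0_norm// indicE.
    have E1 : `|W i x - W i s| <= tint s x (fun x => `|G i x|) by rewrite hW// nJ.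
    have E2 : `|W i t - W i x| <= tint x t (fun x => `|G i x|).
      have [->|xt'] := eqVneq x t; first by rewrite subrr normr0; exact: tint_ge0.
      by rewrite hW ?nJ// lt_neqAle xt'.
    rewrite (tint_split sGi s0 (ltW sx) xt).
    have -> : T i x * (W i t + W i s) - 2 * (W i x * T i x) =
      ((W i t - W i x) - (W i x - W i s)) * T i x by ring.
    rewrite normrM ler_wpM2r// (le_trans (ler_normB _ _))//.
    have := tint_ge0 s x (fun y => normr_ge0 (G i y)).
    have := tint_ge0 x t (fun y => normr_ge0 (G i y)); lra.
  rewrite /g [X in _ <= _ * X]tint_sum//; last first.
    by move=> i; apply: locsummD; exact: locsumm_norm.
  rewrite mulr_sumr; apply: ler_sum => i _.
  apply: ler_pM; rewrite ?mulr_ge0 ?tint_ge0// ?ler_pM2l//; apply: le_I.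
  - by apply: summ_tint => //; exact: locsumm_norm.
  - exact: summ_tint.
  - move=> x; rewrite ler_wpM2l ?indicE// (bigD1 i)//=.
    by rewrite -[leLHS]add0r -addrA lerD// lerDl sumr_ge0// => k _; rewrite addr_ge0.
  - by apply: summ_tint => //; exact: locsumm_norm.
  - by apply: summ_tint => //; apply: locsummD; exact: locsumm_norm.
  - by move=> x; rewrite ler_wpM2l ?indicE// lerDl.
have Dadd s r t : 0 < s -> s < r -> r < t -> D s t = D s r + D r t.
  by move=> s0 sr rt; rewrite /D (tint_split sflux s0 (ltW sr) (ltW rt)); ring.
move=> s t s0 st As At; apply/eqP; rewrite -subr_eq0 -/(D s t) -normr_eq0.
have Jg0 p q : 0 <= tint p q g by exact: tint_ge0.
suff H e : 0 < e -> `|D s t| <= 2 * e * tint s t g.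
  rewrite eq_le normr_ge0 andbT; apply/ler_addgt0Pl => e e0; rewrite addr0.
  have k0 : 0 < 2 * (tint s t g + 1) by rewrite mulr_gt0// ltr_wpDl.
  apply: (le_trans (H (e / (2 * (tint s t g + 1))) _)); first by rewrite divr_gt0.
  have -> : 2 * (e / (2 * (tint s t g + 1))) * tint s t g = e * (tint s t g / (tint s t g + 1)).
    by field; rewrite gt_eqF// ltr_wpDl.
  by rewrite ler_piMr ?ltW// ltr_pdivrMr ?mul1r ?ltrDl// ltr_wpDl.
move=> e0; have [d d0 hd] := tint_abs_cont t sg g0 s0 e0.
suff H m p q : s <= p -> p < q -> q <= t -> A p -> A q -> q - p < m%:R * (d / 2) ->
    `|D p q| <= 2 * e * tint p q g.
  have [m hm] : exists m : nat, (t - s) / (d / 2) < m%:R.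
    by exists (Num.truncn ((t - s) / (d / 2))).+1; exact: truncnS_gt.
  by apply: (H m) => //; rewrite -ltr_pdivrMr// divr_gt0.
elim: m p => [|m ih] p sp pq qt Ap Aq; first by rewrite mul0r subr_lt0 ltNge (ltW pq).
have p0 := lt_le_trans s0 sp.
have small r : p < r -> r <= q -> A r -> r - p < d -> `|D p r| <= 2 * e * tint p r g.
  move=> pr rq Ar rpd; rewrite (le_trans (D2 _ _ p0 pr Ap Ar))//.
  rewrite ler_wpM2r// ler_pM2l// ltW//; apply: hd => //; first exact: ltW.
  exact: le_trans rq qt.
move=> hm; have [qpd|dqp] := ltP (q - p) d; first exact: small.
(* a step of length between d / 2 and d: short enough for [small], and long
   enough to use up one unit of the induction *)
have [r [pr rd Ar]] : exists r, [/\ p + d / 2 < r, r < p + d & A r].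
  by apply: ae_pos_dense hA _ _; lra.
have pr' : p < r by lra.
have rq : r < q by lra.
rewrite (Dadd _ r)// (tint_split sg p0 (ltW pr') (ltW rq)) mulrDr.
rewrite (le_trans (ler_normD _ _))// lerD//; first by apply: small => //; lra.
apply: ih => //; first lra.
move: hm; rewrite -natr1 mulrDl; lra.
Qed.

End Partition.

(** * Integrability in time *)

Section LowerIntegral.
Context d (T : measurableType d) {R : realType}.
Variable mu : {measure set T -> \bar R}.
Implicit Types (D : set T).

(** The integral of a nonnegative function is the supremum of the integrals of
    the simple functions below it, hence monotone without measurability. *)
Lemma ge0_le_lower_integral D (f g : T -> \bar R) :
  (forall x, D x -> 0 <= f x)%E -> (forall x, D x -> f x <= g x)%E ->
  (\int[mu]_(x in D) f x <= \int[mu]_(x in D) g x)%E.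
Proof.
move=> f0 fg; have g0 x : D x -> (0 <= g x)%E by move=> Dx; exact: le_trans (f0 x Dx) (fg x Dx).
rewrite (ge0_integralE mu f0) (ge0_integralE mu g0).
apply: le_ereal_sup => _ [h /= hf <-]; exists h => // x; apply: (le_trans (hf x)).
by rewrite !patchE; case: ifPn => //; rewrite inE; exact: fg.
Qed.

Lemma summ_le_ae (f g : T -> R) : measurable_fun setT f -> (forall x, 0 <= g x) ->
  {ae mu, forall x, `|f x| <= g x} -> summ mu g -> summ mu f.
Proof.
move=> mf g0 fg sg; apply/integrableP; split; first exact/measurable_EFinP.
apply: (@le_lt_trans _ _ (\int[mu]_x (g x)%:E)%E); last by rewrite I_EFin// ltry.
apply: ae_ge0_le_integral => //.
- by apply: measurableT_comp => //; exact/measurable_EFinP.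
- by move=> x _; rewrite lee_fin.
- by apply/measurable_EFinP; exact: summ_meas sg.
- by apply: filterS fg => x h _; rewrite /= lee_fin.
Qed.

End LowerIntegral.

Section TimeIntegrability.
Context {R : realType}.
Local Notation leb := (@lebesgue_measure R).
Implicit Types (f g h : R -> R) (p : \bar R).

Lemma locsumm_le_ae f h : measurable_fun setT f -> locsumm h ->
  {ae (@time R), forall t, 0 < t -> `|f t| <= h t} -> locsumm f.
Proof.
move=> mf sh fh k; have slab0 t : slab k t -> 0 < t.
  by rewrite /slab/= in_itv/= => /andP[kt _]; apply: lt_le_trans kt.
apply: (@summ_le_ae _ _ _ _ _ (fun t => `|\1_(slab k) t * h t|)) => //.
- by apply: measurable_funM => //; apply: measurable_indic; exact: measurable_itv.
- move: fh; apply: filterS => t ht; rewrite !normrM.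
  rewrite indicE; have [|_] := boolP (t \in _); last by rewrite normr0 !mul0r.
  by rewrite inE => /slab0/ht ft; rewrite ler_wpM2l// (le_trans ft)// ler_norm.
- exact: summ_norm.
Qed.

Lemma locsumm_cst (c : R) : locsumm (fun=> c).
Proof.
move=> k; rewrite (_ : (fun _ => _) = (fun t => c * \1_(slab k) t)).
  by apply: summZ; exact: summ_itv.
by apply/funext => t; rewrite mulrC.
Qed.

(** Membership in [L^p] on the positive times, in the local form that suffices. *)
Definition Lcontrol p f :=
  if p is q%:E then locsumm (fun t => f t `^ q)
  else exists C : R, {ae (@time R), forall t, 0 < t -> f t <= C}.

(** Only [f] is measurable here, not the norm [F]: the integral of [F] is a lower
    integral, which is enough to dominate that of [f]. *)
Lemma Lcontrol_Lnorm p (F : R -> \bar R) f : (1 <= p)%E -> measurable_fun setT f ->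
  (forall t, 0 <= f t) -> (forall t, 0 < t -> ((f t)%:E <= F t)%E) ->
  ('N[leb]_p[F \_ `]0%R, +oo[] < +oo)%E -> Lcontrol p f.
Proof.
move=> p1 mf f0 fF.
have aF t : 0 < t -> ((f t)%:E <= `|(F \_ `]0%R, +oo[) t|)%E.
  move=> t0; rewrite patchE mem_set/= ?in_itv/= ?t0//.
  by rewrite (le_trans (fF t t0))// lee_abs.
rewrite unlock; case: p p1 => [q| |//] q1.
- rewrite lee_fin in q1; have q0 : 0 < q by exact: lt_le_trans q1.
  move=> /lty_poweRy => /(_ _)/wrap[]; first by rewrite invr_eq0 gt_eqF.
  move=> Fi k.
  have mfq : measurable_fun setT (fun t => \1_(slab k) t * f t `^ q).
    apply: measurable_funM; first by apply: measurable_indic; exact: measurable_itv.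
    by apply: (measurableT_comp (measurable_powR q)).
  apply/integrableP; split; first exact/measurable_EFinP.
  rewrite -integral_time; last by do 2 apply: measurableT_comp => //.
  apply: le_lt_trans Fi; apply: ge0_le_lower_integral => // t _.
  rewrite /= indicE; have [|_] := boolP (t \in _); last first.
    by rewrite mul0r normr0 poweR_ge0.
  rewrite inE /slab/= in_itv/= => /andP[kt _]; have t0 : 0 < t by exact: lt_le_trans kt.
  rewrite mul1r ger0_norm ?powR_ge0// -poweR_EFin.
  apply: gt0_ler_poweR; rewrite ?in_itv/= ?lee_fin ?leey ?andbT//; first exact: ltW.
  exact: aF.
- have -> : (0 < leb setT)%E.
    apply: (@lt_le_trans _ _ (leb `[0, 1])); first by rewrite lebesgue_measure_itv/= lte_fin ltr01 sube0.
    by apply: le_measure; rewrite ?inE.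
  move=> h; have [C hC] : exists C : R, (ess_sup leb (abse \o F \_ `]0%R, +oo[) <= C%:E)%E.
    move: h; case: (ess_sup _ _) => [C _| //|_]; first by exists C.
    by exists 0; rewrite leNye.
  exists C; apply/ae_time; move/ess_supP: hC; apply: filterS => t ht t0.
  by rewrite -lee_fin (le_trans (aF t t0)).
Qed.

Lemma le1D_powR (x q : R) : 0 <= x -> 1 <= q -> x <= 1 + x `^ q.
Proof.
move=> x0 q1; have [x1|/ltW x1] := leP x 1; first by rewrite (le_trans x1)// lerDl powR_ge0.
by rewrite -[leLHS]powRr1// (le_trans (ler_powR x1 q1))// lerDr.
Qed.

Lemma Lcontrol1 p f : (1 <= p)%E -> measurable_fun setT f -> (forall t, 0 <= f t) ->
  Lcontrol p f -> locsumm f.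
Proof.
move=> p1 mf f0; case: p p1 => [q| |//] q1 /= h.
  apply: (locsumm_le_ae mf (locsummD (locsumm_cst 1) h)).
  by apply: nearW => t _; rewrite ger0_norm// le1D_powR.
case: h => C hC; apply: (locsumm_le_ae mf (locsumm_cst C)).
by apply: filterS hC => t hf t0; rewrite ger0_norm//; exact: hf.
Qed.

Lemma Lcontrol_sq p f : (1 <= p)%E -> measurable_fun setT f -> (forall t, 0 <= f t) ->
  Lcontrol (2%:E * p) f -> Lcontrol p (fun t => f t ^+ 2).
Proof.
move=> p1 mf f0; case: p p1 => [q| |//] q1.
  rewrite -EFinM/= => h k; have := h k.
  suff -> : (fun t => \1_(slab k) t * f t `^ (2 * q)) =
    (fun t => \1_(slab k) t * (f t ^+ 2) `^ q) by [].
  by apply/funext => t; rewrite powRrM powR_mulrn.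
rewrite gt0_muley ?lte_fin// => -[C hC]; exists (C ^+ 2).
apply: filterS hC => t hf t0; rewrite !expr2 ler_pM//; exact: hf.
Qed.

(** Hoelder's inequality in time: one factor is controlled in L^r, the other
    in the dual L^kappa. *)
Lemma Lcontrol_mul (r kappa : \bar R) f g : (1 <= r)%E -> (1 <= kappa)%E ->
  (r^-1 + kappa^-1 = 1)%E ->
  measurable_fun setT f -> measurable_fun setT g ->
  (forall t, 0 <= f t) -> (forall t, 0 <= g t) ->
  Lcontrol r f -> Lcontrol kappa g -> locsumm (fun t => f t * g t).
Proof.
move=> r1 k1 conj mf mg f0 g0 cf cg.
have mfg : measurable_fun setT (fun t => f t * g t) by exact: measurable_funM.
have lf := Lcontrol1 r1 mf f0 cf; have lg := Lcontrol1 k1 mg g0 cg.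
case: r r1 conj cf => [r| |//] r1 conj; last first.
  case=> C hC; apply: (locsumm_le_ae mfg (locsummZ C lg)).
  by apply: filterS hC => t hf t0; have fC := hf t0; rewrite ger0_norm ?mulr_ge0// ler_wpM2r.
case: kappa k1 conj cg => [q| |//] q1 conj; last first.
  case=> C hC _; apply: (locsumm_le_ae mfg (locsummZ C lf)).
  apply: filterS hC => t hf t0; have gC := hf t0; rewrite ger0_norm ?mulr_ge0// [leRHS]mulrC.
  by rewrite ler_wpM2l.
move=> /= cg cf; rewrite !lee_fin in r1 q1.
have r0 : 0 < r by exact: lt_le_trans r1.
have q0 : 0 < q by exact: lt_le_trans q1.
have c : r^-1 + q^-1 = 1.
  by move: conj; rewrite !inver !gt_eqF// -EFinD => -[].
apply: (locsumm_le_ae mfg (locsummD cf cg)); apply: nearW => t _.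
rewrite ger0_norm ?mulr_ge0// (le_trans (conjugate_powR _ _ r0 q0 c))//.
by rewrite lerD// ler_piMr ?powR_ge0// invf_le1.
Qed.

End TimeIntegrability.

(** * Hoelder bounds at almost every time *)

Section HolderMajorant.
Context {R : realType}.
Implicit Types (x y : vec R) (f : vec R -> vec R) (u : R -> vec R -> vec R).

(** Cutting off the times where nothing is known makes the components measurable
    on the whole space. *)
Definition slice u i (z : vec R * R) : R := \1_[set t : R | 0 < t] z.2 * coord3 (u z.2 z.1) i.

Lemma slice_pos u i x t : 0 < t -> slice u i (x, t) = coord3 (u t x) i.
Proof. by move=> t0; rewrite /slice indicE mem_set// mul1r. Qed.

Lemma measurable_coord3 i : measurable_fun setT (fun x : vec R => coord3 x i).
Proof.
have [->|->|->] := ord3P i; rewrite /coord3/=.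
- exact: (measurableT_comp measurable_fst measurable_fst).
- exact: (measurableT_comp measurable_snd measurable_fst).
- exact: measurable_snd.
Qed.

Lemma measurable_slice u i : torus_field u -> measurable_fun setT (slice u i).
Proof.
move=> [_ mu].
have mD : measurable ([set z | (0 < z.2)%R] : set (vec R * R)).
  rewrite (_ : [set _ | _] = snd @^-1` `]0%R, +oo[%classic).
    by rewrite -[X in measurable X]setTI; exact: measurable_snd.
  by apply/seteqP; split => z /=; rewrite in_itv/= andbT.
have -> : slice u i = (fun z => coord3 (u z.2 z.1) i) \_ [set z | (0 < z.2)%R].
  apply/funext => z; rewrite patchE /slice indicE.
  have [z0|z0] := ltP 0 z.2; first by rewrite !mem_set// mul1r.
  by rewrite !memNset/= ?mul0r// ltNge z0.
apply: ((measurable_restrictT (fun z => coord3 (u z.2 z.1) i) mD).1 _).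
exact: (measurableT_comp (measurable_coord3 i) mu).
Qed.

(** A pair of distinct points of the torus: without one the supremum in the
    Hoelder norm would be that of the empty set. *)
Lemma half_not_same : ~ same_point (0 : vec R) (2^-1, 0, 0).
Proof.
move=> [[[k0 k1] k2] []]/= h _ _.
case: k0 h => n h.
  by have := ler0n R n; move: h; rewrite -pmulrn; lra.
have n1 : 1 <= n.+1%:R :> R by rewrite ler1n.
by move: h; rewrite NegzE mulrNz -pmulrn; lra.
Qed.

Lemma holder_norm_ge (theta : R) f :
  (forall x, ((enorm (f x))%:E <= holder_norm theta f)%E) /\
  (forall x y, ~ same_point x y ->
    ((enorm (f x - f y) / tdist x y `^ theta)%:E <= holder_norm theta f)%E).
Proof.
have s1 x : ((enorm (f x))%:E <= ereal_sup [set (enorm (f x))%:E | x in setT])%E.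
  by apply: ereal_sup_ubound; exists x.
have s2 x y : ~ same_point x y -> ((enorm (f x - f y) / tdist x y `^ theta)%:E <=
   ereal_sup [set (enorm (f z.1 - f z.2) / tdist z.1 z.2 `^ theta)%R%:E
            | z in [set z | ~ same_point z.1 z.2]])%E.
  by move=> h; apply: ereal_sup_ubound; exists (x, y).
split=> [x|x y xy].
  rewrite /holder_norm -[leLHS]adde0 leeD//.
  apply: le_trans (s2 _ _ half_not_same).
  by rewrite lee_fin divr_ge0 ?enorm_ge0 ?powR_ge0.
rewrite /holder_norm -[leLHS]add0e leeD//; last exact: s2.
by apply: le_trans (s1 0); rewrite lee_fin enorm_ge0.
Qed.

Lemma sd_cvg (q p : nat -> vec R) x y :
  (forall i, coord3 (q n) i @[n --> \oo] --> coord3 x i) ->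
  (forall i, coord3 (p n) i @[n --> \oo] --> coord3 y i) ->
  sd (q n) (p n) @[n --> \oo] --> sd x y.
Proof.
move=> qx py.
have H : (fun n => \sum_(i < 3) sin (pi * (coord3 (q n) i - coord3 (p n) i)) ^+ 2) @ \oo
    --> \sum_(i < 3) sin (pi * (coord3 x i - coord3 y i)) ^+ 2; last first.
  exact: (cvg_comp _ _ H (@sqrt_continuous R _)).
apply: (@cvg_bigsum R _ _ (fun i n => sin (pi * (coord3 (q n) i - coord3 (p n) i)) ^+ 2)) => i.
under eq_fun do rewrite expr2; rewrite expr2.
have c : sin (pi * (coord3 (q n) i - coord3 (p n) i)) @[n --> \oo] -->
    sin (pi * (coord3 x i - coord3 y i)).
  have c0 : (fun n => pi * (coord3 (q n) i - coord3 (p n) i)) @ \oo -->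
      pi * (coord3 x i - coord3 y i) by apply: cvgM; [exact: cvg_cst|exact: cvgB].
  exact: (cvg_comp _ _ c0 (@continuous_sin R _)).
exact: cvgM.
Qed.

Lemma powR_cvg (a s : R) (q : nat -> R) : 0 < s -> q n @[n --> \oo] --> s ->
  q n `^ a @[n --> \oo] --> s `^ a.
Proof.
move=> s0 qs.
have d : derivable ((@powR R)^~ a) s 1 by apply: derivable_powR; rewrite in_itv/= s0.
have c : {for s, continuous ((@powR R)^~ a)}.
  by apply: differentiable_continuous; exact/derivable1_diffP.
exact: (cvg_comp _ _ qs c).
Qed.

Definition qpoint (k : rat * rat * rat) : vec R := (ratr k.1.1, ratr k.1.2, ratr k.2).

Lemma qpoint_approx x : exists q : nat -> rat * rat * rat,
  forall n i, `|coord3 (qpoint (q n)) i - coord3 x i| <= n.+1%:R^-1.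
Proof.
have H (t : R) n : exists q : rat, `|ratr q - t| <= n.+1%:R^-1.
  have [|q] := @rat_in_itvoo _ (t - n.+1%:R^-1) (t + n.+1%:R^-1).
    by rewrite ltrBlDr -addrA ltrDl addr_gt0 ?invr_gt0.
  rewrite in_itv/= => /andP[/ltW a /ltW b]; exists q.
  by rewrite ler_norml lerBrDr addrC a lerBlDl b.
have H3 n : exists q : rat * rat * rat, forall i, `|coord3 (qpoint q) i - coord3 x i| <= n.+1%:R^-1.
  have [a ha] := H x.1.1 n; have [b hb] := H x.1.2 n; have [c hc] := H x.2 n.
  by exists (a, b, c) => i; have [->|->|->] := ord3P i.
by exists (fun n => projT1 (cid (H3 n))) => n i; case: (cid _).
Qed.

(** The supremum over rational points is a countable one, hence measurable in
    time, and it is below the norm since lowering the exponent and replacing the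
    distance by [sd], both at most increasing the denominator, decrease the
    quotients.  When the norm is finite the field is continuous, so that the
    bounds extend from rational points to all points. *)
Lemma holder_majorant (theta th : R) u : 0 < th -> th <= theta -> torus_field u ->
  exists g : R -> R, [/\ measurable_fun setT g, forall t, 0 <= g t,
    (forall t, 0 < t -> ((g t)%:E <= holder_norm theta (u t))%E) &
    (forall t, 0 < t -> (holder_norm theta (u t) < +oo)%E ->
      (forall x i, `|coord3 (u t x) i| <= g t) /\
      (forall x y i, `|coord3 (u t x) i - coord3 (u t y) i| <= g t * sd x y `^ th))].
Proof.
move=> th0 thle hu; have [per _] := hu.
have theta0 : 0 < theta by exact: lt_le_trans thle.
pose phi (k : 'I_3 * (rat * rat * rat) * (rat * rat * rat)) (t : R) : R :=
  let: (i, p, q) := k in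
  Num.max `|slice u i (qpoint p, t)|
    (`|slice u i (qpoint p, t) - slice u i (qpoint q, t)| / sd (qpoint p) (qpoint q) `^ th).
pose f n t : \bar R := if unpickle n is Some k then (phi k t)%:E else 0%E.
have phi0 k t : 0 <= phi k t by case: k => [[i p] q]; rewrite /phi le_max normr_ge0.
have f0 n t : (0 <= f n t)%E by rewrite /f; case: (unpickle _) => // k; rewrite lee_fin.
have mphi k : measurable_fun setT (phi k).
  have ms i p : measurable_fun setT (fun t => slice u i (p, t)).
    exact: measurable_fun_pair2 (measurable_slice i hu).
  case: k => [[i p] q]; apply: measurable_maxr.
    exact: measurableT_comp (ms _ _).
  apply: measurable_funM; last exact: measurable_cst.
  by apply: measurableT_comp => //; exact: measurable_funB.
have mf n : measurable_fun setT (f n).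
  rewrite /f; case: (unpickle _) => [k|]; last exact: measurable_cst.
  exact/measurable_EFinP.
pose G t := esups (f^~ t) 0.
have fG n t : (f n t <= G t)%E by apply: ereal_sup_ubound; exists n.
have G0 t : (0 <= G t)%E := le_trans (f0 0%N t) (fG 0%N t).
have GN t : 0 < t -> (G t <= holder_norm theta (u t))%E.
  move=> t0; have [n1 n2] := holder_norm_ge theta (u t).
  have N0 : (0 <= holder_norm theta (u t))%E.
    by apply: le_trans (n1 0); rewrite lee_fin enorm_ge0.
  apply: ge_ereal_sup => _ [n _ <-]; rewrite /f; case: (unpickle _) => [[[i p] q]|//].
  rewrite /phi !slice_pos// EFin_max ge_max; apply/andP; split.
    by apply: le_trans (n1 (qpoint p)); rewrite lee_fin norm_coord3_le.
  have [[k hk]|pq] := pselect (same_point (qpoint p) (qpoint q)).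
    by rewrite hk per// subrr normr0 mul0r.
  apply: le_trans (n2 _ _ pq); rewrite lee_fin -coord3B ler_pM ?invr_ge0 ?powR_ge0//.
    exact: norm_coord3_le.
  have sp : 0 < sd (qpoint p) (qpoint q).
    by rewrite lt_def sd_ge0 andbT; apply/eqP => /sd0_same_point.
  have tp : 0 < tdist (qpoint p) (qpoint q).
    by rewrite lt_def tdist_ge0 andbT; apply/eqP => /tdist0_sd0/sd0_same_point.
  rewrite lef_pV2 ?posrE ?powR_gt0//.
  apply: (@le_trans _ _ (tdist (qpoint p) (qpoint q) `^ th)).
    by apply: ger_powR => //; rewrite tp tdist_le1.
  by apply: ge0_ler_powR; rewrite ?nnegrE ?tdist_ge0 ?sd_ge0 ?tdist_le_sd// ltW.
exists (fun t => fine (G t)); split.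
- apply: (measurableT_comp (fine_measurable measurableT)).
  exact: measurable_fun_esups.
- by move=> t; rewrite fine_ge0.
- move=> t t0; apply: le_trans (GN t t0).
  by move: (G0 t); case: (G t) => [r| |]//= _; rewrite leey.
move=> t t0 Noo.
have Gfin : G t \is a fin_num by rewrite ge0_fin_numE// (le_lt_trans (GN t t0)).
have phiG k : phi k t <= fine (G t).
  by rewrite -lee_fin fineK//; have := fG (pickle k) t; rewrite /f pickleK.
have [n1 n2] := holder_norm_ge theta (u t).
have Nfin : holder_norm theta (u t) \is a fin_num.
  by rewrite ge0_fin_numE//; apply: le_trans (n1 0); rewrite lee_fin enorm_ge0.
pose C := fine (holder_norm theta (u t)).
have C0 : 0 <= C by rewrite fine_ge0//; apply: le_trans (n1 0); rewrite lee_fin enorm_ge0.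
have hol x y i : `|coord3 (u t x) i - coord3 (u t y) i| <= C * tdist x y `^ theta.
  have [[k hk]|xy] := pselect (same_point x y).
    by rewrite hk per// subrr normr0 mulr_ge0// powR_ge0.
  have tp : 0 < tdist x y.
    by rewrite lt_def tdist_ge0 andbT; apply/eqP => /tdist0_sd0/sd0_same_point.
  have := n2 x y xy; rewrite -(fineK Nfin) lee_fin ler_pdivrMr ?powR_gt0//.
  by apply: le_trans; rewrite -coord3B norm_coord3_le.
have approx x (q : nat -> rat * rat * rat) :
    (forall n i, `|coord3 (qpoint (q n)) i - coord3 x i| <= n.+1%:R^-1) ->
    (forall i, coord3 (qpoint (q n)) i @[n --> \oo] --> coord3 x i) /\
    (forall i, coord3 (u t (qpoint (q n))) i @[n --> \oo] --> coord3 (u t x) i).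
  move=> hq; have squeeze (a : nat -> R) l (b : nat -> R) : b n @[n --> \oo] --> 0 ->
      (forall n, `|a n - l| <= b n) -> a n @[n --> \oo] --> l.
    move=> b0 ab; apply/subr_cvg0/norm_cvg0P.
    apply: (squeeze_cvgr _ (cvg_cst 0) b0).
    by apply: nearW => n; rewrite normr_ge0 ab.
  have inv0 : (fun n => n.+1%:R^-1 : R) @ \oo --> 0 by exact: cvg_harmonic.
  split=> i; first by apply: (squeeze _ _ _ inv0) => n; exact: hq.
  apply: (@squeeze _ _ (fun n => C * (2 * n.+1%:R^-1) `^ theta)).
    rewrite -(mulr0 C); apply: cvgM; first exact: cvg_cst.
    suff c2 : 2 * (n.+1%:R : R)^-1 @[n --> \oo] --> (0 : R)^'+.
      exact: (cvg_comp _ _ c2 (powR_cvg0 theta0)).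
    move=> A [e /= e0 hA].
    suff : \forall n \near \oo, A (2 * (n.+1%:R : R)^-1) by [].
    near=> n; apply: hA => /=; last by rewrite mulr_gt0 ?invr_gt0.
    rewrite sub0r normrN gtr0_norm ?mulr_gt0 ?invr_gt0// mulrC -ltr_pdivlMr//.
    near: n; exact: (near_infty_natSinv_lt (PosNum (divr_gt0 e0 (@ltr0n _ 2)))).
  move=> n; rewrite (le_trans (hol _ _ _))// ler_wpM2l//.
  apply: ge0_ler_powR; rewrite ?nnegrE ?tdist_ge0 ?mulr_ge0//; first exact: ltW.
  have := tdist_le (qpoint (q n)) x (0, 0, 0).
  rewrite (_ : zvec _ = 0) ?addr0; last by [].
  move=> h; apply: (le_trans h); apply: enorm_le_coord => j.
  by rewrite coord3B hq.
split=> [x i|x y i].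
  have [q hq] := qpoint_approx x; have [_ cu] := approx x q hq.
  apply: (ler_cvg_to (cvg_norm (cu i)) (cvg_cst _)); apply: nearW => n.
  have := phiG (i, q n, q n); rewrite /phi slice_pos// ge_max => /andP[].
  by [].
have [s0|s0] := eqVneq (sd x y) 0.
  have [k hk] := sd0_same_point s0.
  by rewrite hk per// subrr normr0 mulr_ge0// ?powR_ge0// fine_ge0.
have sp : 0 < sd x y by rewrite lt_def s0 sd_ge0.
have [q hq] := qpoint_approx x; have [cq cu] := approx x q hq.
have [p hp] := qpoint_approx y; have [cp cv] := approx y p hp.
have cs := sd_cvg cq cp.
have c1 : (fun n => `|coord3 (u t (qpoint (q n))) i - coord3 (u t (qpoint (p n))) i|)
    @ \oo --> `|coord3 (u t x) i - coord3 (u t y) i|.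
  by apply: cvg_norm; exact: cvgB.
have c2 : (fun n => fine (G t) * sd (qpoint (q n)) (qpoint (p n)) `^ th) @ \oo -->
    fine (G t) * sd x y `^ th.
  by apply: cvgM; [exact: cvg_cst|exact: powR_cvg].
apply: (ler_cvg_to c1 c2).
near=> n.
have spn : 0 < sd (qpoint (q n)) (qpoint (p n)).
  near: n; exact: (cvgr_gt _ cs).
have := phiG (i, q n, p n); rewrite /phi !slice_pos// ge_max => /andP[_].
by rewrite ler_pdivrMr// powR_gt0.
Unshelve. all: by end_near. Qed.

End HolderMajorant.

(** * Sobolev bounds at almost every time *)

Section SobolevMajorant.
Context {R : realType}.
Implicit Types (x y : vec R) (w : R -> vec R -> vec R).
Local Notation mu2 := (@torus R \x @torus R)%E.
Local Notation sl w t := (fun i x => slice w i (x, t)).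

Lemma measurable_sl w i t : torus_field w -> measurable_fun setT (sl w t i).
Proof. by move=> hw; exact: measurable_fun_pair1 (measurable_slice i hw). Qed.

Lemma measurable_wquot_joint (al : R) w : torus_field w ->
  measurable_fun setT (fun z : (vec R * vec R) * R => wquot al (sl w z.2) z.1).
Proof.
move=> hw; apply: measurable_funM.
  apply: measurable_sum => i; apply: measurableT_comp => //; apply: measurable_funB.
    apply: (measurableT_comp (measurable_slice i hw)).
    apply: measurable_fun_pair; last exact: measurable_snd.
    exact: (measurableT_comp measurable_fst measurable_fst).
  apply: (measurableT_comp (measurable_slice i hw)).
  apply: measurable_fun_pair; last exact: measurable_snd.
  exact: (measurableT_comp measurable_snd measurable_fst).
under [fun _ => _]funext => z do rewrite -powRN.
apply: (measurableT_comp (measurable_powR (- (3 + al)))).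
exact: (measurableT_comp (@measurable_sd R) measurable_fst).
Qed.

Lemma sum_coord3_le x : (\sum_i `|coord3 x i|) / 3 <= enorm x.
Proof.
rewrite ler_pdivrMr// sum3E.
have := norm_coord3_le x 0; have := norm_coord3_le x 1; have := norm_coord3_le x 2; lra.
Qed.

(** Here measurability comes from Tonelli's theorem.  Comparison with the norm
    uses monotonicity of the lower integral, and that [sd] dominates the
    distance; the factor 3 compares the sum of the components with the Euclidean
    norm. *)
Lemma sobolev_majorant (al : R) w : 0 < al -> torus_field w ->
  exists n : R -> R, [/\ measurable_fun setT n, forall t, 0 <= n t,
    (forall t, 0 < t -> ((n t)%:E <= sobolev_norm al (w t))%E) &
    (forall t, 0 < t -> (sobolev_norm al (w t) < +oo)%E ->
      [/\ forall i, summ torus (sl w t i),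
         forall i, Rintegral torus setT (fun x => `|sl w t i x|) <= 3 * n t,
         summ mu2 (wquot al (sl w t)) &
         Rintegral mu2 setT (wquot al (sl w t)) <= 3 * n t])].
Proof.
move=> al0 hw.
pose A (z : vec R * R) : \bar R := ((\sum_i `|slice w i z|) / 3)%:E.
pose Q (z : (vec R * vec R) * R) : \bar R := (wquot al (sl w z.2) z.1 / 3)%:E.
have A0 z : (0 <= A z)%E by rewrite lee_fin divr_ge0// sumr_ge0.
have Q0 z : (0 <= Q z)%E by rewrite lee_fin divr_ge0// wquot_ge0.
have mA : measurable_fun setT A.
  apply: measurableT_comp => //; apply: measurable_funM => //.
  by apply: measurable_sum => i; apply: measurableT_comp => //; exact: measurable_slice.
have mQ : measurable_fun setT Q.
  apply: measurableT_comp => //; apply: measurable_funM => //.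
  exact: measurable_wquot_joint.
pose nA (t : R) : \bar R := (\int[torus]_x A (x, t))%E.
pose nQ (t : R) : \bar R := (\int[sfprod torus torus]_z Q (z, t))%E.
have mnA : measurable_fun setT nA by exact: (measurable_fun_fubini_tonelli_G (m1 := @torus R) A mA A0).
have mnQ : measurable_fun setT nQ by exact: (measurable_fun_fubini_tonelli_G (m1 := sfprod (@torus R) (@torus R)) Q mQ Q0).
have nA0 t : (0 <= nA t)%E by apply: integral_ge0.
have nQ0 t : (0 <= nQ t)%E by apply: integral_ge0.
have nle t : 0 < t -> (nA t + nQ t <= sobolev_norm al (w t))%E.
  move=> t0; apply: leeD.
    have mAt : measurable_fun setT (fun x => A (x, t)) by exact: measurable_fun_pair1.
    rewrite /nA -integral_torus//; apply: ge0_le_lower_integral => // x _.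
    rewrite lee_fin; under eq_bigr do rewrite slice_pos//.
    exact: sum_coord3_le.
  have mQt : measurable_fun setT (fun z => Q (z, t)) by exact: measurable_fun_pair1.
  rewrite /nQ (@fubini_tonelli1 _ _ _ _ _ torus torus _ mQt)//.
  rewrite -integral_torus; last exact: measurable_fun_fubini_tonelli_F.
  apply: ge0_le_lower_integral => [x _|x _]; first exact: integral_ge0.
  rewrite /fubini_F -integral_torus; last exact: measurable_fun_pair2 mQt.
  apply: ge0_le_lower_integral => [//|y _]; rewrite lee_fin /wquot/=.
  under eq_bigr do rewrite !slice_pos// -coord3B.
  rewrite mulrAC.
  have [s0|s0] := eqVneq (sd x y) 0.
    rewrite s0 powR0 ?invr0 ?mulr0 ?divr_ge0 ?powR_ge0 ?enorm_ge0//.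
    by rewrite gt_eqF// addr_gt0.
  have sp : 0 < sd x y by rewrite lt_def s0 sd_ge0.
  have tp : 0 < tdist x y.
    by rewrite lt_def tdist_ge0 andbT; apply: contra_neq s0 => /tdist0_sd0.
  apply: ler_pM; rewrite ?divr_ge0 ?sumr_ge0 ?invr_ge0 ?powR_ge0//.
    exact: sum_coord3_le.
  rewrite [al + 3]addrC lef_pV2 ?posrE ?powR_gt0//.
  apply: ge0_ler_powR; rewrite ?nnegrE ?tdist_ge0 ?sd_ge0 ?tdist_le_sd//.
  by rewrite addr_ge0// ltW.
exists (fun t => fine (nA t + nQ t)%E); split.
- by apply: (measurableT_comp (fine_measurable measurableT)); exact: emeasurable_funD.
- by move=> t; rewrite fine_ge0// adde_ge0.
- move=> t t0; apply: le_trans (nle t t0).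
  have : (0 <= nA t + nQ t)%E by rewrite adde_ge0.
  by case: (nA t + nQ t)%E => [r| |]//= _; rewrite leey.
move=> t t0 Noo.
have noo := le_lt_trans (nle t t0) Noo.
have fin : (nA t + nQ t)%E \is a fin_num by rewrite ge0_fin_numE// adde_ge0.
have [finA finQ] : nA t \is a fin_num /\ nQ t \is a fin_num.
  by move: fin; rewrite fin_numD => /andP[].
have fA0 : 0 <= fine (nA t) by rewrite fine_ge0.
have fQ0 : 0 <= fine (nQ t) by rewrite fine_ge0.
rewrite fineD//.
have sS : summ torus (fun x => (\sum_i `|sl w t i x|) / 3).
  apply/integrableP; split.
    by have := measurable_fun_pair1 t mA.
  apply: (@le_lt_trans _ _ (nA t)); last by rewrite ltey_eq finA.
  apply: ge0_le_lower_integral => x _; first exact: abse_ge0.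
  by rewrite /= ger0_norm// divr_ge0// sumr_ge0.
have sQ : summ (sfprod torus torus) (fun z => wquot al (sl w t) z / 3).
  apply/integrableP; split.
    by have := measurable_fun_pair1 t mQ.
  apply: (@le_lt_trans _ _ (nQ t)); last by rewrite ltey_eq finQ.
  apply: ge0_le_lower_integral => x _; first exact: abse_ge0.
  by rewrite /= ger0_norm// divr_ge0// wquot_ge0.
have E1 : fine (nA t) = Rintegral torus setT (fun x => (\sum_i `|sl w t i x|) / 3) by [].
have E2 : fine (nQ t) = Rintegral (sfprod torus torus) setT
    (fun z => wquot al (sl w t) z / 3) by [].
have sumle i x : `|sl w t i x| <= \sum_i `|sl w t i x|.
  by rewrite (bigD1 i)//= lerDl sumr_ge0.
have s3 : summ torus (fun x => \sum_i `|sl w t i x|).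
  have -> : (fun x => \sum_i `|sl w t i x|) = (fun x => 3 * ((\sum_i `|sl w t i x|) / 3)).
    by apply/funext => x; field.
  exact: summZ.
have sw i : summ torus (sl w t i).
  apply: (summ_le _ (sumle i) s3); exact: measurable_sl.
have sq : summ (sfprod torus torus) (wquot al (sl w t)).
  have -> : wquot al (sl w t) = (fun z => 3 * (wquot al (sl w t) z / 3)).
    by apply/funext => x; field.
  exact: summZ.
split=> // [i|].
  apply: (@le_trans _ _ (3 * fine (nA t))); last by rewrite ler_pM2l// lerDl.
  rewrite E1 -IZ//; apply: le_I; [exact: summ_norm|exact: summZ|move=> x].
  rewrite mulrCA divff// mulr1; exact: sumle.
apply: (@le_trans _ _ (3 * fine (nQ t))); last by rewrite ler_pM2l// lerDr.
rewrite E2 -IZ// le_eqVlt; apply/orP; left; apply/eqP.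
apply: eq_I => z; by field.
Qed.

End SobolevMajorant.

(** * Fubini in space and time *)

Section FubiniSections.
Context d1 d2 (T1 : measurableType d1) (T2 : measurableType d2) {R : realType}.
Variable m1 : {sigma_finite_measure set T1 -> \bar R}.
Variable m2 : {sigma_finite_measure set T2 -> \bar R}.
Variable f : T1 * T2 -> R.
Hypothesis sf : summ (m1 \x m2)%E f.

Lemma summ_section : summ m2 (fun y => Rintegral m1 setT (fun x => f (x, y))).
Proof.
have mf := summ_meas sf.
have mef : measurable_fun setT (EFin \o f) by exact/measurable_EFinP.
apply/integrableP; split.
  apply/measurable_EFinP; apply: (measurableT_comp (fine_measurable measurableT)).
  exact: (measurable_fubini_G sf).
apply: le_lt_trans ((integrable21ltyP _ _ mef).1 sf).
apply: ge0_le_lower_integral => [y _|y _]; first exact: abse_ge0.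
have my : measurable_fun setT (fun x => (f (x, y))%:E).
  exact: measurable_fun_pair1 mef.
apply: le_trans (le_abse_integral m1 measurableT my).
rewrite /Rintegral /=; case: (\int[m1]_x _)%E => [r| |] //=; rewrite ?normr0; exact: leey.
Qed.

Lemma I_section : Rintegral (m1 \x m2)%E setT f =
  Rintegral m2 setT (fun y => Rintegral m1 setT (fun x => f (x, y))).
Proof.
rewrite [LHS]/Rintegral -integral21_prod_meas1//; apply: (f_equal fine).
have := summ_meas summ_section => ms.
apply: ae_eq_integral => //.
- exact: (measurable_fubini_G sf).
- exact/measurable_EFinP.
have := ae_integrable2 sf; apply: filterS => y iy _.
by rewrite /Rintegral fineK//; exact: (integrable_fin_num measurableT iy).
Qed.

End FubiniSections.

Section Pairing.
Context {R : realType}.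
Implicit Types (h F G : vec R * R -> R).
Local Notation st := (@torus R \x @time R)%E.

Let cell4 : set (vec R * R) := cell `*` setT.

Let mcell4 : measurable cell4.
Proof. exact: measurableX (@measurable_cell R) measurableT. Qed.

Definition cell4_measure (A : set (vec R * R)) : \bar R := leb4 (A `&` cell4).

Let restr4 := @mrestr _ _ _ _ (@leb4 R) mcell4.

Let cell4_0 : cell4_measure set0 = 0%E.
Proof. exact: (@measure0 _ _ _ restr4). Qed.

Let cell4_ge0 A : (0 <= cell4_measure A)%E.
Proof. exact: (@measure_ge0 _ _ _ restr4). Qed.

Let cell4_sigma_additive : semi_sigma_additive cell4_measure.
Proof. exact: (@measure_semi_sigma_additive _ _ _ restr4). Qed.

HB.instance Definition _ := isMeasure.Build _ (vec R * R)%type R cell4_measure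
  cell4_0 cell4_ge0 cell4_sigma_additive.

Lemma spacetimeE (A : set (vec R * R)) : measurable A -> st A = leb4 (A `&` cell4).
Proof.
move=> mA; apply: (@product_measure_unique _ _ _ _ _ torus time
  cell4_measure) => // B C mB mC.
rewrite /= /cell4_measure -setXI /leb4 /= {1}/sfprod product_measure1E//.
- by rewrite (torusE mB) setIT.
- by apply: measurableI => //; exact: measurable_cell.
- exact: measurableI.
Qed.

Lemma integral_spacetime (f : vec R * R -> \bar R) : measurable_fun setT f ->
  (\int[leb4]_(x in cell4) f x = \int[st]_x f x)%E.
Proof.
move=> mf.
have Hid : measurable_fun setT (idfun : _ -> (vec R * R)%type) by exact: measurable_id.
have E1 := @integral_restr _ _ _ leb4 restr4 cell4 f mcell4 (fun A _ => erefl) mf.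
have E2 := @integral_transport _ _ _ (vec R * R)%type R restr4 idfun Hid f mf.
apply: (etrans E1); apply: (etrans E2).
apply: eq_measure_integral => A mA _; symmetry; exact: spacetimeE.
Qed.

(** Integrals over space-time become integrals for the product of the measure of
    the torus and that of time. *)
Lemma pairingE F G : measurable_fun setT F -> (forall z, z.2 <= 0 -> F z = 0) ->
  (forall z, cell z.1 -> 0 < z.2 -> G z = F z) ->
  pairing G = Rintegral st setT F.
Proof.
move=> mF F0 GF; apply: (f_equal fine); rewrite -integral_spacetime; last first.
  by apply: measurableT_comp.
rewrite [LHS]integral_mkcond [RHS]integral_mkcond; congr (integral _ _ _).
apply/funext => z; rewrite !patchE.
have [z0|z0] := leP z.2 0.
  rewrite (memNset (A := spacetime)); last by move=> [_]; rewrite ltNge z0.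
  by case: ifP => // _; rewrite F0.
have [cz|cz] := pselect (cell z.1).
  by rewrite !mem_set//= GF.
by rewrite !memNset//; move=> [].
Qed.

Definition slabsumm h := forall k, summ st (fun z => \1_(slab k) z.2 * h z).

Lemma measurable_slab2 k : measurable_fun setT (fun z : vec R * R => \1_(slab k) z.2 : R).
Proof.
by apply: measurableT_comp; [apply: measurable_indic; exact: measurable_itv|exact: measurable_snd].
Qed.

Lemma slabsumm_le h (B : R -> R) : measurable_fun setT h -> locsumm B ->
  {ae (@time R), forall t, 0 < t -> (\int[torus]_x `|(h (x, t))%:E| <= (B t)%:E)%E} ->
  slabsumm h.
Proof.
move=> mh sB hB k.
have mf : measurable_fun setT (EFin \o (fun z => \1_(slab k) z.2 * h z)).
  by apply/measurable_EFinP; apply: measurable_funM => //; exact: measurable_slab2.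
apply/(integrable21ltyP _ _ mf).
have mn : measurable_fun setT (fun z => `|(\1_(slab k) z.2 * h z)%:E|%E).
  exact: measurableT_comp.
have sb := summ_norm (sB k).
apply: (@le_lt_trans _ _ (\int[time]_t (`|\1_(slab k) t * B t|)%:E)%E); last first.
  by rewrite I_EFin// ltry.
apply: ae_ge0_le_integral => //.
- by move=> t _; exact: integral_ge0.
- exact: (measurable_fun_fubini_tonelli_G (m1 := @torus R)
    (fun z => `|(\1_(slab k) z.2 * h z)%:E|%E) mn (fun z => abse_ge0 _)).
- by apply/measurable_EFinP; exact: summ_meas sb.
apply: (filterS _ hB) => t ht _ /=; rewrite !indicE.
have [|_] := boolP (t \in _); last first.
  by under eq_integral do rewrite mul0r normr0; rewrite integral0 lee_fin.
rewrite inE /slab/= in_itv/= => /andP[kt _]; have t0 : 0 < t by exact: lt_le_trans kt.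
under eq_integral do rewrite mul1r; rewrite mul1r (le_trans (ht t0))// lee_fin ler_norm.
Unshelve. all: by []. Qed.

Lemma I_scale_indic (D : set R) (t : R) (p : vec R -> R) :
  Rintegral torus setT (fun x => \1_D t * p x) = \1_D t * Rintegral torus setT p.
Proof.
rewrite indicE; case: (_ \in _); last by under eq_I do rewrite mul0r; rewrite I0 mul0r.
by under eq_I do rewrite mul1r; rewrite mul1r.
Qed.

Lemma slabsummM h (E : vec R -> R) (M : R) : slabsumm h -> measurable_fun setT E ->
  (forall x, `|E x| <= M) -> slabsumm (fun z => h z * E z.1).
Proof.
move=> sh mE EM k.
have mE1 : measurable_fun setT (fun z : vec R * R => E z.1).
  by apply: measurableT_comp => //; exact: measurable_fst.
have := @summM_bounded _ _ _ st _ (fun z => E z.1) M (sh k) mE1 (fun z => EM z.1).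
have -> // : (fun z : vec R * R => \1_(slab k) z.2 * h z * E z.1) =
  (fun z => \1_(slab k) z.2 * (h z * E z.1)).
by apply/funext => z; rewrite mulrA.
Qed.

Lemma locsumm_section h : slabsumm h ->
  locsumm (fun t => Rintegral torus setT (fun x => h (x, t))).
Proof.
move=> sh k; have := summ_section (sh k).
by under eq_fun do rewrite I_scale_indic.
Qed.

Lemma ttest_slab (chi : R -> R) : ttest chi ->
  exists k, forall t, chi t != 0 -> slab k t.
Proof.
move=> [_ [a [b [a0 ab hc]]]]; have [k hk] := slab_itv b a0.
by exists k => t /hc/hk.
Qed.

Lemma ttest_bounded (chi : R -> R) : ttest chi -> exists M, forall t, `|chi t| <= M.
Proof.
move=> [sc [a [b [a0 ab hc]]]].
have cg : {within `[a, b], continuous (fun x => `|chi x|)}.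
  apply/continuous_subspaceT => x; apply: continuous_comp.
    exact: smooth1_continuous.
  exact: norm_continuous.
have [c _ hM] := EVT_max (ltW ab) cg; exists `|chi c| => t.
have [->|/hc ht] := eqVneq (chi t) 0; first by rewrite normr0.
by apply: hM; rewrite in_itv.
Qed.

(** Fubini; for the exceptional times at which a slice of [h] is not integrable
    the inner integrals mean nothing, but they form a null set. *)
Lemma summ_slab_test h (chi : R -> R) : slabsumm h -> ttest chi ->
  summ st (fun z => h z * chi z.2) /\
  Rintegral st setT (fun z => h z * chi z.2) =
  Rintegral time setT (fun t => Rintegral torus setT (fun x => h (x, t)) * chi t).
Proof.
move=> sh tc; have [k hk] := ttest_slab tc; have [M hM] := ttest_bounded tc.
have mc : measurable_fun setT chi by case: tc => sc _; exact: smooth1_measurable.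
have E t : chi t = \1_(slab k) t * chi t.
  have [->|/hk ht] := eqVneq (chi t) 0; first by rewrite mulr0.
  by rewrite indicE mem_set ?mul1r.
have E1 : (fun z => h z * chi z.2) = (fun z : vec R * R => \1_(slab k) z.2 * h z * chi z.2).
  by apply/funext => z; rewrite {1}E; ring.
have s1 : summ st (fun z => h z * chi z.2).
  rewrite E1; apply: (@summM_bounded _ _ _ st _ (fun z => chi z.2) M (sh k)) => //.
  by apply: measurableT_comp => //; exact: measurable_snd.
have E2 t : Rintegral torus setT (fun x => h (x, t)) * chi t =
    \1_(slab k) t * Rintegral torus setT (fun x => h (x, t)) * chi t.
  by rewrite {1}E; ring.
split=> //; rewrite I_section//; apply: eq_I_ae.
- exact: summ_meas (summ_section s1).
- under [fun _ => _]funext => t do rewrite E2.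
  by apply: measurable_funM => //; exact: summ_meas (locsumm_section sh k).
have := ae_integrable2 (sh k); apply: filterS => t it.
rewrite E2 -I_scale_indic mulrC -IZ//; apply: eq_I => x /=.
by rewrite {1}E; ring.
Qed.

End Pairing.

(** * Algebra of the mollified helicity *)

Section SpectralAlgebra.
Context {R : realType}.
Variable N : nat.
Local Notation I f := (Rintegral (@torus R) setT f).
Implicit Types (f h : vec R -> R) (u w : 'I_3 -> vec R -> R) (q : 'I_3 -> 'I_3 -> vec R -> R).

(** The relation [w = curl u], tested against the functions in the expansion of
    the kernel. *)
Definition curl_moments u w := forall (J : Idx N) l,
  moment J (w l) = dmoment J (l + 2) (u (l + 1)) - dmoment J (l + 1) (u (l + 2)).

Let S b f h := \sum_(J : Idx N) coef J * (moment J f * dmoment J b h).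

Let S_anti b f h : summ torus f -> summ torus h -> S b f h = - S b h f.
Proof.
move=> sf sh; have E p k : summ torus k -> S b p k = I (fun x => k x * PS N [:: b] p x).
  by move=> sk; rewrite I_mul_PS//; apply: eq_bigr => J _; rewrite [moment _ _ * _]mulrC.
by rewrite !E// I_mul_PS1_anti.
Qed.

Let ord3_1 : (1 + 1 : 'I_3) = 2. Proof. exact: val_inj. Qed.
Let ord3_2 : (1 + 2 : 'I_3) = 0. Proof. exact: val_inj. Qed.
Let ord3_3 : (2 + 1 : 'I_3) = 0. Proof. exact: val_inj. Qed.
Let ord3_4 : (2 + 2 : 'I_3) = 1. Proof. exact: val_inj. Qed.
Let ord3E := (@add0r 'I_3, ord3_1, ord3_2, ord3_3, ord3_4).

(** The curl is a symmetric operator that commutes with mollification: each of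
    its two terms is antisymmetric, and exchanging them is a cyclic permutation
    of the coordinates. *)
Lemma hel_sym u w u' w' : (forall i, summ torus (u i)) -> (forall i, summ torus (u' i)) ->
  curl_moments u w -> curl_moments u' w' -> hel u w' N = hel u' w N.
Proof.
move=> su su' cu cu'.
have H v v' z : curl_moments v' z -> hel v z N =
    \sum_i (S (i + 2) (v i) (v' (i + 1)) - S (i + 1) (v i) (v' (i + 2))).
  move=> c; under eq_bigr do rewrite -sumrB; rewrite exchange_big/=.
  apply: eq_bigr => J _; rewrite mulr_sumr; apply: eq_bigr => i _; rewrite c; ring.
rewrite (H _ _ _ cu') (H _ _ _ cu) !sum3E !ord3E.
rewrite (S_anti 2 (su 0) (su' 1)) (S_anti 1 (su 0) (su' 2)) (S_anti 0 (su 1) (su' 2)).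
rewrite (S_anti 2 (su 1) (su' 0)) (S_anti 1 (su 2) (su' 0)) (S_anti 0 (su 2) (su' 1)).
move: (S 2 _ _) (S 1 _ _) (S 0 _ _) (S 2 _ _) (S 1 _ _) (S 0 _ _) => *; ring.
Qed.

Definition dE (J : Idx N) s : vec R -> R := prodf (foldr dere (ebs J) s).

(** The stress tensor paired with the gradient of [E_J], and with that of the
    curl of [E_J]. *)
Definition stressT q (J : Idx N) l := \sum_j I (fun x => q l j x * dE J [:: j] x).

Definition stressG q (J : Idx N) l := \sum_j
  (I (fun x => q (l + 1) j x * dE J [:: j; l + 2] x) -
   I (fun x => q (l + 2) j x * dE J [:: j; l + 1] x)).

Lemma I_mul_PS_dmoment s b f h : summ torus f -> summ torus h ->
  \sum_(J : Idx N) coef J * (dmoment J b h * I (fun x => f x * dE J s x)) =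
  - I (fun x => f x * PS N (rcons s b) h x).
Proof.
move=> sf sh.
have [_ <-] := @summ_I_sum_kernel R (Idx N) (@coef R N) (fun J => dmoment J b h)
  (fun J => dE J s) f (fun J => moment_summ J s sf).
have sp : summ torus (fun x => f x * PS N (rcons s b) h x) by exact: summM_PS.
rewrite -mulN1r -IZ//; apply: eq_I => x; rewrite mulrCA mulN1r -(PS_dmoment _ _ _ _ sh) mulrC.
by congr (_ * _); apply: eq_bigr => J _; rewrite [dmoment _ _ _ * _]mulrC.
Qed.

(** The symmetry of the curl once more, with one factor at one time and the stress
    tensor at another. *)
Lemma stress_duality u w q : (forall i, summ torus (u i)) -> (forall i j, summ torus (q i j)) ->
  curl_moments u w ->
  \sum_(J : Idx N) \sum_l coef J * (moment J (u l) * stressG q J l) =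
  \sum_(J : Idx N) \sum_l coef J * (moment J (w l) * stressT q J l).
Proof.
move=> su sq cu.
pose P i j c d := I (fun x => q i j x * PS N [:: j; c] (u d) x).
have L : \sum_(J : Idx N) \sum_l coef J * (moment J (u l) * stressG q J l) =
    \sum_l \sum_j (P (l + 1) j (l + 2) l - P (l + 2) j (l + 1) l).
  rewrite exchange_big/=; apply: eq_bigr => l _.
  transitivity (\sum_(J : Idx N) \sum_j
    (coef J * (I (fun x => q (l + 1) j x * dE J [:: j; l + 2] x) * moment J (u l)) -
     coef J * (I (fun x => q (l + 2) j x * dE J [:: j; l + 1] x) * moment J (u l)))).
    apply: eq_bigr => J _; rewrite /stressG !mulr_sumr; apply: eq_bigr => j _; ring.
  rewrite exchange_big/=; apply: eq_bigr => j _.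
  by rewrite sumrB /P !I_mul_PS.
have Rr : \sum_(J : Idx N) \sum_l coef J * (moment J (w l) * stressT q J l) =
    \sum_l \sum_j (P l j (l + 1) (l + 2) - P l j (l + 2) (l + 1)).
  rewrite exchange_big/=; apply: eq_bigr => l _.
  transitivity (\sum_(J : Idx N) \sum_j
    (coef J * (dmoment J (l + 2) (u (l + 1)) * I (fun x => q l j x * dE J [:: j] x)) -
     coef J * (dmoment J (l + 1) (u (l + 2)) * I (fun x => q l j x * dE J [:: j] x)))).
    apply: eq_bigr => J _; rewrite /stressT cu !mulr_sumr; apply: eq_bigr => j _; ring.
  rewrite exchange_big/=; apply: eq_bigr => j _.
  by rewrite sumrB !I_mul_PS_dmoment// /P opprK addrC.
rewrite L Rr; clearbody P => {L Rr}.
rewrite !(@sum3E R).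
rewrite !ord3E.
ring.
Qed.

Lemma stress_flux u w : (forall i j, summ torus (fun x => u i x * u j x)) ->
  \sum_(J : Idx N) \sum_l coef J * (moment J (w l) * stressT (fun i j x => u i x * u j x) J l) =
  flux u w N.
Proof.
move=> sq.
rewrite exchange_big/= /flux; symmetry.
have s l j : summ torus (fun x => u l x * u j x * PS N [:: j] (w l) x) by exact: summM_PS.
rewrite Isum; last by move=> l; exact: summ_sum.
apply: eq_bigr => l _; rewrite Isum//.
transitivity (\sum_j \sum_(J : Idx N)
    coef J * (I (fun x => u l x * u j x * dE J [:: j] x) * moment J (w l))).
  by apply: eq_bigr => j _; rewrite I_mul_PS.
rewrite exchange_big/=; apply: eq_bigr => J _.
rewrite /stressT !mulr_sumr; apply: eq_bigr => j _; ring.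
Qed.

End SpectralAlgebra.

(** * The equations at almost every time *)

Section ProductTests.
Context {R : realType}.
Implicit Types (f chi : R -> R).

Lemma ttest_derive chi : ttest chi -> ttest (derive1 chi).
Proof.
move=> [sc [a [b [a0 ab hc]]]]; split; first exact: smooth1_derive.
exists a, b; split => // t; apply: contraR => h.
have z : is_derive t 1 (fun=> 0 : R) 0 by exact: is_derive_cst.
have out s : ~~ (a <= s <= b) -> chi s = 0.
  by move=> hs; apply/eqP; apply: contraNT hs => /hc.
apply/eqP; move: h; rewrite negb_and -!ltNge => /orP[ta|bt].
  have d : is_derive t 1 chi 0.
    apply: near_eq_is_derive z; near=> x; rewrite out//.
    by rewrite negb_and -!ltNge; apply/orP; left; near: x; exact: lt_nbhsl.
  by rewrite derive1E; exact: derive_val.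
have d : is_derive t 1 chi 0.
  apply: near_eq_is_derive z; near=> x; rewrite out//.
  by rewrite negb_and -!ltNge; apply/orP; right; near: x; exact: lt_nbhsr.
by rewrite derive1E; exact: derive_val.
Unshelve. all: by end_near. Qed.

Lemma ttestN chi : ttest chi -> ttest (fun t => -1 * chi t).
Proof.
move=> [sc [a [b [a0 ab hc]]]]; split.
  by apply: smooth1M => //; exact: smooth1_cst.
by exists a, b; split => // t; rewrite mulN1r oppr_eq0; exact: hc.
Qed.

Lemma summ_test f chi : locsumm f -> ttest chi -> summ time (fun t => f t * chi t).
Proof.
move=> sf tc; have [k hk] := ttest_slab tc; have [M hM] := ttest_bounded tc.
have mc : measurable_fun setT chi by case: tc => sc _; exact: smooth1_measurable.
have -> : (fun t => f t * chi t) = (fun t => \1_(slab k) t * f t * chi t).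
  apply/funext => t; have [->|/hk ht] := eqVneq (chi t) 0; first by rewrite !mulr0.
  by rewrite indicE mem_set ?mul1r.
exact: (summM_bounded (sf k) mc hM).
Qed.

Lemma ttest_neg chi t : ttest chi -> t <= 0 -> chi t = 0.
Proof.
move=> [_ [a [b [a0 _ hc]]]] t0; apply/eqP; apply: contraLR t0 => /hc/andP[at_ _].
by rewrite -ltNge; exact: lt_le_trans at_.
Qed.

(** Testing with a sum of products [h(x, t) c(t)] leaves an identity between
    functions of time alone. *)
Lemma pairing_slab (K : Type) (q : seq K) (h : K -> vec R * R -> R) (c : K -> R -> R)
    (G : vec R * R -> R) :
  (forall m, slabsumm (h m)) -> (forall m, ttest (c m)) ->
  (forall z, cell z.1 -> 0 < z.2 -> G z = \sum_(m <- q) h m z * c m z.2) ->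
  pairing G = \sum_(m <- q)
    Rintegral time setT (fun t => Rintegral torus setT (fun x => h m (x, t)) * c m t).
Proof.
move=> sh tc hG.
have s m : summ (@torus R \x @time R)%E (fun z => h m z * c m z.2).
  exact: (summ_slab_test (sh m) (tc m)).1.
rewrite (@pairingE _ (fun z => \sum_(m <- q) h m z * c m z.2))//.
- by rewrite Isum//; apply: eq_bigr => m _; exact: (summ_slab_test (sh m) (tc m)).2.
- exact: summ_meas (summ_sum _ s).
- by move=> z z0; rewrite big1// => m _; rewrite (ttest_neg (tc m) z0) mulr0.
Qed.

Lemma ae_forallc (K : countType) (P : K -> R -> Prop) :
  (forall k, {ae (@time R), forall t, P k t}) -> {ae (@time R), forall t, forall k, P k t}.
Proof.
move=> h.
have : {ae (@time R), forall t, forall m, if unpickle m is Some k then P k t else True}.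
  apply: ae_foralln => m; case: (unpickle m) => [k|]; first exact: h.
  exact: nearW.
by apply: filterS => t ht k; have := ht (pickle k); rewrite pickleK.
Qed.

Lemma test_function_spectral N (J : Idx N) s chi : ttest chi ->
  test_function (stprod chi (foldr dere (ebs J) s)).
Proof.
move=> [sc [a [b [a0 ab hc]]]]; apply: (test_function_stprod a0 ab hc sc).
  exact: smooth3_foldr.
exact: periodic3_foldr.
Qed.

Lemma cancel_pressure (a1 b1 a2 b2 c : R) : a1 + b1 + c = 0 -> a2 + b2 + c = 0 ->
  a1 - a2 = - (b1 - b2).
Proof. lra. Qed.

Lemma curl_cancel (a b : R) : - (a + - b) - (b - a) = 0.
Proof. lra. Qed.

End ProductTests.

Section Dynamics.
Context {R : realType}.
Variables (u w : R -> vec R -> vec R) (g n : R -> R).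
Hypotheses (hu : torus_field u) (hw : torus_field w).
Hypotheses (lg : locsumm g) (lg2 : locsumm (fun t => g t ^+ 2)) (ln : locsumm n).
Hypothesis bu : {ae (@time R), forall t, 0 < t -> forall x i, `|slice u i (x, t)| <= g t}.
Hypothesis bw : {ae (@time R), forall t, 0 < t -> forall i, summ torus (fun x => slice w i (x, t)) /\
  Rintegral torus setT (fun x => `|slice w i (x, t)|) <= 3 * n t}.
Hypothesis euler : euler_weak_solution u.
Hypothesis curl : is_curl u w.

Local Notation sl u t := (fun i x => slice u i (x, t)).
Local Notation I f := (Rintegral (@torus R) setT f).
Local Notation It f := (Rintegral (@time R) setT f).

Let slabsummE N (J : Idx N) s (h : vec R * R -> R) : slabsumm h -> slabsumm (fun z => h z * dE J s z.1).
Proof.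
move=> sh; have [M hM] := TP_bounded (@TP_foldr R N J s).
have mE : measurable_fun setT (dE J s) := TP_measurable (@TP_foldr R N J s).
exact: (@slabsummM _ h (dE J s) M sh mE hM).
Qed.

Let integral_le_cst (f : vec R -> R) (c : R) : measurable_fun setT f ->
  (forall x, `|f x| <= c) -> (\int[torus]_x `|(f x)%:E| <= c%:E)%E.
Proof.
move=> mf fc; have sf : summ torus f by exact: summ_torus_bounded mf fc.
have -> : (\int[torus]_x `|(f x)%:E| = (I (fun x => `|f x|))%:E)%E.
  by rewrite -I_EFin//; exact: summ_norm.
rewrite lee_fin -[leRHS](@I_torus_cst R c); apply: le_I => //; first exact: summ_norm.
by apply: (@summ_torus_bounded _ _ `|c|).
Qed.

Lemma slabsumm_velocity i : slabsumm (slice u i).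
Proof.
apply: (slabsumm_le (measurable_slice i hu) lg).
apply: filterS bu => t ht t0; apply: integral_le_cst; last by move=> x; exact: ht.
exact: measurable_sl.
Qed.

Lemma slabsumm_stress i j : slabsumm (fun z => slice u i z * slice u j z).
Proof.
have m k := measurable_slice k hu.
apply: (slabsumm_le (measurable_funM (m i) (m j)) lg2).
apply: filterS bu => t ht t0; apply: integral_le_cst.
  by apply: measurable_funM; exact: measurable_sl.
by move=> x; rewrite normrM expr2 ler_pM// ht.
Qed.

Lemma slabsumm_vorticity i : slabsumm (slice w i).
Proof.
apply: (slabsumm_le (measurable_slice i hw) (locsummZ 3 ln)).
apply: filterS bw => t ht t0; have [s b] := ht t0 i.
by rewrite -lee_fin -I_EFin in b; last exact: summ_norm.
Qed.

Definition stress t i j (x : vec R) : R := slice u i (x, t) * slice u j (x, t).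

Definition vmoment N (J : Idx N) l t : R :=
  dmoment J (l + 2) (sl u t (l + 1)) - dmoment J (l + 1) (sl u t (l + 2)).

Let mU i N (J : Idx N) s t := I (fun x => slice u i (x, t) * dE J s x).
Let mq i j N (J : Idx N) s t := I (fun x => slice u i (x, t) * slice u j (x, t) * dE J s x).

Lemma locsumm_mU i N (J : Idx N) s : locsumm (mU i J s).
Proof. exact: locsumm_section (slabsummE J s (slabsumm_velocity i)). Qed.

Lemma locsumm_mq i j N (J : Idx N) s : locsumm (mq i j J s).
Proof. exact: locsumm_section (slabsummE J s (slabsumm_stress i j)). Qed.

Lemma locsumm_moment i N (J : Idx N) : locsumm (fun t => moment J (sl w t i)).
Proof. exact: locsumm_section (slabsummE J [::] (slabsumm_vorticity i)). Qed.

Let locsummB (a b : R -> R) : locsumm a -> locsumm b -> locsumm (fun t => a t - b t).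
Proof.
move=> sa sb; have := locsummD sa (locsummZ (-1) sb).
by under eq_fun do rewrite mulN1r.
Qed.

Lemma locsumm_vmoment N (J : Idx N) l : locsumm (vmoment J l).
Proof. exact: locsummB (locsumm_mU (l + 1) J [:: l + 2]) (locsumm_mU (l + 2) J [:: l + 1]). Qed.

Lemma locsumm_stressG N (J : Idx N) l : locsumm (fun t => stressG (stress t) J l).
Proof. by apply: locsumm_sum => j; apply: locsummB; exact: locsumm_mq. Qed.

Lemma locsumm_stressT N (J : Idx N) l : locsumm (fun t => stressT (stress t) J l).
Proof. by apply: locsumm_sum => j; exact: locsumm_mq. Qed.

(** Testing with a product and integrating in space first turns the momentum
    equation into an identity between functions of time; the pressure is only
    kept as an unknown number. *)
Lemma euler_product p : (forall phi (i : 'I_3), test_function phi ->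
    pairing (fun z => coord3 (u z.2 z.1) i * partial None phi z +
      \sum_j coord3 (u z.2 z.1) i * coord3 (u z.2 z.1) j * partial (Some j) phi z)
    + p (partial (Some i) phi) = 0) ->
  forall i N (J : Idx N) s chi, ttest chi ->
  It (fun t => mU i J s t * derive1 chi t) +
    \sum_j It (fun t => mq i j J (j :: s) t * chi t) +
    p (stprod chi (foldr dere (ebs J) (i :: s))) = 0.
Proof.
move=> hp i N J s chi tc; have [sc _] := tc.
have se := smooth3_foldr J s.
have := hp _ i (test_function_spectral J s tc).
rewrite partial_space_stprod// => hpair; rewrite -[RHS]hpair; congr (_ + _).
(* the term with the time derivative, then one for each space derivative *)
pose q : seq (option 'I_3) := None :: map Some (index_enum 'I_3).
pose h (m : option 'I_3) (z : vec R * R) : R := if m is Some j then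
  slice u i z * slice u j z * dE J (j :: s) z.1 else slice u i z * dE J s z.1.
pose c (m : option 'I_3) : R -> R := if m is Some j then chi else derive1 chi.
rewrite (@pairing_slab _ _ q h c).
- by rewrite big_cons big_map.
- move=> [j|]; first exact: slabsummE (slabsumm_stress i j).
  exact: slabsummE (slabsumm_velocity i).
- by move=> [j|]; [exact: tc|exact: ttest_derive].
move=> [x t] _ /= t0; rewrite big_cons big_map partial_time_stprod// /h /c !slice_pos//.
rewrite /stprod/=; congr (_ + _); first by rewrite /dE; ring.
by apply: eq_bigr => j _; rewrite partial_space_stprod// slice_pos// /stprod/= /dE/=; ring.
Qed.

(** The two momentum equations are tested with the two mixed derivatives of the
    same function, so the pressure terms are equal and cancel. *)
Lemma vmoment_weak N (J : Idx N) l chi : ttest chi ->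
  It (fun t => vmoment J l t * derive1 chi t) =
  - It (fun t => stressG (stress t) J l * chi t).
Proof.
move=> tc; have [[p [_ hp]] _] := euler.
have e1 := euler_product hp (l + 1) J [:: l + 2] tc.
have e2 := euler_product hp (l + 2) J [:: l + 1] tc.
have tc' := ttest_derive tc.
rewrite /= (dereC (l + 1) (l + 2)) in e1; rewrite /= in e2.
have E1 : It (fun t => vmoment J l t * derive1 chi t) =
   It (fun t => mU (l + 1) J [:: l + 2] t * derive1 chi t) -
   It (fun t => mU (l + 2) J [:: l + 1] t * derive1 chi t).
  rewrite -IB; [|exact: summ_test (locsumm_mU _ _ _) tc'..].
  by apply: eq_I => t; rewrite -mulrBl.
have E2 : It (fun t => stressG (stress t) J l * chi t) =
   \sum_j It (fun t => mq (l + 1) j J [:: j; l + 2] t * chi t) -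
   \sum_j It (fun t => mq (l + 2) j J [:: j; l + 1] t * chi t).
  rewrite -sumrB; under [RHS]eq_bigr => j _.
    rewrite -IB; [|exact: summ_test (locsumm_mq _ _ _ _) tc..]; over.
  rewrite -Isum; last first.
    by move=> j; apply: summB; exact: summ_test (locsumm_mq _ _ _ _) tc.
  by apply: eq_I => t; rewrite mulr_suml; apply: eq_bigr => j _; rewrite -mulrBl.
by rewrite E1 E2; apply: cancel_pressure; [exact: e1|exact: e2].
Qed.

Lemma vorticity_weak N (J : Idx N) l chi : ttest chi ->
  It (fun t => (moment J (sl w t l) - vmoment J l t) * chi t) = 0.
Proof.
move=> tc; have [sc _] := tc; have se := smooth3_ebs J.
have := curl l (test_function_spectral J [::] tc).
rewrite (@pairing_slab _ _ [:: tt] (fun _ z => slice w l z * dE J [::] z.1) (fun=> chi))//.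
- rewrite (@pairing_slab _ _ [:: true; false] (fun b z => if b then
    slice u (l + 2) z * dE J [:: l + 1] z.1 else slice u (l + 1) z * dE J [:: l + 2] z.1)
    (fun b => if b then chi else fun t => -1 * chi t)).
  + rewrite big_seq1 big_cons big_seq1 => h.
    have sm := summ_test (locsumm_moment l J) tc.
    have s1 := summ_test (locsumm_mU (l + 2) J [:: l + 1]) tc.
    have s2 := summ_test (locsumm_mU (l + 1) J [:: l + 2]) tc.
    have hm : It (fun t => (moment J (sl w t l) - vmoment J l t) * chi t) =
      It (fun t => moment J (sl w t l) * chi t) -
      (It (fun t => mU (l + 1) J [:: l + 2] t * chi t) -
       It (fun t => mU (l + 2) J [:: l + 1] t * chi t)).
      have e := etrans (IB sm (summB s2 s1)) (congr1 (fun y => _ - y) (IB s2 s1)).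
      apply: etrans e; apply: eq_I => t; rewrite -!mulrBl; reflexivity.
    have h2 : It (fun t => mU (l + 1) J [:: l + 2] t * (-1 * chi t)) =
        - It (fun t => mU (l + 1) J [:: l + 2] t * chi t).
      apply: etrans (etrans (IZ (-1) s2) (mulN1r _)).
      by apply: eq_I => t; rewrite mulrCA.
    rewrite hm (etrans h (congr1 (fun a => - (_ + a)) h2)).
    exact: curl_cancel.
  + move=> [|]; exact: slabsummE (slabsumm_velocity _).
  + by move=> [|]; [exact: tc|exact: ttestN].
  move=> [x t] _ /= t0; rewrite !big_cons big_nil !slice_pos// !partial_space_stprod//.
  by rewrite /stprod/= /dE/=; ring.
- by move=> _; exact: slabsummE (slabsumm_vorticity _).
move=> [x t] _ /= t0; rewrite big_cons big_nil slice_pos// /stprod/= /dE/=; ring.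
Qed.

Lemma divergence_weak N (J : Idx N) chi : ttest chi ->
  It (fun t => (\sum_j dmoment J j (sl u t j)) * chi t) = 0.
Proof.
move=> tc; have [sc _] := tc; have se := smooth3_ebs J.
have [_ hd] := euler; have := hd _ (test_function_spectral J [::] tc).
rewrite (@pairing_slab _ _ (index_enum 'I_3) (fun j z => slice u j z * dE J [:: j] z.1)
  (fun=> chi))//.
- move=> h; rewrite -[RHS]h -Isum; last first.
    by move=> j; exact: summ_test (locsumm_mU _ _ _) tc.
  by apply: eq_I => t; rewrite mulr_suml.
- by move=> j; exact: slabsummE (slabsumm_velocity _).
move=> [x t] _ /= t0; apply: eq_bigr => j _; rewrite slice_pos// partial_space_stprod//.
by rewrite /stprod/= /dE/=; ring.
Qed.

(** For a countable family of test functions the equations hold off a single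
    null set of times. *)
Definition good_time t := [/\ forall N, curl_moments N (sl u t) (sl w t),
  forall N (J : Idx N), \sum_j dmoment J j (sl u t j) = 0 &
  forall N (J : Idx N) l, lpt (vmoment J l) t].

Lemma ae_good_time : {ae (@time R), forall t, 0 < t -> good_time t}.
Proof.
have a1 : {ae (@time R), forall t, forall (N : nat) (k : Idx N * 'I_3), 0 < t ->
    moment k.1 (sl w t k.2) = vmoment k.1 k.2 t}.
  apply: ae_foralln => N; apply: ae_forallc => -[J l] /=.
  have sd := locsummB (locsumm_moment l J) (locsumm_vmoment J l).
  apply: filterS (ae_lpt sd) => t ht t0; apply/eqP; rewrite -subr_eq0; apply/eqP.
  exact: (fundamental_lemma sd (fun chi => @vorticity_weak N J l chi) t0 ht).
have a2 : {ae (@time R), forall t, forall (N : nat) (J : Idx N), 0 < t ->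
    \sum_j dmoment J j (sl u t j) = 0}.
  apply: ae_foralln => N; apply: ae_forallc => J.
  have sd : locsumm (fun t => \sum_j dmoment J j (sl u t j)).
    by apply: locsumm_sum => j; exact: (locsumm_mU j J [:: j]).
  apply: filterS (ae_lpt sd) => t ht t0.
  exact: (fundamental_lemma sd (fun chi => @divergence_weak N J chi) t0 ht).
have a3 : {ae (@time R), forall t, forall (N : nat) (k : Idx N * 'I_3),
    lpt (vmoment k.1 k.2) t}.
  apply: ae_foralln => N; apply: ae_forallc => -[J l].
  exact/ae_lpt/locsumm_vmoment.
apply: (filterS3 _ _ a1 a2 a3) => t h1 h2 h3 t0; split=> N.
- by move=> J l; exact: (h1 N (J, l) t0).
- by move=> J; exact: h2.
- by move=> J l; exact: (h3 N (J, l)).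
Qed.

Lemma moment_evolution N (J : Idx N) l s t : 0 < s -> s < t -> good_time s -> good_time t ->
  moment J (sl w t l) - moment J (sl w s l) = tint s t (fun x => stressG (stress x) J l).
Proof.
move=> s0 st [cs _ ls] [ct _ lt]; rewrite cs ct.
exact: (du_bois_reymond (locsumm_vmoment J l) (locsumm_stressG J l)
  (fun chi => @vmoment_weak N J l chi) s0 st (ls N J l) (lt N J l)).
Qed.

End Dynamics.

(** * Conservation of helicity *)

Section AeDominated.
Context {R : realType}.
Implicit Types (f g h : R -> R).

(** Measurability of the product is needed on each slab only, where it follows
    from that of the factors. *)
Lemma locsumm_mul_le f g h : locsumm f -> locsumm g -> locsumm h ->
  {ae (@time R), forall t, 0 < t -> `|f t * g t| <= h t} -> locsumm (fun t => f t * g t).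
Proof.
move=> sf sg sh fgh k; have slab0 t : slab k t -> 0 < t.
  by rewrite /slab/= in_itv/= => /andP[kt _]; apply: lt_le_trans kt.
apply: (@summ_le_ae _ _ _ _ _ (fun t => `|\1_(slab k) t * h t|)) => //.
- have -> : (fun t => \1_(slab k) t * (f t * g t)) =
      (fun t => (\1_(slab k) t * f t) * (\1_(slab k) t * g t)).
    by apply/funext => t; rewrite indicE; case: (_ \in _); rewrite ?mul1r ?mul0r.
  by apply: measurable_funM; [exact: summ_meas (sf k)|exact: summ_meas (sg k)].
- apply: filterS fgh => t ht; rewrite [leLHS]normrM [leRHS]normrM.
  rewrite indicE; have [|_] := boolP (t \in _); last by rewrite normr0 !mul0r.
  by rewrite inE => /slab0/ht ft; rewrite ler_wpM2l// (le_trans ft)// ler_norm.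
- exact: summ_norm.
Qed.

Lemma dominated_I0_ae (f_ : nat -> R -> R) h :
  (forall n, measurable_fun setT (f_ n)) -> summ time h ->
  {ae (@time R), forall t, f_ n t @[n --> \oo] --> 0} ->
  {ae (@time R), forall t, forall n, `|f_ n t| <= h t} ->
  Rintegral time setT (f_ n) @[n --> \oo] --> (0 : R).
Proof.
move=> mf sh c d.
have [] := @dominated_convergence _ _ _ time setT measurableT (fun n => EFin \o f_ n)
    (EFin \o (fun=> 0)) (EFin \o h).
- by move=> n; exact/measurable_EFinP.
- exact/measurable_EFinP.
- apply: filterS c => t ct _; apply: cvg_EFin; [exact: nearW|exact: ct].
- exact: sh.
- by apply: filterS d => t dt n _; rewrite /= lee_fin.
move=> s0 _ cf; rewrite -(@I0 _ _ R time); apply: fine_cvg; rewrite fineK//.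
exact: (integrable_fin_num measurableT s0).
Qed.

End AeDominated.

Section Conservation.
Context {R : realType}.
Variables (al : R) (u w : R -> vec R -> vec R) (g n : R -> R).
Hypothesis hal : 0 < al < 1.
Hypotheses (hu : torus_field u) (hw : torus_field w).
Hypothesis g0 : forall t, 0 <= g t.
Hypotheses (lg : locsumm g) (lg2 : locsumm (fun t => g t ^+ 2)) (ln : locsumm n).
Hypothesis lg2n : locsumm (fun t => g t ^+ 2 * n t).
Local Notation sl u t := (fun i x => slice u i (x, t)).
Local Notation I f := (Rintegral (@torus R) setT f).
Local Notation mu2 := (@torus R \x @torus R)%E.

Definition regular_time t := [/\
  forall x i, `|slice u i (x, t)| <= g t,
  forall x y i, `|slice u i (x, t) - slice u i (y, t)| <= g t * sd x y `^ ((1 - al) / 2),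
  forall i, summ torus (sl w t i) /\ I (fun x => `|slice w i (x, t)|) <= 3 * n t,
  summ mu2 (wquot al (sl w t)) &
  Rintegral mu2 setT (wquot al (sl w t)) <= 3 * n t].

Hypothesis hreg : {ae (@time R), forall t, 0 < t -> regular_time t}.
Hypothesis euler : euler_weak_solution u.
Hypothesis curl : is_curl u w.

Definition typical_time t := [/\ 0 < t, regular_time t & good_time u w t].

Lemma ae_typical_time : {ae (@time R), forall t, 0 < t -> typical_time t}.
Proof.
have b1 : {ae (@time R), forall t, 0 < t -> forall x i, `|slice u i (x, t)| <= g t}.
  by apply: filterS hreg => t ht t0; have [] := ht t0.
have b2 : {ae (@time R), forall t, 0 < t -> forall i, summ torus (fun x => slice w i (x, t)) /\
    I (fun x => `|slice w i (x, t)|) <= 3 * n t}.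
  by apply: filterS hreg => t ht t0; have [] := ht t0.
have := ae_good_time hu hw lg ln b1 b2 euler curl => h.
apply: (filterS2 _ _ hreg h) => t h1 h2 t0; split=> //; [exact: h1|exact: h2].
Qed.

Let su t : typical_time t -> forall i, summ torus (sl u t i).
Proof.
by move=> [_ [b _ _ _ _] _] i; apply: (@summ_torus_bounded _ _ (g t)) => [|x];
  [exact: measurable_sl|exact: b].
Qed.

Let sstress t : typical_time t -> forall i j, summ torus (stress u t i j).
Proof.
move=> [_ [b _ _ _ _] _] i j; apply: (@summ_torus_bounded _ _ (g t * g t)) => [|x].
  by apply: measurable_funM; exact: measurable_sl.
by rewrite normrM ler_pM// b.
Qed.

Lemma flux_typical_le N t : typical_time t ->
  `|flux (sl u t) (sl w t) N| <= 18 * @Kbound R * (g t ^+ 2 * n t).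
Proof.
move=> [t0 [b h s q qn] [c d _]].
have wper i x y : sd x y = 0 -> sl w t i x = sl w t i y.
  by move=> /sd0_same_point[k ->]; rewrite !slice_pos//; have [per _] := hw; rewrite per.
have := flux_le hal (fun i => measurable_sl i t hu) (fun i x => b x i) (fun i x y => h x y i)
  (fun i => (s i).1) wper q c d N.
move=> fl; apply: (le_trans fl).
have -> : 18 * @Kbound R * (g t ^+ 2 * n t) = 6 * @Kbound R * (g t ^+ 2 * (3 * n t)) by ring.
by rewrite ler_wpM2l ?mulr_ge0 ?Kbound_ge0// ler_wpM2l// exprn_ge0.
Qed.

Lemma flux_typical_cvg t : typical_time t ->
  flux (sl u t) (sl w t) N @[N --> \oo] --> 0.
Proof.
move=> [t0 [b h s q qn] [c d _]].
have wper i x y : sd x y = 0 -> sl w t i x = sl w t i y.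
  by move=> /sd0_same_point[k ->]; rewrite !slice_pos//; have [per _] := hw; rewrite per.
exact: (flux_cvg0 hal (fun i => measurable_sl i t hu) (fun i x => b x i)
  (fun i x y => h x y i) (fun i => (s i).1) wper q c d).
Qed.

Lemma hel_typical_cvg t : typical_time t ->
  hel (sl u t) (sl w t) N @[N --> \oo] --> I (fun x => \sum_i slice u i (x, t) * slice w i (x, t)).
Proof.
move=> [t0 [b h s q qn] _].
exact: (hel_cvg hal (fun i => measurable_sl i t hu) (fun i x => b x i)
  (fun i x y => h x y i) (fun i => (s i).1)).
Qed.

Section FixedResolution.
Variable N : nat.
Let K : finType := (Idx N * 'I_3)%type.
Let U (k : K) t := moment k.1 (sl u t k.2).
Let W (k : K) t := moment k.1 (sl w t k.2).
Let T (k : K) t := coef k.1 * stressT (stress u t) k.1 k.2.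
Let G (k : K) t := stressG (stress u t) k.1 k.2.
Let F t := hel (sl u t) (sl w t) N.

Let helE s t : hel (sl u s) (sl w t) N = \sum_(k : K) coef k.1 * U k s * W k t.
Proof.
rewrite /hel; under eq_bigr do rewrite mulr_sumr.
by rewrite pair_big/=; apply: eq_bigr => k _; rewrite mulrA.
Qed.

Let duality t x : typical_time t -> typical_time x ->
  \sum_(k : K) coef k.1 * U k t * G k x = \sum_(k : K) W k t * T k x.
Proof.
move=> ht hx; have [_ _ [c _ _]] := ht.
have := stress_duality (su ht) (sstress hx) (c N).
rewrite !pair_big/= => h.
transitivity (\sum_(k : K) coef k.1 * (moment k.1 (sl u t k.2) * stressG (stress u x) k.1 k.2)).
  by apply: eq_bigr => k _; rewrite -mulrA.
by rewrite h; apply: eq_bigr => k _; rewrite mulrCA.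
Qed.

Let fluxE x : typical_time x -> \sum_(k : K) W k x * T k x = flux (sl u x) (sl w x) N.
Proof.
move=> hx; rewrite -(stress_flux N (sl w x) (sstress hx)) pair_big/=.
by apply: eq_bigr => k _; rewrite mulrCA.
Qed.

Let sT k : locsumm (T k).
Proof.
apply: locsummZ; have b1 : {ae (@time R), forall t, 0 < t -> forall x i, `|slice u i (x, t)| <= g t}.
  by apply: filterS hreg => t ht t0; have [] := ht t0.
exact: locsumm_stressT.
Qed.

Let sG k : locsumm (G k).
Proof.
have b1 : {ae (@time R), forall t, 0 < t -> forall x i, `|slice u i (x, t)| <= g t}.
  by apply: filterS hreg => t ht t0; have [] := ht t0.
exact: locsumm_stressG.
Qed.

Let sW k : locsumm (W k).
Proof.
have b2 : {ae (@time R), forall t, 0 < t -> forall i, summ torus (fun x => slice w i (x, t)) /\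
    I (fun x => `|slice w i (x, t)|) <= 3 * n t}.
  by apply: filterS hreg => t ht t0; have [] := ht t0.
exact: (locsumm_moment hw ln b2 k.2 k.1).
Qed.

Let sWT k : locsumm (fun x => W k x * T k x).
Proof.
have [M hM] := TP_bounded (@TP_foldr R N k.1 [::]).
have hMj (j : 'I_3) := TP_bounded (@TP_foldr R N k.1 [:: j]).
pose Mj j := projT1 (cid (hMj j)).
have hj j x : `|dE k.1 [:: j] x| <= Mj j by rewrite /Mj; case: (cid (hMj j)) => M1 h1; exact: h1.
have M0 : 0 <= M := le_trans (normr_ge0 _) (hM 0).
pose C := M * 3 * (`|coef k.1| * \sum_j Mj j).
apply: (locsumm_mul_le (sW k) (sT k) (locsummZ C lg2n)).
apply: filterS ae_typical_time => t ht t0; have tt := ht t0; have [_ [b _ s _ _] _] := tt.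
have [si ni] := s k.2.
have bW : `|W k t| <= M * (3 * n t).
  apply: (@le_trans _ _ (M * I (fun x => `|slice w k.2 (x, t)|))); last by rewrite ler_wpM2l.
  rewrite -IZ; last exact: summ_norm.
  apply: (@norm_I_le _ _ _ _ (fun x => slice w k.2 (x, t) * prodf (ebs k.1) x)).
  - exact: (moment_summ k.1 [::] si).
  - exact/summZ/summ_norm.
  move=> x.
  by rewrite normrM mulrC ler_wpM2r//; exact: hM.
have bT : `|T k t| <= `|coef k.1| * (\sum_j Mj j) * g t ^+ 2.
  rewrite normrM -mulrA ler_wpM2l// mulr_suml (le_trans (ler_norm_sum _ _ _))//.
  apply: ler_sum => j _; rewrite -[leRHS]I_torus_cst; apply: norm_I_le.
  - exact: (moment_summ k.1 [:: j] (sstress tt _ _)).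
  - by apply: (@summ_torus_bounded _ _ `|Mj j * g t ^+ 2|).
  move=> x; rewrite normrM [leLHS]mulrC; apply: ler_pM => //.
  by rewrite normrM expr2 ler_pM// b.
have -> : C * (g t ^+ 2 * n t) = M * (3 * n t) * (`|coef k.1| * (\sum_j Mj j) * g t ^+ 2).
  by rewrite /C; ring.
by rewrite normrM ler_pM.
Qed.

Let evolution k s t : 0 < s -> s < t -> typical_time s -> typical_time t ->
  W k t - W k s = tint s t (G k).
Proof.
move=> s0 st [_ _ gs] [_ _ gt].
have b1 : {ae (@time R), forall t, 0 < t -> forall x i, `|slice u i (x, t)| <= g t}.
  by apply: filterS hreg => x hx x0; have [] := hx x0.
exact: (moment_evolution hu lg lg2 b1 euler).
Qed.

(** The cross terms cancel by [hel_sym], which lets all the differences fall on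
    [W]; duality then moves the derivative back to the stress. *)
Let increments s t : 0 < s -> s < t -> typical_time s -> typical_time t ->
  F t - F s = \sum_k tint s t (T k) * (W k t + W k s).
Proof.
move=> s0 st ts tt; have [_ _ [cs _ _]] := ts; have [_ _ [ct _ _]] := tt.
have sym := hel_sym (su tt) (su ts) (ct N) (cs N).
transitivity (\sum_k coef k.1 * (U k t + U k s) * (W k t - W k s)).
  transitivity (hel (sl u t) (sl w t) N - hel (sl u t) (sl w s) N +
      (hel (sl u s) (sl w t) N - hel (sl u s) (sl w s) N)).
    by rewrite sym /F addrA subrK.
  rewrite !helE -!sumrB -big_split/=; apply: eq_bigr => k _; ring.
under eq_bigr => k _ do rewrite evolution// -tintZ//.
rewrite -tint_sum//; last by move=> k; exact: locsummZ.
transitivity (tint s t (fun x => \sum_k (W k t + W k s) * T k x)); last first.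
  rewrite tint_sum//; last by move=> k; exact: locsummZ.
  by apply: eq_bigr => k _; rewrite tintZ// mulrC.
apply: eq_I_ae.
- by apply: summ_meas (summ_tint t _ s0); apply: locsumm_sum => k; exact: locsummZ.
- by apply: summ_meas (summ_tint t _ s0); apply: locsumm_sum => k; exact: locsummZ.
apply: filterS ae_typical_time => x hx.
rewrite indicE; have [|_] := boolP (x \in _); last by rewrite !mul0r.
rewrite inE/= in_itv/= => /andP[sx _]; have {}hx := hx (lt_trans s0 sx).
congr (_ * _).
transitivity (\sum_k coef k.1 * U k t * G k x + \sum_k coef k.1 * U k s * G k x).
  by rewrite -big_split; apply: eq_bigr => k _; rewrite mulrDr mulrDl.
by rewrite !duality// -big_split; apply: eq_bigr => k _; rewrite mulrDl.
Qed.

Lemma hel_increment s t : 0 < s -> s < t -> typical_time s -> typical_time t ->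
  hel (sl u t) (sl w t) N - hel (sl u s) (sl w s) N =
  2 * tint s t (fun x => \sum_(k : K) W k x * T k x).
Proof.
exact: (partition_lemma ae_typical_time sT sG sWT evolution increments).
Qed.

(** The flux is measurable in time only through a representative that agrees with
    it at typical times. *)
Lemma flux_density s t : 0 < s -> exists f : R -> R,
  [/\ measurable_fun setT f,
    {ae (@time R), forall x, f x = \1_(`]s, t] : set R) x * flux (sl u x) (sl w x) N} &
    s < t -> typical_time s -> typical_time t ->
    hel (sl u t) (sl w t) N - hel (sl u s) (sl w s) N = 2 * Rintegral time setT f].
Proof.
move=> s0; exists (fun x => \1_(`]s, t] : set R) x * \sum_(k : K) W k x * T k x); split.
- by apply: summ_meas (summ_tint t _ s0); exact: locsumm_sum.
- apply: filterS ae_typical_time => x hx.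
  rewrite indicE; have [|_] := boolP (x \in _); last by rewrite !mul0r.
  rewrite inE/= in_itv/= => /andP[sx _]; have {}hx := hx (lt_trans s0 sx).
  by rewrite fluxE.
exact: hel_increment.
Qed.

End FixedResolution.

Lemma helicity_conserved s t : 0 < s -> s < t -> typical_time s -> typical_time t ->
  I (fun x => \sum_i slice u i (x, t) * slice w i (x, t)) =
  I (fun x => \sum_i slice u i (x, s) * slice w i (x, s)).
Proof.
move=> s0 st ts tt.
have [f hf] := choice (fun N => flux_density N t s0).
have lim : Rintegral time setT (f N) @[N --> \oo] --> (0 : R).
  have sh : summ time (fun x => \1_(`]s, t] : set R) x * (18 * @Kbound R * (g x ^+ 2 * n x))).
    by apply: summ_tint => //; exact: locsummZ.
  have ev : {ae (@time R), forall x, forall N, f N x =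
      \1_(`]s, t] : set R) x * flux (sl u x) (sl w x) N}.
    by apply: ae_foralln => N; have [] := hf N.
  apply: (dominated_I0_ae _ sh) => [N| |]; first by have [] := hf N.
    apply: (filterS2 _ _ ev ae_typical_time) => x fx hx.
    under eq_fun do rewrite fx.
    rewrite indicE; have [|_] := boolP (x \in _); last first.
      by under eq_fun do rewrite mul0r; exact: cvg_cst.
    rewrite inE/= in_itv/= => /andP[sx _]; have {}hx := hx (lt_trans s0 sx).
    by under eq_fun do rewrite mul1r; exact: flux_typical_cvg.
  apply: (filterS2 _ _ ev ae_typical_time) => x fx hx N; rewrite fx normrM.
  rewrite indicE; have [|_] := boolP (x \in _); last by rewrite normr0 !mul0r.
  rewrite inE/= in_itv/= => /andP[sx _]; have {}hx := hx (lt_trans s0 sx).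
  by rewrite normr1 !mul1r flux_typical_le.
have d : (fun N => hel (sl u t) (sl w t) N - hel (sl u s) (sl w s) N) @ \oo -->
    I (fun x => \sum_i slice u i (x, t) * slice w i (x, t)) -
    I (fun x => \sum_i slice u i (x, s) * slice w i (x, s)).
  by apply: cvgB; exact: hel_typical_cvg.
have e : (fun N => hel (sl u t) (sl w t) N - hel (sl u s) (sl w s) N) @ \oo --> (0 : R).
  rewrite (_ : (fun _ => _) = (fun N => 2 * Rintegral time setT (f N))); last first.
    by apply/funext => N; have [_ _ h] := hf N; exact: h.
  by rewrite -(mulr0 2); apply: cvgM => //; exact: cvg_cst.
by apply/eqP; rewrite -subr_eq0; apply/eqP; apply: (cvg_unique _ d e).
Qed.

End Conservation.

Lemma helicity_slices (R : realType) (u w : R -> vec R -> vec R) (t : R) :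
  torus_field u -> torus_field w -> 0 < t ->
  summ torus (fun x => \sum_i slice u i (x, t) * slice w i (x, t)) ->
  helicity u w t =
  (Rintegral torus setT (fun x => \sum_i slice u i (x, t) * slice w i (x, t)))%:E.
Proof.
move=> hu hw t0 s; rewrite -I_EFin// -integral_torus; last first.
  by apply: measurableT_comp => //; exact: summ_meas s.
rewrite /helicity; congr (integral _ _ _); apply/funext => x; congr (_%:E).
by apply: eq_bigr => i _; rewrite !slice_pos.
Qed.

Theorem corollary1p2 (R : realType) (theta alpha : R) (r kappa : \bar R)
    (u omega : R -> vec R -> vec R)
    (htheta : 0 < theta < 1) (halpha : 0 < alpha < 1)
    (hr : (1 <= r)%E) (hkappa : (1 <= kappa)%E)
    (hconj : (r^-1 + kappa^-1 = 1)%E)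
    (hu : in_Lt (2%:E * r)%E (holder_norm theta) u)
    (heuler : euler_weak_solution u)
    (hcurl : is_curl u omega)
    (homega : in_Lt kappa (sobolev_norm alpha) omega)
    (hreg : 1 <= 2 * theta + alpha) :
  exists c : R,
    {ae @lebesgue_measure R, forall t, 0 < t -> helicity u omega t = c%:E}.
Proof.
have [tu au nu] := hu; have [tw aw nw] := homega.
have /andP[al0 al1] := halpha.
have th0 : 0 < (1 - alpha) / 2 by lra.
have thle : (1 - alpha) / 2 <= theta by lra.
have [g [mg g0 gle gb]] := holder_majorant th0 thle tu.
have [n [mn n0 nle nb]] := sobolev_majorant al0 tw.
have r2 : (1 <= 2%:E * r)%E.
  rewrite -[leLHS]mule1; apply: lee_pmul => //; first by rewrite lee_fin ler1n.
have mg2 : measurable_fun setT (fun t => g t ^+ 2) by exact: measurable_funX.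
have g20 t : 0 <= g t ^+ 2 by rewrite exprn_ge0.
have cg := Lcontrol_Lnorm r2 mg g0 gle nu.
have cg2 := Lcontrol_sq hr mg g0 cg.
have cn := Lcontrol_Lnorm hkappa mn n0 nle nw.
have lg := Lcontrol1 r2 mg g0 cg.
have lg2 := Lcontrol1 hr mg2 g20 cg2.
have ln := Lcontrol1 hkappa mn n0 cn.
have lg2n := Lcontrol_mul hr hkappa hconj mg2 mn g20 n0 cg2 cn.
have reg : {ae (@time R), forall t, 0 < t -> regular_time alpha u omega g n t}.
  apply: (filterS2 _ _ ((ae_time _).1 au) ((ae_time _).1 aw)) => t ht1 ht2 t0.
  have [b h] := gb t t0 (ht1 t0); have [s sb q qb] := nb t t0 (ht2 t0).
  split=> //.
  - by move=> x i; rewrite slice_pos.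
  - by move=> x y i; rewrite !slice_pos.
have typ := ae_typical_time tu tw lg ln reg heuler hcurl.
have [t0 [_ _ tt0]] := ae_pos_dense typ (@ltr01 R) (ltr1n R 2).
exists (Rintegral torus setT (fun x => \sum_i slice u i (x, t0) * slice omega i (x, t0))).
apply/ae_time; apply: filterS typ => t ht tpos; have tt := ht tpos.
have [_ [b _ s _ _] _] := tt.
rewrite helicity_slices//; last first.
  apply: summ_sum => i; under [fun _ => _]funext => x do rewrite mulrC.
  by apply: (@summM_bounded _ _ _ _ _ _ (g t) (s i).1) => [|x]; [exact: measurable_sl|exact: b].
congr (_%:E).
have [lt|gt|<-//] := ltgtP t t0.
- by symmetry; apply: (helicity_conserved halpha tu tw g0 lg lg2 ln lg2n reg heuler hcurl).
- have t00 : 0 < t0 by case: tt0.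
  by apply: (helicity_conserved halpha tu tw g0 lg lg2 ln lg2n reg heuler hcurl).
Qed.
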